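(* Let $N>2$ and assume $f_1$, $\alpha_*$ and $f_2$ satisfy $(H_1)$–$(H_5)$ below. Then there exist positive constants $\bar\epsilon$ and $\bar A$ such that for every $0<\epsilon<\bar\epsilon$ and every $A>\bar A$, the problem $$\Delta u+f(u)=0\ \text{in }\mathbb R^N,\qquad \lim_{|x|\to\infty}u(x)=0,$$ with $$f(s)=\begin{cases}f_1(s), & 0\le s\le\alpha_*+\epsilon,\\ L(s), & \alpha_*+\epsilon\le s\le\alpha_*+2\epsilon,\\ A^2f_2(s), & s\ge\alpha_*+2\epsilon,\end{cases}$$ (extended to negative $s$ as an odd function) has at least two (radial) ground state solutions.
   Context: $L$ denotes the affine function whose graph is the segment from $(\alpha_*+\epsilon,f_1(\alpha_*+\epsilon))$ to $(\alpha_*+2\epsilon,A^2f_2(\alpha_*+2\epsilon))$. A ground state is a nonnegative, nontrivial solution (a solution that vanishes identically after a double zero, i.e. has compact support, is also allowed). Hypotheses: $(H_1)$ $f_1\in C[0,\infty)\cap C^1(0,\infty)$, $f_1(0)=0$, there is $b\ge0$ with $f_1(s)>0$ for $s>b$, $f_1(s)\le0$ on $[0,b]$, and $f_1<0$ on $(0,\epsilon_0)$ for some $\epsilon_0>0$; with $F_1(s)=\int_0^sf_1(t)\,dt$, there is a unique finite $\beta\ge b$ with $F_1(\beta)=0$. $(H_2)$ $(F_1/f_1)'(s)>(N-2)/(2N)$ for all $s>\beta$. $(H_3)$ $f_1(s)/(s-b)$ is increasing for $s>b$. $(H_4)$ $\alpha_*>0$ is such that the solution of $u''+\frac{N-1}{r}u'+f_1(u)=0$,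 $u(0)=\alpha_*$, $u'(0)=0$ is a ground state (positive and tending to $0$ at infinity). $(H_5)$ $f_2$ is a positive continuous function on $[\alpha_*,\gamma)$ for some $\alpha_*<\gamma\le\infty$ (and $f$ is considered on $[0,\gamma)$). *)

(* Defs.v *)
From Stdlib Require Import Reals.
From Coquelicot Require Import Coquelicot.
Open Scope R_scope.

Definition prim (f1 : R -> R) (s : R) : R := RInt f1 0 s.

(* (H1) with b and beta given explicitly (both are determined by f1). *)
Definition H1 (f1 : R -> R) (b beta : R) : Prop :=
  (forall s, 0 <= s ->
     filterlim f1 (within (fun t => 0 <= t) (locally s)) (locally (f1 s))) /\
  (forall s, 0 < s -> ex_derive f1 s /\ continuous (Derive f1) s) /\
  f1 0 = 0 /\
  0 <= b /\
  (forall s, b < s -> 0 < f1 s) /\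
  (forall s, 0 <= s <= b -> f1 s <= 0) /\
  (exists eps0, 0 < eps0 /\ forall s, 0 < s < eps0 -> f1 s < 0) /\
  b <= beta /\ prim f1 beta = 0 /\
  (forall s, b <= s -> prim f1 s = 0 -> s = beta).

Definition H2 (N : nat) (f1 : R -> R) (beta : R) : Prop :=
  forall s, beta < s ->
    Derive (fun t => prim f1 t / f1 t) s > (INR N - 2) / (2 * INR N).

Definition H3 (f1 : R -> R) (b : R) : Prop :=
  forall s t, b < s -> s < t -> f1 s / (s - b) < f1 t / (t - b).

(* Radial solution of  Delta u + f(u) = 0  in R^N : the profile u(r), r >= 0,
   with u in C^2(0,oo) /\ C^1[0,oo), u'(0) = 0. *)
Definition radial_sol (N : nat) (f : R -> R) (u : R -> R) : Prop :=
  (forall r, 0 < r ->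
     ex_derive u r /\ ex_derive (Derive u) r /\
     continuous (Derive (Derive u)) r /\
     Derive (Derive u) r + (INR N - 1) / r * Derive u r + f (u r) = 0) /\
  filterlim u (at_right 0) (locally (u 0)) /\
  filterlim (Derive u) (at_right 0) (locally 0).

Definition H4 (N : nat) (f1 : R -> R) (alpha : R) : Prop :=
  0 < alpha /\
  exists u : R -> R, radial_sol N f1 u /\ u 0 = alpha /\
    (forall r, 0 <= r -> 0 < u r) /\ is_lim u p_infty 0.

Definition H5 (f2 : R -> R) (alpha : R) (gamma : Rbar) : Prop :=
  Rbar_lt alpha gamma /\
  forall s, alpha <= s -> Rbar_lt s gamma ->
    0 < f2 s /\
    filterlim f2 (within (fun t => alpha <= t /\ Rbar_lt t gamma) (locally s))
      (locally (f2 s)).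

Definition Lseg (f1 f2 : R -> R) (alpha eps A s : R) : R :=
  f1 (alpha + eps) +
  (A ^ 2 * f2 (alpha + 2 * eps) - f1 (alpha + eps)) * (s - (alpha + eps)) / eps.

Definition fpos (f1 f2 : R -> R) (alpha eps A s : R) : R :=
  if Rle_dec s (alpha + eps) then f1 s
  else if Rle_dec s (alpha + 2 * eps) then Lseg f1 f2 alpha eps A s
  else A ^ 2 * f2 s.

Definition fglued (f1 f2 : R -> R) (alpha eps A s : R) : R :=
  if Rle_dec 0 s then fpos f1 f2 alpha eps A s
  else - fpos f1 f2 alpha eps A (- s).

(* (radial) ground state: nonnegative, nontrivial radial solution tending to 0
   at infinity (compactly supported ones included), with values in [0,gamma)
   where f is considered. *)
Definition ground_state (N : nat) (f : R -> R) (gamma : Rbar) (u : R -> R) : Prop :=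
  radial_sol N f u /\
  (forall r, 0 <= r -> 0 <= u r /\ Rbar_lt (u r) gamma) /\
  (exists r, 0 <= r /\ u r <> 0) /\
  is_lim u p_infty 0.

(* Main.v *)
Require Import Defs.
From mathcomp Require filter.
From Stdlib Require Import Reals Lra Lia Classical ClassicalEpsilon.
From Coquelicot Require Import Coquelicot.
Open Scope R_scope.

(** The given ground state [u] is one of the two solutions, because the
nonlinearity is unchanged below [alpha + eps].  The second one is found by
shooting from [a = alpha + eps] up to [c = alpha + h] with a fixed small [h].

Two decreasing solutions are compared in the level variable [s = u].  Let [F]
be the primitive of [f1], [r] the radius and [p = - u'] the slope.  The quantity
[Q = 2 N F / f1 - r p - 2 F r / p] is the Pohozaev functional of Erbe and Tang
divided by [r ^ (N-1) p]; by (H2) it is negative above [beta] along a solution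
started at its centre.  If at some level solution 1 has the smaller slope and
the larger [Q], then [r1 ^ (N-1) p1 (Q1 - Q2)] grows as [s] decreases to [beta],
and below [beta] so does [W2 - W1], where [W = r sqrt (p ^ 2 + 2 F)].  Hence
[p1 < p2] persists down to level [0] and [W2] stays away from [0], which is
impossible for a solution 2 that never becomes negative.
- With [u] as solution 1, the solution started at [a > alpha] must become negative.
- With [u] as solution 2, the solution started at [c] must stay positive when
  [A] is large: after an initial layer of radius of order [1 / A] it has dropped
  to a nearly flat part strictly below [alpha], at a tiny radius, where the
  comparison with [u] could be started if it ever reached [0].

Initial value problems may have several solutions, as [f2] is only continuous
and [f1] need not be Lipschitz at [0].  So the intermediate value theorem is
applied to the minimum over [[0, T]] of delayed (Tonelli) approximations, which
depend continuously on the initial value; a solution that is nonnegative and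
has nonnegative energy up to its first zero is then obtained by letting the
delay tend to [0] and [T] to infinity. *)

(** The comparison is asymmetric, and this decides which solution plays which role. The weight
    [r1 ^ (N-1) p1] is an integrating factor that removes [Q1] from the derivative, so only [Q2]
    needs a sign, while solution 1 needs only positive energy below [beta]. The glued nonlinearity
    need not satisfy (H2), so a solution started at [c] comes without control of [Q] and can only be
    solution 1.

    The monotone quantity has to change at [beta]: [Q] divides by [f1], which vanishes at [b], and
    (H2) is available only above [beta], whereas the derivative of [W] contains neither [f1] nor
    [r]. At [beta], where [F = 0], both differences equal [r2 p2 - r1 p1], so the gap won above is
    handed over intact. It bounds [W2] from below, against [r p] becoming arbitrarily small along a
    nonnegative solution in dimension at least 3.

    Nonnegative energy is carried through the limit because nonnegativity alone would not force
    decay: a solution could settle near the zero [b] of [f1], where the energy is negative. *)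

Ltac minmax := unfold Rmin, Rmax in *; repeat destruct Rle_dec; lra.

(** * Elementary real analysis: monotonicity, first and last zeros, signs of derivatives *)

Lemma continuous_pt (g : R -> R) x : continuous g x -> continuity_pt g x.
Proof. intros H; apply continuity_pt_filterlim; exact H. Qed.

Lemma derive_continuous (g : R -> R) x l : is_derive g x l -> continuous g x.
Proof. intros H; apply (ex_derive_continuous g); exists l; exact H. Qed.

Lemma Derive_eq (g : R -> R) x l : is_derive g x l -> Derive (fun t : R => g t) x = l.
Proof. exact (is_derive_unique g x l). Qed.

Lemma nonincr_le (g g' : R -> R) a b :
  a <= b ->
  (forall x, a <= x <= b -> continuous g x) ->
  (forall x, a < x < b -> is_derive g x (g' x)) ->
  (forall x, a < x < b -> g' x <= 0) -> g b <= g a.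
Proof.
intros Hab Hc Hd Hn.
(* The mean value point is only known to lie in the closed interval, while [g'] is controlled in the
   open one; the default value 0 has the right sign if the point is an endpoint. *)
destruct (MVT_gen g a b (fun x => if Rlt_dec a x then if Rlt_dec x b then g' x else 0 else 0))
  as [c [Hc1 Hc2]].
- rewrite Rmin_left, Rmax_right by lra. intros x Hx.
  destruct (Rlt_dec a x); [|lra]. destruct (Rlt_dec x b); [|lra]. now apply Hd.
- rewrite Rmin_left, Rmax_right by lra. intros x Hx. now apply continuous_pt, Hc.
- rewrite Rmin_left, Rmax_right in Hc1 by lra.
  assert (K : (if Rlt_dec a c then if Rlt_dec c b then g' c else 0 else 0) <= 0).
  { destruct (Rlt_dec a c); [|lra]. destruct (Rlt_dec c b); [|lra]. now apply Hn. }
  revert Hc2 K. generalize (if Rlt_dec a c then if Rlt_dec c b then g' c else 0 else 0).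
  intros y H1 H2. nra.
Qed.

Lemma decr_lt (g g' : R -> R) a b :
  a < b ->
  (forall x, a <= x <= b -> continuous g x) ->
  (forall x, a < x < b -> is_derive g x (g' x)) ->
  (forall x, a < x < b -> g' x < 0) -> g b < g a.
Proof.
intros Hab Hc Hd Hn.
(* Here the default is -1, so that the sign stays strict at an endpoint. *)
destruct (MVT_gen g a b (fun x => if Rlt_dec a x then if Rlt_dec x b then g' x else -1 else -1))
  as [c [Hc1 Hc2]].
- rewrite Rmin_left, Rmax_right by lra. intros x Hx.
  destruct (Rlt_dec a x); [|lra]. destruct (Rlt_dec x b); [|lra]. now apply Hd.
- rewrite Rmin_left, Rmax_right by lra. intros x Hx. now apply continuous_pt, Hc.
- rewrite Rmin_left, Rmax_right in Hc1 by lra.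
  assert (K : (if Rlt_dec a c then if Rlt_dec c b then g' c else -1 else -1) < 0).
  { destruct (Rlt_dec a c); [|lra]. destruct (Rlt_dec c b); [|lra]. now apply Hn. }
  revert Hc2 K. generalize (if Rlt_dec a c then if Rlt_dec c b then g' c else -1 else -1).
  intros y H1 H2. nra.
Qed.

Lemma continuous_eps (g : R -> R) x e :
  continuous g x -> 0 < e ->
  exists d, 0 < d /\ forall y, Rabs (y - x) < d -> Rabs (g y - g x) < e.
Proof.
intros Hc He.
destruct (proj1 (filterlim_locally g (g x)) Hc (mkposreal e He)) as [d Hd].
exists d; split; [apply cond_pos|]. intros y Hy. exact (Hd y Hy).
Qed.

Lemma eps_continuous (g : R -> R) x :
  (forall e, 0 < e -> exists d, 0 < d /\ forall y, Rabs (y - x) < d -> Rabs (g y - g x) < e) ->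
  continuous g x.
Proof.
intros H. apply (proj2 (filterlim_locally g (g x))). intros e.
destruct (H e (cond_pos e)) as [d [Hd K]].
exists (mkposreal d Hd). intros y Hy. exact (K y Hy).
Qed.

Lemma continuous_pos (g : R -> R) x :
  continuous g x -> 0 < g x ->
  exists d, 0 < d /\ forall y, Rabs (y - x) < d -> 0 < g y.
Proof.
intros Hc Hp. destruct (continuous_eps g x (g x) Hc Hp) as [d [Hd K]].
exists d; split; auto. intros y Hy. specialize (K y Hy).
apply Rabs_def2 in K. lra.
Qed.

(** The supremum of the points up to which [g] stays positive; the intermediate value theorem would
    give some zero, not the first one. *)
Lemma first_zero (g : R -> R) a b :
  a <= b -> (forall x, a <= x <= b -> continuous g x) -> 0 < g a -> g b <= 0 ->
  exists c, a < c <= b /\ g c = 0 /\ forall x, a <= x < c -> 0 < g x.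
Proof.
intros Hab Hc Ha Hb.
destruct (completeness (fun x => a <= x <= b /\ forall y, a <= y <= x -> 0 < g y))
  as [c [Hc1 Hc2]].
- exists b. intros x Hx; lra.
- exists a. split; [lra|]. intros y Hy. replace y with a by lra. auto.
- assert (Hac : a <= c). { apply Hc1. split; [lra|]. intros y Hy. replace y with a by lra. auto. }
  assert (Hcb : c <= b). { apply Hc2. intros x Hx; lra. }
  assert (Hlt : forall x, a <= x < c -> 0 < g x).
  { intros x Hx. apply NNPP. intros Hn.
    assert (c <= x); [|lra]. apply Hc2. intros y [Hy1 Hy2].
    apply Rnot_lt_le. intros Hxy. apply Hn, Hy2. lra. }
  assert (Hgc : g c = 0).
  { destruct (Rtotal_order (g c) 0) as [H|[H|H]]; auto.
    - destruct (continuous_pos (fun x => - g x) c) as [d [Hd K]].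
      { apply (continuous_opp g); apply Hc; lra. } { lra. }
      destruct (Req_dec a c) as [E|E]; [subst; lra|].
      assert (0 < - g (Rmax a (c - d/2))).
      { apply K. apply Rabs_def1; minmax. }
      assert (0 < g (Rmax a (c - d/2))).
      { apply Hlt. minmax. }
      lra.
    - destruct (continuous_pos g c (Hc c (conj Hac Hcb)) H) as [d [Hd K]].
      destruct (Req_dec c b) as [E|E]; [subst; lra|].
      assert (Rmin b (c + d/2) <= c).
      { apply Hc1. split. { minmax. }
        intros y Hy. destruct (Rlt_le_dec y c); [apply Hlt; lra|].
        apply K. apply Rabs_def1; minmax. }
      minmax. }
  exists c. repeat split; auto.
  destruct (Req_dec a c) as [E|E]; [subst; lra| lra].
Qed.

Lemma last_zero (g : R -> R) a b :
  a <= b -> (forall x, a <= x <= b -> continuous g x) -> g a <= 0 -> 0 < g b ->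
  exists c, a <= c < b /\ g c = 0 /\ forall x, c < x <= b -> 0 < g x.
Proof.
intros Hab Hc Ha Hb.
destruct (first_zero (fun x => g (- x)) (- b) (- a)) as [c [H1 [H2 H3]]].
- lra.
- intros x Hx. apply (continuous_comp Ropp g).
  + apply (derive_continuous Ropp x (-1)). auto_derive; auto; ring.
  + apply Hc; lra.
- rewrite Ropp_involutive; auto.
- rewrite Ropp_involutive; auto.
- exists (- c). repeat split; try lra. intros x Hx.
  rewrite <- (Ropp_involutive x). apply H3. lra.
Qed.

Lemma deriv_right_nonneg (g : R -> R) x b l :
  is_derive g x l -> g x = 0 -> x < b -> (forall y, x < y < b -> 0 < g y) -> 0 <= l.
Proof.
intros Hd H0 Hb Hp. apply Rnot_lt_le. intros Hl.
apply is_derive_Reals in Hd.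
destruct (Hd (- l) ltac:(lra)) as [[e He] K]; simpl in K.
set (h := Rmin (e/2) ((b-x)/2)).
assert (Hh : 0 < h /\ h < e /\ h < b - x).
{ unfold h; minmax. }
specialize (K h ltac:(lra) ltac:(rewrite Rabs_right; lra)).
rewrite H0, Rminus_0_r in K. apply Rabs_def2 in K.
assert (0 < g (x + h)) by (apply Hp; lra).
assert (0 < g (x+h) / h) by (apply Rdiv_lt_0_compat; lra). lra.
Qed.

Lemma deriv_left_nonpos (g : R -> R) x a l :
  is_derive g x l -> g x = 0 -> a < x -> (forall y, a < y < x -> 0 < g y) -> l <= 0.
Proof.
intros Hd H0 Ha Hp.
assert (0 <= - l); [|lra].
apply (deriv_right_nonneg (fun y => g (- y)) (- x) (- a)).
- replace (- l) with (scal (-1) l) by (unfold scal; simpl; unfold mult; simpl; ring).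
  apply (is_derive_comp g Ropp).
  + rewrite Ropp_involutive; auto.
  + auto_derive; auto; try ring.
- rewrite Ropp_involutive; auto.
- lra.
- intros y Hy. apply Hp; lra.
Qed.

(** * Comparison of two solutions in the level variable *)

(* The inverse function [r] of a decreasing radial profile [u] and its slope
   [p = - u' o r], both as functions of the level [s = u]. *)
Record level_sol (n : R) (f r p : R -> R) (l s1 : R) : Prop := {
  level_r : forall s, l < s < s1 -> 0 < r s;
  level_p : forall s, l < s < s1 -> 0 < p s;
  level_dr : forall s, l < s < s1 -> is_derive r s (- / p s);
  level_dp : forall s, l < s < s1 -> is_derive p s (n / r s - f s / p s) }.

(* The Erbe-Tang form of the Pohozaev functional, divided by [r ^ (N-1) * p]; here [N = n + 1]. *)
Definition erbe_tang (n fs Fs r p : R) : R :=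
  2 * (n + 1) * (Fs / fs) - r * p - 2 * Fs * (r / p).

(** With [T = r p + 2 F r / p] and [Q = erbe_tang], each solution satisfies
    [T' = n - 1 - f Q / p^2], and [T2 - T1 = Q1 - Q2]. The weight [r1^d p1] has logarithmic
    derivative [- f / p1^2], which cancels the contribution of [Q1] and leaves [Q2] alone. *)
Lemma derive_erbe_tang_diff (d : nat) (f F r1 p1 r2 p2 : R -> R) l s1 s :
  (1 <= d)%nat -> level_sol (INR d) f r1 p1 l s1 -> level_sol (INR d) f r2 p2 l s1 ->
  l < s < s1 -> is_derive F s (f s) -> f s <> 0 ->
  is_derive (fun t => r1 t ^ d * p1 t *
      ((r2 t * p2 t + 2 * F t * (r2 t / p2 t)) - (r1 t * p1 t + 2 * F t * (r1 t / p1 t)))) s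
    (r1 s ^ d * p1 s * f s * erbe_tang (INR d) (f s) (F s) (r2 s) (p2 s) *
      (/ (p1 s)^2 - / (p2 s)^2)).
Proof.
intros Hd L1 L2 Hs HF Hf.
pose proof (level_r _ _ _ _ _ _ L1 s Hs) as R1.
pose proof (level_p _ _ _ _ _ _ L1 s Hs) as P1.
pose proof (level_dr _ _ _ _ _ _ L1 s Hs) as DR1.
pose proof (level_dp _ _ _ _ _ _ L1 s Hs) as DP1.
pose proof (level_r _ _ _ _ _ _ L2 s Hs) as R2.
pose proof (level_p _ _ _ _ _ _ L2 s Hs) as P2.
pose proof (level_dr _ _ _ _ _ _ L2 s Hs) as DR2.
pose proof (level_dp _ _ _ _ _ _ L2 s Hs) as DP2.
auto_derive.
- repeat split; try (eexists; eassumption); lra.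
- rewrite (Derive_eq _ _ _ DR1), (Derive_eq _ _ _ DP1),
    (Derive_eq _ _ _ DR2), (Derive_eq _ _ _ DP2), (Derive_eq _ _ _ HF).
  destruct d as [|d]; [lia|]. simpl Nat.pred. unfold erbe_tang.
  rewrite <- !tech_pow_Rmult. field. lra.
Qed.

(** The term [- f] in [p p'] cancels against the derivative of [F], and the factor [r] against
    [n / r]. What remains depends on [p] and [F] only, so two solutions can be compared through
    their slopes even where [f] changes sign. *)
Lemma derive_erbe_tang_weight (n : R) (f F r p : R -> R) l s1 s :
  level_sol n f r p l s1 -> l < s < s1 -> is_derive F s (f s) -> 0 < p s ^ 2 + 2 * F s ->
  is_derive (fun t => r t * sqrt (p t ^ 2 + 2 * F t)) s
    (n * (p s / sqrt (p s ^ 2 + 2 * F s)) - sqrt (p s ^ 2 + 2 * F s) / p s).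
Proof.
intros L1 Hs HF HE.
pose proof (level_r _ _ _ _ _ _ L1 s Hs) as R1.
pose proof (level_p _ _ _ _ _ _ L1 s Hs) as P1.
pose proof (level_dr _ _ _ _ _ _ L1 s Hs) as DR1.
pose proof (level_dp _ _ _ _ _ _ L1 s Hs) as DP1.
auto_derive.
- repeat split; try (eexists; eassumption); simpl in HE; lra.
- rewrite (Derive_eq _ _ _ DR1), (Derive_eq _ _ _ DP1), (Derive_eq _ _ _ HF).
  replace (p s * (p s * 1) + 2 * F s) with (p s ^ 2 + 2 * F s) by ring.
  assert (0 < sqrt (p s ^ 2 + 2 * F s)) by now apply sqrt_lt_R0.
  set (q := sqrt (p s ^ 2 + 2 * F s)) in *. field. lra.
Qed.

(** Both terms are monotone functions of [sqrt (p^2 + c) / p = sqrt (1 + c / p^2)], which increases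
    with [p] because [c < 0]; here [c] stands for [2 F]. *)
Lemma slope_ratio_mono (n c p1 p2 : R) :
  0 <= n -> c < 0 -> 0 < p1 <= p2 -> 0 < p1 ^ 2 + c ->
  n * (p2 / sqrt (p2 ^ 2 + c)) - sqrt (p2 ^ 2 + c) / p2 <=
  n * (p1 / sqrt (p1 ^ 2 + c)) - sqrt (p1 ^ 2 + c) / p1.
Proof.
intros Hn Hc Hp HE.
assert (HE2 : 0 < p2 ^ 2 + c) by nra.
pose proof (sqrt_lt_R0 _ HE) as S1. pose proof (sqrt_lt_R0 _ HE2) as S2.
assert (Q1 := sqrt_sqrt _ (Rlt_le _ _ HE)). assert (Q2 := sqrt_sqrt _ (Rlt_le _ _ HE2)).
set (q1 := sqrt (p1 ^ 2 + c)) in *. set (q2 := sqrt (p2 ^ 2 + c)) in *.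
assert (K : q1 * p2 <= q2 * p1).
{ apply Rsqr_incr_0; [|nra|nra]. unfold Rsqr.
  replace (q1 * p2 * (q1 * p2)) with (q1 * q1 * (p2 * p2)) by ring.
  replace (q2 * p1 * (q2 * p1)) with (q2 * q2 * (p1 * p1)) by ring.
  rewrite Q1, Q2.
  assert (0 <= - c * ((p2 - p1) * (p2 + p1))) by (repeat apply Rmult_le_pos; lra).
  replace ((p2 ^ 2 + c) * (p1 * p1)) with
    ((p1 ^ 2 + c) * (p2 * p2) + - c * ((p2 - p1) * (p2 + p1))) by ring. lra. }
assert (K1 : q1 / p1 <= q2 / p2).
{ apply (Rmult_le_reg_r (p1 * p2)); [nra|].
  replace (q1 / p1 * (p1 * p2)) with (q1 * p2) by (field; lra).
  replace (q2 / p2 * (p1 * p2)) with (q2 * p1) by (field; lra). auto. }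
assert (K2 : p2 / q2 <= p1 / q1).
{ apply (Rmult_le_reg_r (q1 * q2)); [nra|].
  replace (p2 / q2 * (q1 * q2)) with (q1 * p2) by (field; lra).
  replace (p1 / q1 * (q1 * q2)) with (q2 * p1) by (field; lra). auto. }
nra.
Qed.

(* Where the slopes first agree again (going down), the monotone quantities
   force [r1 < r2], and then [(p1 - p2)' = n (1/r1 - 1/r2) > 0] is absurd. *)
Lemma level_compare (d : nat) (f F r1 p1 r2 p2 : R -> R) l beta s0 s1 :
  (1 <= d)%nat ->
  level_sol (INR d) f r1 p1 l s1 -> level_sol (INR d) f r2 p2 l s1 ->
  0 <= l < beta -> beta < s0 < s1 ->
  (forall s, 0 < s -> is_derive F s (f s)) ->
  (forall s, beta <= s -> 0 < f s) ->
  (forall s, 0 < s < beta -> F s < 0) ->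
  (forall s, beta <= s -> 0 <= F s) ->
  (forall s, l < s < beta -> 0 < p1 s ^ 2 + 2 * F s) ->
  (forall s, beta <= s <= s0 -> erbe_tang (INR d) (f s) (F s) (r2 s) (p2 s) < 0) ->
  p1 s0 < p2 s0 ->
  erbe_tang (INR d) (f s0) (F s0) (r2 s0) (p2 s0) <
    erbe_tang (INR d) (f s0) (F s0) (r1 s0) (p1 s0) ->
  F beta = 0 ->
  (forall s, l < s <= s0 -> p1 s < p2 s) /\
  exists delta, 0 < delta /\ forall s, l < s < beta ->
    r1 s * sqrt (p1 s ^ 2 + 2 * F s) + delta <= r2 s * sqrt (p2 s ^ 2 + 2 * F s).
Proof.
intros Hd L1 L2 Hl Hs0 HF Hf HFn HFp HE HQ Hp0 HQ0 Hb.
assert (Rp1 := level_r _ _ _ _ _ _ L1). assert (Pp1 := level_p _ _ _ _ _ _ L1).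
assert (Rp2 := level_r _ _ _ _ _ _ L2). assert (Pp2 := level_p _ _ _ _ _ _ L2).
assert (Hn : 1 <= INR d) by (apply (le_INR 1); auto).
assert (Hcont : forall s, l < s < s1 -> continuous (fun t => p2 t - p1 t) s).
{ intros s Hs. apply (continuous_minus p2 p1); eapply derive_continuous;
  [apply (level_dp _ _ _ _ _ _ L2)|apply (level_dp _ _ _ _ _ _ L1)]; auto. }
assert (Hcross : forall c b, l < c < s1 -> c < b -> (forall x, c < x <= b -> 0 < p2 x - p1 x) ->
   p2 c - p1 c = 0 -> r1 c < r2 c -> False).
{ intros c b Hc Hcb Hpos H0 Hr.
  assert (K : 0 <= INR d / r2 c - f c / p2 c - (INR d / r1 c - f c / p1 c)).
  { apply (deriv_right_nonneg (fun t => p2 t - p1 t) c b).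
    - apply (is_derive_minus p2 p1); [apply (level_dp _ _ _ _ _ _ L2)|apply (level_dp _ _ _ _ _ _ L1)]; auto.
    - auto. - auto. - intros y Hy; apply Hpos; lra. }
  replace (p2 c) with (p1 c) in K by lra.
  assert (/ r2 c < / r1 c).
  { apply Rinv_lt_contravar; auto. apply Rmult_lt_0_compat; auto. }
  unfold Rdiv in K. nra. }
(* This is [Q1 - Q2]: the common term in [F / f] cancels. *)
set (D := fun t => (r2 t * p2 t + 2 * F t * (r2 t / p2 t)) - (r1 t * p1 t + 2 * F t * (r1 t / p1 t))).
(* As long as [p1 < p2], the factor [/ p1^2 - / p2^2] is positive and [Q2] is negative, so the
   weighted difference can only grow on the way down from [s0]. *)
assert (HD : forall c, beta <= c < s0 -> (forall x, c < x <= s0 -> 0 < p2 x - p1 x) -> 0 < D c).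
{ intros c Hc Hpos.
  assert (K : r1 s0 ^ d * p1 s0 * D s0 <= r1 c ^ d * p1 c * D c).
  { assert (HdD : forall x, c <= x <= s0 -> is_derive (fun t => r1 t ^ d * p1 t * D t) x
      (r1 x ^ d * p1 x * f x * erbe_tang (INR d) (f x) (F x) (r2 x) (p2 x) *
        (/ (p1 x)^2 - / (p2 x)^2))).
    { intros x Hx. apply (derive_erbe_tang_diff d f F r1 p1 r2 p2 l s1); auto; try lra.
      apply HF; lra. assert (0 < f x) by (apply Hf; lra). lra. }
    eapply (nonincr_le (fun t => r1 t ^ d * p1 t * D t)); [lra| |intros x Hx; apply HdD; lra|].
    - intros x Hx. eapply derive_continuous, HdD; lra.
    - intros x Hx. simpl.
      assert (0 < p1 x) by (apply Pp1; lra). assert (0 < f x) by (apply Hf; lra).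
      assert (0 < r1 x ^ d) by (apply pow_lt, Rp1; lra).
      assert (p1 x < p2 x) by (specialize (Hpos x); lra).
      assert (erbe_tang (INR d) (f x) (F x) (r2 x) (p2 x) < 0) by (apply HQ; lra).
      assert (/ (p2 x * (p2 x * 1)) <= / (p1 x * (p1 x * 1))).
      { apply Rinv_le_contravar; nra. }
      assert (0 < r1 x ^ d * p1 x * f x) by (repeat apply Rmult_lt_0_compat; auto).
      assert (r1 x ^ d * p1 x * f x * erbe_tang (INR d) (f x) (F x) (r2 x) (p2 x) < 0) by nra.
      nra. }
  assert (0 < D s0). { unfold D. unfold erbe_tang in HQ0. lra. }
  assert (0 < r1 s0 ^ d * p1 s0) by (apply Rmult_lt_0_compat; [apply pow_lt, Rp1|apply Pp1]; lra).
  assert (0 < r1 c ^ d * p1 c) by (apply Rmult_lt_0_compat; [apply pow_lt, Rp1|apply Pp1]; lra).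
  assert (0 < r1 s0 ^ d * p1 s0 * D s0) by (apply Rmult_lt_0_compat; auto).
  nra. }
assert (Hup : forall s, beta <= s <= s0 -> p1 s < p2 s).
{ intros s Hs. apply NNPP. intros Hn'.
  destruct (last_zero (fun t => p2 t - p1 t) s s0) as [c [Hc1 [Hc2 Hc3]]]; try lra.
  { intros x Hx. apply Hcont. lra. }
  apply (Hcross c s0); auto; try lra.
  assert (HDc := HD c ltac:(lra) Hc3).
  (* At equal slopes [D] becomes [(r2 - r1) (p + 2 F / p)] with [F >= 0], hence it has the sign of
     [r2 - r1]. *)
  unfold D in HDc. replace (p2 c) with (p1 c) in HDc by lra.
  assert (0 < p1 c) by (apply Pp1; lra). assert (0 <= F c) by (apply HFp; lra).
  assert (0 < (r2 c - r1 c) * (p1 c + 2 * (F c * / p1 c))).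
  { replace ((r2 c - r1 c) * (p1 c + 2 * (F c * / p1 c)))
      with ((r2 c * p1 c + 2 * F c * (r2 c / p1 c)) - (r1 c * p1 c + 2 * F c * (r1 c / p1 c))) by (field; lra).
    auto. }
  assert (0 <= F c * / p1 c). { apply Rmult_le_pos; auto. left. now apply Rinv_0_lt_compat. }
  nra. }
assert (HDb : r1 beta * p1 beta < r2 beta * p2 beta).
{ assert (K := HD beta ltac:(lra)). unfold D in K. rewrite Hb in K.
  assert (0 < r2 beta * p2 beta + 2 * 0 * (r2 beta / p2 beta) -
    (r1 beta * p1 beta + 2 * 0 * (r1 beta / p1 beta))); [|lra].
  apply K. intros x Hx. assert (p1 x < p2 x) by (apply Hup; lra). lra. }
(* At [beta] one has [F = 0], so [W] starts from the very gap [r2 p2 - r1 p1] that [D] has just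
   shown to be positive. *)
set (W := fun t => r2 t * sqrt (p2 t ^ 2 + 2 * F t) - r1 t * sqrt (p1 t ^ 2 + 2 * F t)).
set (delta := r2 beta * p2 beta - r1 beta * p1 beta).
assert (HWb : W beta = delta).
{ unfold W, delta. rewrite Hb, Rmult_0_r, !Rplus_0_r, !sqrt_pow2; auto; left; [apply Pp1|apply Pp2]; lra. }
assert (HW : forall c, l < c < beta -> (forall x, c < x <= beta -> 0 <= p2 x - p1 x) -> p1 c <= p2 c -> delta <= W c).
{ intros c Hc Hpos Hpc.
  assert (G : forall x, c <= x <= beta -> 0 < p1 x <= p2 x /\ 0 < p1 x ^ 2 + 2 * F x).
  { intros x Hx. assert (0 < p1 x) by (apply Pp1; lra). split.
    - split; auto. destruct (Req_dec c x); [subst; auto|]. specialize (Hpos x); lra.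
    - destruct (Req_dec x beta) as [->|]; [rewrite Hb; nra|]. apply HE; lra. }
  assert (HdW : forall x, c <= x <= beta -> is_derive W x
     ((INR d * (p2 x / sqrt (p2 x ^ 2 + 2 * F x)) - sqrt (p2 x ^ 2 + 2 * F x) / p2 x) -
      (INR d * (p1 x / sqrt (p1 x ^ 2 + 2 * F x)) - sqrt (p1 x ^ 2 + 2 * F x) / p1 x))).
  { intros x Hx. destruct (G x Hx) as [G1 G2].
    apply (is_derive_minus (fun t => r2 t * sqrt (p2 t ^ 2 + 2 * F t))
             (fun t => r1 t * sqrt (p1 t ^ 2 + 2 * F t)));
    eapply derive_erbe_tang_weight; eauto; try lra; try (apply HF; lra). nra. }
  rewrite <- HWb. eapply (nonincr_le W); [lra| |intros x Hx; apply HdW; lra|].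
  - intros x Hx. eapply derive_continuous, HdW; lra.
  - intros x Hx. simpl. destruct (G x ltac:(lra)) as [G1 G2].
    assert (K := slope_ratio_mono (INR d) (2 * F x) (p1 x) (p2 x) ltac:(lra)).
    assert (F x < 0) by (apply HFn; lra).
    specialize (K ltac:(lra) G1 G2). simpl in K |- *. lra. }
assert (Hall : forall s, l < s <= s0 -> p1 s < p2 s).
{ intros s Hs. destruct (Rle_lt_dec beta s) as [Hsb|Hsb]; [apply Hup; lra|].
  apply NNPP. intros Hn'.
  assert (p1 beta < p2 beta) by (apply Hup; lra).
  destruct (last_zero (fun t => p2 t - p1 t) s beta) as [c [Hc1 [Hc2 Hc3]]]; try lra.
  { intros x Hx. apply Hcont. lra. }
  apply (Hcross c beta); auto; try lra.
  (* At equal slopes the two square roots coincide, and [W c > 0] again says [r1 c < r2 c]. *)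
  assert (HWc := HW c ltac:(lra) ltac:(intros x Hx; left; auto) ltac:(lra)).
  unfold W in HWc. replace (p2 c) with (p1 c) in HWc by lra.
  assert (0 < sqrt (p1 c ^ 2 + 2 * F c)) by (apply sqrt_lt_R0, HE; lra).
  unfold delta in HWc. nra. }
split; auto. exists delta. split; [unfold delta; lra|].
intros s Hs. assert (K := HW s Hs).
assert (delta <= W s); [|unfold W in *; lra]. apply K.
- intros x Hx. assert (p1 x < p2 x) by (apply Hall; lra). lra.
- left; apply Hall; lra.
Qed.

(** * Radial profiles *)

(* A radial solution and [p = - u'], in dimension [d + 1]; the values at
   negative radii only serve to make continuity at [0] two-sided. *)
Record profile (d : nat) (f u p : R -> R) : Prop := {
  profile_u : forall r, 0 < r -> is_derive u r (- p r);
  profile_p : forall r, 0 < r -> is_derive p r (f (u r) - INR d / r * p r);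
  profile_cu0 : continuous u 0;
  profile_cp0 : continuous p 0;
  profile_p0 : p 0 = 0 }.

(** The part of (H1) that survives the gluing: after extension to the whole line, [f1] and the
    modified nonlinearity both satisfy it, with the same [b] and [beta]. *)
Record admissible (f F : R -> R) (b beta : R) : Prop := {
  admissible_cont : forall s, continuous f s;
  admissible_prim : forall s, is_derive F s (f s);
  admissible_F0 : F 0 = 0;
  admissible_b : 0 < b < beta;
  admissible_pos : forall s, b < s -> 0 < f s;
  admissible_neg : forall s, 0 < s < beta -> F s < 0;
  admissible_beta : F beta = 0 }.

Definition energy (F u p : R -> R) (r : R) : R := p r ^ 2 / 2 + F (u r).

Lemma prim_pos f F b beta s : admissible f F b beta -> beta < s -> 0 < F s.
Proof.
intros H Hs. assert (F beta = 0) by apply H.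
assert (- F s < - F beta); [|lra].
apply (decr_lt (fun x => - F x) (fun x => - f x)); auto.
- intros x _. apply (continuous_opp F). eapply derive_continuous, (admissible_prim _ _ _ _ H).
- intros x _. apply (is_derive_opp F), (admissible_prim _ _ _ _ H).
- intros x Hx. assert (0 < f x); [|lra]. apply (admissible_pos _ _ _ _ H).
  destruct (admissible_b _ _ _ _ H). lra.
Qed.

Lemma prim_ge0 f F b beta s : admissible f F b beta -> beta <= s -> 0 <= F s.
Proof.
intros H Hs. destruct (Req_dec s beta) as [->|]; [rewrite (admissible_beta _ _ _ _ H); lra|].
left. eapply prim_pos; eauto. lra.
Qed.

Lemma profile_cu d f u p r : profile d f u p -> 0 <= r -> continuous u r.
Proof.
intros H Hr. destruct (Req_dec r 0) as [->|]; [apply H|].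
eapply derive_continuous, (profile_u _ _ _ _ H). lra.
Qed.

Lemma profile_cp d f u p r : profile d f u p -> 0 <= r -> continuous p r.
Proof.
intros H Hr. destruct (Req_dec r 0) as [->|]; [apply H|].
eapply derive_continuous, (profile_p _ _ _ _ H). lra.
Qed.

Lemma energy_continuous d f F u p b beta r :
  profile d f u p -> admissible f F b beta -> 0 <= r -> continuous (energy F u p) r.
Proof.
intros H HA Hr. apply (continuous_plus (fun r => p r ^ 2 / 2) (fun r => F (u r))).
- apply (continuous_comp p (fun y => y ^ 2 / 2)).
  + eapply profile_cp; eauto.
  + apply (derive_continuous (fun y => y ^ 2 / 2) (p r) (p r)). auto_derive; auto; field.
- apply (continuous_comp u F).
  + eapply profile_cu; eauto.
  + eapply derive_continuous, (admissible_prim _ _ _ _ HA).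
Qed.

Lemma derive_energy d f F u p b beta r :
  profile d f u p -> admissible f F b beta -> 0 < r ->
  is_derive (energy F u p) r (- (INR d / r * p r ^ 2)).
Proof.
intros H HA Hr. unfold energy.
assert (DU := profile_u _ _ _ _ H r Hr). assert (DP := profile_p _ _ _ _ H r Hr).
assert (DF := admissible_prim _ _ _ _ HA (u r)).
auto_derive.
- repeat split; eexists; eassumption.
- rewrite (Derive_eq _ _ _ DU), (Derive_eq _ _ _ DP), (Derive_eq _ _ _ DF). field. lra.
Qed.

Lemma energy_le d f F u p b beta x y :
  profile d f u p -> admissible f F b beta -> 0 <= x <= y ->
  energy F u p y <= energy F u p x.
Proof.
intros H HA Hxy.
apply (nonincr_le _ (fun r => - (INR d / r * p r ^ 2))); try lra.
- intros r Hr. eapply energy_continuous; eauto. lra.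
- intros r Hr. eapply derive_energy; eauto. lra.
- intros r Hr. assert (0 <= INR d / r * p r ^ 2); [|lra].
  apply Rmult_le_pos; [|apply pow2_ge_0].
  apply Rmult_le_pos; [apply pos_INR|left; apply Rinv_0_lt_compat; lra].
Qed.

Lemma derive_flux d f u p r :
  profile d f u p -> (1 <= d)%nat -> 0 < r ->
  is_derive (fun t => t ^ d * p t) r (r ^ d * f (u r)).
Proof.
intros H Hd Hr. assert (DP := profile_p _ _ _ _ H r Hr).
auto_derive.
- eexists; eassumption.
- rewrite (Derive_eq _ _ _ DP). destruct d as [|d]; [lia|]. simpl Nat.pred.
  rewrite <- !tech_pow_Rmult. field. lra.
Qed.

Lemma flux_continuous d f u p r :
  profile d f u p -> 0 <= r -> continuous (fun t => t ^ d * p t) r.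
Proof.
intros H Hr. apply (continuous_mult (fun t => t ^ d) p).
- apply (derive_continuous _ r (INR d * r ^ Nat.pred d)). auto_derive; auto; ring.
- eapply profile_cp; eauto.
Qed.

Lemma derive_pow_scal d C r :
  is_derive (fun t : R => C * t ^ S d / INR (S d)) r (C * r ^ d).
Proof.
assert (E : INR (S d) <> 0) by (apply not_0_INR; lia).
auto_derive; auto. simpl Nat.pred. cbn [INR] in E |- *. field. exact E.
Qed.

Lemma flux_le d f u p x y C :
  profile d f u p -> (1 <= d)%nat -> 0 <= x <= y ->
  (forall t, x < t < y -> f (u t) <= C) ->
  y ^ d * p y <= x ^ d * p x + C * (y ^ S d - x ^ S d) / INR (S d).
Proof.
intros H Hd Hxy HC.
assert (0 < INR (S d)) by (apply lt_0_INR; lia).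
assert (y ^ d * p y - C * y ^ S d / INR (S d) <= x ^ d * p x - C * x ^ S d / INR (S d)).
{ apply (nonincr_le (fun t => t ^ d * p t - C * t ^ S d / INR (S d))
    (fun t => t ^ d * f (u t) - C * t ^ d)); try lra.
  - intros t Ht. apply (continuous_minus (fun t => t ^ d * p t) (fun t => C * t ^ S d / INR (S d))).
    + eapply flux_continuous; eauto. lra.
    + eapply derive_continuous, derive_pow_scal.
  - intros t Ht. apply (is_derive_minus (fun t => t ^ d * p t) (fun t => C * t ^ S d / INR (S d))).
    + eapply derive_flux; eauto. lra.
    + apply derive_pow_scal.
  - intros t Ht. specialize (HC t Ht). assert (0 < t ^ d) by (apply pow_lt; lra). nra. }
replace (C * (y ^ S d - x ^ S d) / INR (S d)) with
  (C * y ^ S d / INR (S d) - C * x ^ S d / INR (S d)) by (field; lra). lra.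
Qed.

(** Reflection turns each upper estimate of a slope or a flux into the matching lower one. *)
Lemma profile_opp d f u p :
  profile d f u p -> profile d (fun s => - f (- s)) (fun r => - u r) (fun r => - p r).
Proof.
intros H. split.
- intros r Hr. apply (is_derive_opp u), (profile_u _ _ _ _ H); auto.
- intros r Hr. replace (- f (- - u r) - INR d / r * - p r) with (- (f (u r) - INR d / r * p r))
    by (rewrite Ropp_involutive; ring).
  apply (is_derive_opp p), (profile_p _ _ _ _ H); auto.
- apply (continuous_opp u), H.
- apply (continuous_opp p), H.
- rewrite (profile_p0 _ _ _ _ H); ring.
Qed.

Lemma flux_ge d f u p x y C :
  profile d f u p -> (1 <= d)%nat -> 0 <= x <= y ->
  (forall t, x < t < y -> C <= f (u t)) ->
  x ^ d * p x + C * (y ^ S d - x ^ S d) / INR (S d) <= y ^ d * p y.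
Proof.
intros H Hd Hxy HC.
assert (K := flux_le _ _ _ _ x y (- C) (profile_opp _ _ _ _ H) Hd Hxy).
simpl in K.
assert (K' : y ^ d * - p y <= x ^ d * - p x + - C * (y ^ S d - x ^ S d) / INR (S d)).
{ apply K. intros t Ht. rewrite Ropp_involutive. specialize (HC t Ht). lra. }
unfold Rdiv in *. lra.
Qed.

Lemma slope_ge d f u p r C :
  profile d f u p -> (1 <= d)%nat -> 0 < r -> (forall t, 0 < t < r -> C <= f (u t)) ->
  C * r / INR (S d) <= p r.
Proof.
intros H Hd Hr HC. assert (K := flux_ge d f u p 0 r C H Hd ltac:(lra) HC).
assert (0 < INR (S d)) by (apply lt_0_INR; lia).
assert (E0 : 0 ^ S d = 0) by (apply pow_i; lia).
rewrite (profile_p0 _ _ _ _ H), E0, <- tech_pow_Rmult in K.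
assert (0 < r ^ d) by (apply pow_lt; lra).
apply (Rmult_le_reg_l (r ^ d)); auto.
replace (r ^ d * (C * r / INR (S d))) with (0 ^ d * 0 + C * (r * r ^ d - 0) / INR (S d)) by (field; lra).
exact K.
Qed.

Lemma slope_le d f u p r C :
  profile d f u p -> (1 <= d)%nat -> 0 < r -> (forall t, 0 < t < r -> f (u t) <= C) ->
  p r <= C * r / INR (S d).
Proof.
intros H Hd Hr HC.
assert (K := slope_ge d _ _ _ r (- C) (profile_opp _ _ _ _ H) Hd Hr).
simpl in K. assert (K' : - C * r / INR (S d) <= - p r).
{ apply K. intros t Ht. rewrite Ropp_involutive. specialize (HC t Ht). lra. }
unfold Rdiv in *. lra.
Qed.

Lemma slope_ge_near0 d f u p C :
  profile d f u p -> (1 <= d)%nat -> continuous f (u 0) -> C < f (u 0) ->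
  exists tau, 0 < tau /\ forall r, 0 < r <= tau -> C * r / INR (S d) <= p r.
Proof.
intros H Hd Hf HC.
destruct (continuous_eps (fun r => f (u r)) 0 (f (u 0) - C)) as [e [He K]].
{ apply (continuous_comp u f); auto. apply H. } { lra. }
exists (e / 2). split; [lra|]. intros r Hr. eapply slope_ge; eauto; try lra.
intros t Ht. specialize (K t). rewrite Rminus_0_r, Rabs_right in K by lra.
specialize (K ltac:(lra)). apply Rabs_def2 in K. lra.
Qed.

Lemma slope_pos_near0 d f u p :
  profile d f u p -> (1 <= d)%nat -> continuous f (u 0) -> 0 < f (u 0) ->
  exists tau, 0 < tau /\ forall r, 0 < r <= tau -> 0 < p r.
Proof.
intros H Hd Hf HC.
destruct (slope_ge_near0 d f u p (f (u 0) / 2) H Hd Hf ltac:(lra)) as [tau [Ht K]].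
exists tau. split; auto. intros r Hr. specialize (K r Hr).
assert (0 < INR (S d)) by (apply lt_0_INR; lia).
assert (0 < f (u 0) / 2 * r / INR (S d)); [|lra].
apply Rdiv_lt_0_compat; auto. nra.
Qed.

Lemma profile_decr d f u p x y :
  profile d f u p -> 0 <= x < y -> (forall t, 0 < t <= y -> 0 < p t) -> u y < u x.
Proof.
intros H Hxy Hp. apply (decr_lt u (fun t => - p t)); try lra.
- intros t Ht. eapply profile_cu; eauto. lra.
- intros t Ht. apply (profile_u _ _ _ _ H). lra.
- intros t Ht. assert (0 < p t) by (apply Hp; lra). lra.
Qed.

Ltac decr := eapply profile_decr; [eassumption|lra|
  let t := fresh in let Ht := fresh in intros t Ht;
  match goal with K : forall _, _ -> 0 < ?p _ |- 0 < ?p _ => apply K; lra end].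

(* At a first critical point [f (u) <= 0], hence [u <= b] and the energy is negative. *)
Lemma slope_pos d f F u p b beta R :
  profile d f u p -> admissible f F b beta -> (1 <= d)%nat -> b < u 0 -> 0 < R ->
  (forall t, 0 <= t <= R -> 0 < u t) -> 0 <= energy F u p R ->
  forall r, 0 < r <= R -> 0 < p r.
Proof.
intros H HA Hd Hu0 HR Hu HE r Hr. apply NNPP. intros Hn.
destruct (slope_pos_near0 d f u p H Hd (admissible_cont _ _ _ _ HA _) (admissible_pos _ _ _ _ HA _ Hu0))
  as [tau [Htau Kt]].
assert (tau < r). { apply Rnot_le_lt. intros Hle. apply Hn, Kt. lra. }
destruct (first_zero p tau r) as [c [Hc1 [Hc2 Hc3]]]; try lra.
{ intros x Hx. eapply profile_cp; eauto. lra. }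
{ apply Kt; lra. }
assert (Hf : f (u c) - INR d / c * p c <= 0).
{ apply (deriv_left_nonpos p c tau); auto; try lra.
  - apply (profile_p _ _ _ _ H). lra.
  - intros y Hy. apply Hc3. lra. }
rewrite Hc2, Rmult_0_r, Rminus_0_r in Hf.
assert (u c <= b). { apply Rnot_lt_le. intros Hb. apply (admissible_pos _ _ _ _ HA) in Hb. lra. }
assert (F (u c) < 0).
{ apply (admissible_neg _ _ _ _ HA). destruct (admissible_b _ _ _ _ HA). split; [apply Hu|]; lra. }
assert (HE' : energy F u p R <= p c ^ 2 / 2 + F (u c)) by (eapply (energy_le d f F u p b beta); eauto; lra).
rewrite Hc2 in HE'. simpl in HE'. lra.
Qed.

Lemma linear_descent d f u p r0 k s :
  profile d f u p -> 0 <= r0 -> 0 < k -> (forall r, r0 < r -> k <= p r) ->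
  exists r, r0 <= r /\ u r < s.
Proof.
intros H H0 Hk Hp.
assert (K : forall r, r0 <= r -> u r <= u r0 - k * (r - r0)).
{ intros r Hr. assert (u r + k * (r - r0) <= u r0 + k * (r0 - r0)); [|lra].
  apply (nonincr_le (fun t => u t + k * (t - r0)) (fun t => - p t + k)); auto.
  - intros x Hx. apply (continuous_plus u (fun t => k * (t - r0))).
    + eapply profile_cu; eauto. lra.
    + apply (derive_continuous _ x k). auto_derive; auto; ring.
  - intros x Hx. apply (is_derive_plus u (fun t => k * (t - r0))).
    + apply (profile_u _ _ _ _ H). lra.
    + auto_derive; auto; ring.
  - intros x Hx. specialize (Hp x). lra. }
exists (r0 + (Rabs (u r0 - s) + 1) / k).
assert (0 <= (Rabs (u r0 - s) + 1) / k).
{ apply Rmult_le_pos; [|left; apply Rinv_0_lt_compat; auto]. assert (K1 := Rabs_pos (u r0 - s)). lra. }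
split; [lra|]. specialize (K (r0 + (Rabs (u r0 - s) + 1) / k) ltac:(lra)).
replace (k * (r0 + (Rabs (u r0 - s) + 1) / k - r0)) with (Rabs (u r0 - s) + 1) in K by (field; lra).
assert (K1 := Rle_abs (u r0 - s)). lra.
Qed.

(** * Descent of profiles to level zero and passage to the level variable *)

Lemma max_on (g : R -> R) a b :
  a <= b -> (forall x, a <= x <= b -> continuous g x) ->
  exists M, a <= M <= b /\ forall x, a <= x <= b -> g x <= g M.
Proof.
intros Hab Hc. destruct (continuity_ab_maj g a b Hab) as [M [H1 H2]].
- intros x Hx. apply continuous_pt, Hc, Hx.
- exists M; auto.
Qed.

Lemma min_on (g : R -> R) a b :
  a <= b -> (forall x, a <= x <= b -> continuous g x) ->
  exists M, a <= M <= b /\ forall x, a <= x <= b -> g M <= g x.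
Proof.
intros Hab Hc. destruct (continuity_ab_min g a b Hab) as [M [H1 H2]].
- intros x Hx. apply continuous_pt, Hc, Hx.
- exists M; auto.
Qed.

(** The slope is required to be positive all the way from the centre, which is what makes [u]
    invertible on the levels between [l] and [u 0]. *)
Definition reaches (u p : R -> R) (l : R) : Prop :=
  forall s, l < s < u 0 -> exists r, 0 < r /\ u r = s /\ forall t, 0 < t <= r -> 0 < p t.

(** A profile that stayed above a level [s > 0] would have its slope bounded away from 0. Once below
    [beta], nonnegative energy gives [p^2 >= -2 F (u)], and [F] has a negative maximum on the levels
    left; if it never gets below [beta], then [f] has a positive minimum and [p] grows linearly.
    Either way it would fall below [s]. *)
Lemma descent d f F u p b beta :
  profile d f u p -> admissible f F b beta -> (1 <= d)%nat -> b < u 0 ->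
  (forall r, 0 < r -> (forall t, 0 <= t <= r -> 0 < u t) -> 0 <= energy F u p r) ->
  reaches u p 0.
Proof.
intros H HA Hd Hu0 HE s Hs.
destruct (classic (exists r, 0 <= r /\ u r <= s)) as [[r [Hr1 Hr2]]|Hn].
- destruct (first_zero (fun t => u t - s) 0 r) as [c [Hc1 [Hc2 Hc3]]]; try lra.
  { intros x Hx. apply (continuous_minus u (fun _ => s)); [|apply continuous_const].
    eapply profile_cu; eauto. lra. }
  assert (Hpos : forall t, 0 <= t <= c -> 0 < u t).
  { intros t Ht. destruct (Req_dec t c); [subst; lra|]. specialize (Hc3 t). lra. }
  exists c. repeat split; try lra. intros t Ht.
  apply (slope_pos d f F u p b beta c H HA Hd Hu0 ltac:(lra) Hpos); auto. apply HE; auto; lra.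
- exfalso.
  assert (Hgt : forall r, 0 <= r -> s < u r).
  { intros r Hr. apply Rnot_le_lt. intros Hle. apply Hn. exists r; auto. }
  assert (HEp : forall r, 0 < r -> 0 <= energy F u p r).
  { intros r Hr. apply HE; auto. intros t Ht. specialize (Hgt t). lra. }
  assert (Hp : forall r, 0 < r -> 0 < p r).
  { intros r Hr. apply (slope_pos d f F u p b beta r H HA Hd Hu0 Hr); auto; try lra.
    intros t Ht. specialize (Hgt t). lra. }
  destruct (classic (exists r, 0 <= r /\ u r < beta)) as [[r0 [Hr1 Hr2]]|Hn2].
  + destruct (max_on F s (u r0)) as [M [HM1 HM2]].
    { left; auto. } { intros x _. eapply derive_continuous, (admissible_prim _ _ _ _ HA). }
    assert (HFM : F M < 0) by (apply (admissible_neg _ _ _ _ HA); lra).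
    assert (0 < sqrt (- 2 * F M)) by (apply sqrt_lt_R0; lra).
    destruct (linear_descent d f u p r0 (sqrt (- 2 * F M)) s H Hr1 H0) as [r [Hr3 Hr4]].
    * intros r Hr. assert (0 <= energy F u p r) by (apply HEp; lra). unfold energy in H1.
      assert (u r < u r0). { decr. }
      assert (F (u r) <= F M). { apply HM2. specialize (Hgt r). lra. }
      assert (0 < p r) by (apply Hp; lra).
      rewrite <- (sqrt_pow2 (p r)) by lra. apply sqrt_le_1_alt. lra.
    * specialize (Hgt r). lra.
  + assert (Hge : forall r, 0 <= r -> beta <= u r).
    { intros r Hr. apply Rnot_lt_le. intros Hlt. apply Hn2. exists r; auto. }
    destruct (min_on f beta (u 0)) as [M [HM1 HM2]].
    { apply Hge; lra. } { intros x _. apply HA. }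
    assert (HfM : 0 < f M). { apply (admissible_pos _ _ _ _ HA). destruct (admissible_b _ _ _ _ HA). lra. }
    assert (0 < INR (S d)) by (apply lt_0_INR; lia).
    destruct (linear_descent d f u p 1 (f M / INR (S d)) s H ltac:(lra)) as [r [Hr3 Hr4]].
    * apply Rdiv_lt_0_compat; auto.
    * intros r Hr. apply Rle_trans with (f M * r / INR (S d)).
      { unfold Rdiv. assert (0 < / INR (S d)) by now apply Rinv_0_lt_compat.
        assert (0 < f M * / INR (S d)) by (apply Rmult_lt_0_compat; auto). nra. }
      eapply slope_ge; eauto; try lra. intros t Ht. apply HM2. split; [apply Hge; lra|].
      left. decr.
    * specialize (Hgt r). lra.
Qed.

(** While [p > 0] the profile is strictly decreasing, so the radius of a level is unique and any
    choice of radii is the inverse function. Its derivative follows from the difference quotients of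
    [u]. *)
Lemma profile_level d f u p l :
  profile d f u p -> reaches u p l ->
  exists rho, level_sol (INR d) f rho (fun s => p (rho s)) l (u 0) /\
    (forall s, l < s < u 0 -> u (rho s) = s /\ forall t, 0 < t <= rho s -> 0 < p t) /\
    (forall r, 0 < r -> (forall t, 0 < t <= r -> 0 < p t) -> l < u r -> rho (u r) = r).
Proof.
intros H Hr.
destruct (choice (fun s r => l < s < u 0 -> 0 < r /\ u r = s /\ forall t, 0 < t <= r -> 0 < p t))
  as [rho Hrho].
{ intros s. destruct (classic (l < s < u 0)) as [Hs|Hs].
  - destruct (Hr s Hs) as [r K]. exists r. auto.
  - exists 0. tauto. }
assert (Hinv : forall r, 0 < r -> (forall t, 0 < t <= r -> 0 < p t) -> l < u r -> rho (u r) = r).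
{ intros r H0 Hp Hl.
  assert (u r < u 0) by (decr).
  destruct (Hrho (u r) ltac:(lra)) as [K1 [K2 K3]].
  destruct (Rtotal_order (rho (u r)) r) as [E|[E|E]]; auto; exfalso.
  - assert (u r < u (rho (u r))) by (decr). lra.
  - assert (u (rho (u r)) < u r) by (decr). lra. }
assert (Hmono : forall s s', l < s -> s < s' -> s' < u 0 -> rho s' < rho s).
{ intros s s' H1 H2 H3. destruct (Hrho s ltac:(lra)) as [K1 [K2 K3]].
  destruct (Hrho s' ltac:(lra)) as [K1' [K2' K3']].
  apply Rnot_le_lt. intros Hle. destruct (Req_dec (rho s) (rho s')) as [E|E].
  - rewrite E in K2. lra.
  - assert (u (rho s') < u (rho s)) by (decr). lra. }
assert (Hder : forall s, l < s < u 0 -> is_derive rho s (- / p (rho s))).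
{ intros s Hs. destruct (Hrho s Hs) as [K1 [K2 K3]].
  assert (HP : 0 < p (rho s)) by (apply K3; lra).
  apply is_derive_Reals. intros e He.
  assert (DU := profile_u _ _ _ _ H _ K1). apply is_derive_Reals in DU.
  set (P := p (rho s)) in *.
  (* [e1 <= P / 2] keeps the quotient [q] of [u] below [- P / 2], so [|P q| >= P^2 / 2], and the
     second bound then makes [|P + q| / |P q|] smaller than [e]. *)
  set (e1 := Rmin (P / 2) (e * (P * P) / 4)).
  assert (He1 : 0 < e1 /\ e1 <= P / 2 /\ e1 <= e * (P * P) / 4).
  { assert (0 < e * (P * P)) by (repeat apply Rmult_lt_0_compat; auto). unfold e1; minmax. }
  destruct (DU e1 ltac:(lra)) as [[dl Hdl] KD]. simpl in KD.
  set (s' := (l + s) / 2). destruct (Hrho s' ltac:(unfold s'; lra)) as [K1' [K2' K3']].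
  assert (rho s < rho s') by (apply Hmono; unfold s'; lra).
  (* Radii on both sides of [rho s] within [dl]: levels between [u t2] and [u t1] have their radius
     in [(t1, t2)], which is the continuity of [rho] at [s]. *)
  set (t1 := Rmax (rho s - dl / 2) (rho s / 2)).
  set (t2 := Rmin (rho s + dl / 2) (rho s')).
  assert (Ht1 : 0 < t1 < rho s /\ rho s - dl < t1) by (unfold t1; minmax).
  assert (Ht2 : rho s < t2 < rho s + dl /\ t2 <= rho s') by (unfold t2; minmax).
  assert (Hu1 : s < u t1).
  { rewrite <- K2. decr. }
  assert (Hu2 : u t2 < s).
  { rewrite <- K2. decr. }
  assert (Hu1' : u t1 < u 0).
  { decr. }
  assert (Hu2' : l < u t2).
  { assert (s' <= u t2); [|unfold s' in *; lra]. rewrite <- K2'.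
    destruct (Req_dec t2 (rho s')) as [->|]; [lra|]. left. decr. }
  assert (E1 : rho (u t1) = t1) by (apply Hinv; try lra; intros; apply K3; lra).
  assert (E2 : rho (u t2) = t2) by (apply Hinv; try lra; intros; apply K3'; lra).
  assert (Hh : 0 < Rmin (u t1 - s) (s - u t2)) by minmax.
  exists (mkposreal _ Hh). simpl. intros h Hh0 Hh1.
  assert (Hsh : u t2 < s + h < u t1).
  { apply Rabs_def2 in Hh1. revert Hh1. minmax. }
  assert (Hk : t1 < rho (s + h) < t2).
  { split; [rewrite <- E1|rewrite <- E2]; apply Hmono; lra. }
  destruct (Hrho (s + h) ltac:(lra)) as [K1h [K2h K3h]].
  set (k := rho (s + h) - rho s).
  assert (Hk0 : k <> 0).
  { unfold k. intros E. replace (rho (s + h)) with (rho s) in K2h by lra. lra. }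
  specialize (KD k Hk0 ltac:(apply Rabs_def1; unfold k; lra)).
  replace (rho s + k) with (rho (s + h)) in KD by (unfold k; ring).
  rewrite K2h, K2 in KD. replace (s + h - s) with h in KD by ring.
  apply Rabs_def2 in KD.
  set (q := h / k) in *.
  assert (Hq : q < - P / 2) by lra.
  replace (k / h - - / P) with ((P + q) / (P * q)) by (unfold q; field; lra).
  rewrite Rabs_div by nra.
  assert (HPq : Rabs (P * q) >= P * P / 2). { rewrite Rabs_left by nra. nra. }
  assert (HPq2 : Rabs (P + q) < e1) by (apply Rabs_def1; lra).
  apply (Rmult_lt_reg_r (Rabs (P * q))); [nra|].
  unfold Rdiv. rewrite Rmult_assoc, Rinv_l, Rmult_1_r by nra. nra. }
exists rho. split; [|split; auto].
- constructor; auto.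
  + intros s Hs. apply (Hrho s Hs).
  + intros s Hs. destruct (Hrho s Hs) as [K1 [K2 K3]]. apply K3; lra.
  + intros s Hs. destruct (Hrho s Hs) as [K1 [K2 K3]].
    assert (0 < p (rho s)) by (apply K3; lra).
    assert (K := is_derive_comp p rho s _ _ (profile_p _ _ _ _ H _ K1) (Hder s Hs)).
    rewrite K2 in K. 
    replace (INR d / rho s - f s / p (rho s)) with (scal (- / p (rho s)) (f s - INR d / rho s * p (rho s))); auto.
    unfold scal; simpl; unfold mult; simpl. field. lra.
- intros s Hs. destruct (Hrho s Hs) as [K1 [K2 K3]]. auto.
Qed.

Lemma slope_zero_at_min d f u p c :
  profile d f u p -> (forall r, 0 <= r -> 0 <= u r) -> 0 < c -> u c = 0 -> p c = 0.
Proof.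
intros H Hu Hc Huc.
assert (DU := profile_u _ _ _ _ H c Hc). apply is_derive_Reals in DU.
destruct (Req_dec (p c) 0) as [|Hpc]; auto. exfalso.
destruct (DU (Rabs (p c)) (Rabs_pos_lt _ Hpc)) as [[e He] K]. simpl in K.
set (h := Rmin (e / 2) (c / 2)).
assert (Hh : 0 < h /\ h < e /\ h < c) by (unfold h; minmax).
assert (K1 := K h ltac:(lra) ltac:(rewrite Rabs_right; lra)).
assert (K2 := K (- h) ltac:(lra) ltac:(rewrite Rabs_left; lra)).
rewrite Huc, Rminus_0_r in K1, K2.
assert (0 < / h) by (apply Rinv_0_lt_compat; lra).
assert (0 <= u (c + h) / h) by (apply Rmult_le_pos; [apply Hu; lra|lra]).
assert (0 <= u (c + - h) / h) by (apply Rmult_le_pos; [apply Hu; lra|lra]).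
replace (u (c + - h) / - h) with (- (u (c + - h) / h)) in K2 by (field; lra).
apply Rabs_def2 in K1. apply Rabs_def2 in K2.
destruct (Rcase_abs (p c)); [rewrite Rabs_left in K1, K2 by auto|rewrite Rabs_right in K1, K2 by auto]; lra.
Qed.

(* [r ^ d * p] is nonincreasing once [u <= b], so [r * p] decays like [r ^ (1 - d)]. *)
Lemma weighted_slope_small d f F u p b beta e :
  profile d f u p -> admissible f F b beta -> (2 <= d)%nat -> b < u 0 ->
  (forall s, 0 <= s <= b -> f s <= 0) ->
  (forall r, 0 <= r -> 0 <= u r) -> reaches u p 0 ->
  (forall r, 0 < r -> (forall t, 0 <= t <= r -> 0 < u t) -> forall t, 0 < t <= r -> 0 < p t) ->
  0 < e ->
  exists r, 0 < r /\ 0 < u r < beta /\ (forall t, 0 < t <= r -> 0 < p t) /\ r * p r < e.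
Proof.
intros H HA Hd Hu0 Hfb Hu Hreach Hp He.
destruct (admissible_b _ _ _ _ HA) as [Hb0 Hbb].
destruct (Hreach b ltac:(lra)) as [rb [Hrb1 [Hrb2 Hrb3]]].
destruct (classic (exists r, 0 <= r /\ u r <= 0)) as [[r [Hr1 Hr2]]|Hn].
- destruct (first_zero u 0 r) as [c [Hc1 [Hc2 Hc3]]]; try lra.
  { intros x Hx. eapply profile_cu; eauto. lra. }
  assert (Hpc : p c = 0) by (eapply slope_zero_at_min; eauto; lra).
  destruct (continuous_eps (fun r => r * p r) c e) as [e1 [He1 K]]; auto.
  { apply (continuous_mult (fun r => r) p); [apply continuous_id|eapply profile_cp; eauto; lra]. }
  destruct (continuous_eps u c beta) as [e2 [He2 K2]]; try lra.
  { eapply profile_cu; eauto; lra. }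
  set (r0 := Rmax (c / 2) (Rmax (c - e1 / 2) (c - e2 / 2))).
  assert (Hr0 : 0 < r0 < c /\ c - e1 < r0 /\ c - e2 < r0) by (unfold r0; minmax).
  specialize (K r0 ltac:(apply Rabs_def1; lra)). specialize (K2 r0 ltac:(apply Rabs_def1; lra)).
  rewrite Hpc, Rmult_0_r, Rminus_0_r in K. rewrite Hc2, Rminus_0_r in K2.
  apply Rabs_def2 in K. apply Rabs_def2 in K2.
  exists r0. repeat split; try lra.
  + apply Hc3; lra.
  + apply Hp; [lra|]. intros t Ht. apply Hc3; lra.
- assert (Hpos : forall r, 0 <= r -> 0 < u r).
  { intros r Hr. apply Rnot_le_lt. intros Hle. apply Hn. exists r; auto. }
  assert (Hpp : forall r, 0 < r -> 0 < p r).
  { intros r Hr. apply (Hp r Hr); [|lra]. intros; apply Hpos; lra. }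
  set (M := rb ^ d * p rb).
  assert (HM : 0 < M) by (apply Rmult_lt_0_compat; [apply pow_lt; lra|apply Hpp; lra]).
  (* [r >= 1] absorbs the surplus powers in [r^d p <= M], leaving [r (r p) <= M], and [r > M / e]
     turns this into [r p < e]. *)
  set (r := rb + 1 + M / e).
  assert (0 < M / e) by (apply Rdiv_lt_0_compat; auto).
  assert (Hle : r ^ d * p r <= M).
  { assert (K := flux_le d f u p rb r 0 H ltac:(lia) ltac:(unfold r; lra)).
    unfold Rdiv in K. rewrite !Rmult_0_l, Rplus_0_r in K. apply K.
    intros t Ht. apply Hfb. split; [apply Hu; lra|]. rewrite <- Hrb2. left.
    decr. }
  exists r. repeat split; try (unfold r; lra).
  + apply Hpos. unfold r; lra.
  + apply Rle_lt_trans with (u rb); [|lra]. left.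
    assert (rb < r) by (unfold r; lra). decr.
  + intros; apply Hpp; lra.
  + destruct d as [|[|d]]; try lia. rewrite <- !tech_pow_Rmult in Hle.
    assert (1 <= r ^ d) by (apply pow_R1_Rle; unfold r; lra).
    assert (0 < p r) by (apply Hpp; unfold r; lra).
    assert (Hrp : 0 < r * p r) by (apply Rmult_lt_0_compat; [unfold r; lra|auto]).
    assert (r * (r * p r) <= M).
    { apply Rle_trans with (r * (r * r ^ d) * p r); auto.
      replace (r * (r * r ^ d) * p r) with (r ^ d * (r * (r * p r))) by ring.
      assert (0 < r * (r * p r)) by (apply Rmult_lt_0_compat; [unfold r; lra|auto]). nra. }
    assert (M < r * e). { unfold r. replace M with (M / e * e) at 1 by (field; lra). nra. }
    assert (0 < r) by (unfold r; lra). nra.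
Qed.

(* Here [2 (d+1) (F/f)' > d - 1] makes the Pohozaev functional decrease in [r] from its value [0] at the centre. *)
Lemma erbe_tang_neg d f F u p b beta r :
  profile d f u p -> admissible f F b beta -> (1 <= d)%nat ->
  (forall s, beta < s <= u 0 -> exists q, is_derive (fun t => F t / f t) s q /\
      (INR d - 1) / (2 * (INR d + 1)) < q) ->
  0 < r -> (forall t, 0 < t <= r -> 0 < p t) -> beta <= u r ->
  erbe_tang (INR d) (f (u r)) (F (u r)) r (p r) < 0.
Proof.
intros H HA Hd Hq Hr Hp Hur.
destruct (admissible_b _ _ _ _ HA) as [Hb0 Hbb].
assert (Hub : forall t, 0 <= t <= r -> beta <= u t <= u 0).
{ intros t Ht. split.
  - destruct (Req_dec t r); [subst; auto|]. apply Rle_trans with (u r); auto. left.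
    decr.
  - destruct (Req_dec t 0); [subst; lra|]. left. decr. }
(* [r^d p] times [erbe_tang], with the divisions by [p] cleared so that it is continuous at the
   centre, where it vanishes. *)
set (P := fun t => 2 * (INR d + 1) * (t ^ d * p t) * (F (u t) / f (u t))
   - t * (t ^ d * p t) * p t - 2 * t * t ^ d * F (u t)).
assert (K : P r < P 0).
{ destruct (choice (fun t q => 0 < t < r -> is_derive (fun t => F t / f t) (u t) q /\
      (INR d - 1) / (2 * (INR d + 1)) < q)) as [q HQ].
  { intros t. destruct (classic (0 < t < r)) as [Ht|Ht]; [|exists 0; tauto].
    destruct (Hq (u t)) as [q Kq].
    - split; [|apply Hub; lra]. apply Rle_lt_trans with (u r); auto. decr.
    - exists q; auto. }
  apply (decr_lt P (fun t => - (t ^ d * p t * p t * (2 * (INR d + 1) * q t - (INR d - 1))))); auto.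
  - intros t Ht. assert (Hfu : 0 < f (u t)).
    { apply (admissible_pos _ _ _ _ HA). specialize (Hub t Ht). lra. }
    assert (Cu : continuous u t) by (eapply profile_cu; eauto; lra).
    assert (Cp : continuous p t) by (eapply profile_cp; eauto; lra).
    assert (Cf : continuous (fun t => t ^ d * p t) t) by (eapply flux_continuous; eauto; lra).
    assert (CF : continuous (fun t => F (u t)) t).
    { apply (continuous_comp u F); auto. eapply derive_continuous, (admissible_prim _ _ _ _ HA). }
    assert (Ci : continuous (fun t => / f (u t)) t).
    { apply (continuous_comp (fun t => f (u t)) Rinv).
      - apply (continuous_comp u f); auto. apply HA.
      - apply (derive_continuous _ _ (- / (f (u t)) ^ 2)). auto_derive; [lra|field; lra]. }
    assert (Ct : continuous (fun t : R => t) t) by apply continuous_id.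
    assert (Ctd : continuous (fun t : R => t ^ d) t).
    { apply (derive_continuous _ t (INR d * t ^ Nat.pred d)). auto_derive; auto; ring. }
    unfold P.
    apply (continuous_minus
      (fun t => 2 * (INR d + 1) * (t ^ d * p t) * (F (u t) * / f (u t)) - t * (t ^ d * p t) * p t)
      (fun t => 2 * t * t ^ d * F (u t))).
    + apply (continuous_minus
        (fun t => 2 * (INR d + 1) * (t ^ d * p t) * (F (u t) * / f (u t)))
        (fun t => t * (t ^ d * p t) * p t)).
      * apply (continuous_mult (fun t => 2 * (INR d + 1) * (t ^ d * p t)) (fun t => F (u t) * / f (u t))).
        -- apply (continuous_mult (fun _ => 2 * (INR d + 1)) (fun t => t ^ d * p t)); auto.
           apply continuous_const.
        -- apply (continuous_mult (fun t => F (u t)) (fun t => / f (u t))); auto.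
      * apply (continuous_mult (fun t => t * (t ^ d * p t)) p); auto.
        apply (continuous_mult (fun t => t) (fun t => t ^ d * p t)); auto.
    + apply (continuous_mult (fun t => 2 * t * t ^ d) (fun t => F (u t))); auto.
      apply (continuous_mult (fun t => 2 * t) (fun t => t ^ d)); auto.
      apply (continuous_mult (fun _ => 2) (fun t => t)); auto.
      apply continuous_const.
  - intros t Ht. destruct (HQ t Ht) as [Q1 Q2].
    assert (DU := profile_u _ _ _ _ H t ltac:(lra)).
    assert (DP := profile_p _ _ _ _ H t ltac:(lra)).
    assert (DF := admissible_prim _ _ _ _ HA (u t)).
    assert (Hfu : 0 < f (u t)).
    { apply (admissible_pos _ _ _ _ HA). specialize (Hub t ltac:(lra)). lra. }
    assert (DQ := is_derive_comp (fun t => F t / f t) u t _ _ Q1 DU).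
    unfold P.
    (* Only the quotient [F / f] is known to be differentiable, not [f], so its composition with [u]
       is differentiated as one function. *)
    assert (Eg : exists g : R -> R, (forall x, g x = F (u x) / f (u x))) by (eexists; reflexivity).
    destruct Eg as [g Eg].
    assert (DG : is_derive g t (- p t * q t)).
    { apply (is_derive_ext (fun t => F (u t) / f (u t))); auto. }
    apply (is_derive_ext (fun t0 : R => 2 * (INR d + 1) * (t0 ^ d * p t0) * g t0 - t0 * (t0 ^ d * p t0) * p t0 -
       2 * t0 * t0 ^ d * F (u t0))).
    { intros x. rewrite Eg. reflexivity. }
    auto_derive.
    + repeat split; eexists; eassumption.
    + rewrite (Derive_eq _ _ _ DU), (Derive_eq _ _ _ DP), (Derive_eq _ _ _ DF),
        (Derive_eq _ _ _ DG), (Eg t).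
      destruct d as [|d']; [lia|]. simpl Nat.pred. rewrite <- !tech_pow_Rmult. field. lra.
  - intros t Ht. destruct (HQ t Ht) as [Q1 Q2].
    assert (0 < p t) by (apply Hp; lra). assert (0 < t ^ d) by (apply pow_lt; lra).
    assert (Hn := pos_INR d).
    assert (INR d - 1 < 2 * (INR d + 1) * q t).
    { apply (Rmult_lt_compat_l (2 * (INR d + 1))) in Q2; [|lra].
      replace (2 * (INR d + 1) * ((INR d - 1) / (2 * (INR d + 1)))) with (INR d - 1) in Q2 by (field; lra). auto. }
    assert (0 < t ^ d * p t * p t * (2 * (INR d + 1) * q t - (INR d - 1))); [|lra].
    repeat apply Rmult_lt_0_compat; auto. lra. }
assert (P 0 = 0). { unfold P. rewrite (profile_p0 _ _ _ _ H). ring_simplify. ring. }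
assert (Hpr : 0 < p r) by (apply Hp; lra). assert (0 < r ^ d) by (apply pow_lt; lra).
assert (Hfu : 0 < f (u r)) by (apply (admissible_pos _ _ _ _ HA); lra).
assert (E : P r = r ^ d * p r * erbe_tang (INR d) (f (u r)) (F (u r)) r (p r)).
{ unfold P, erbe_tang. field. lra. }
apply Rnot_le_lt. intros Hle.
assert (0 <= P r); [|lra]. rewrite E. repeat apply Rmult_le_pos; lra.
Qed.

Lemma energy_lt d f F u p b beta x y :
  profile d f u p -> admissible f F b beta -> (1 <= d)%nat -> 0 <= x < y ->
  (forall t, x < t < y -> 0 < p t) -> energy F u p y < energy F u p x.
Proof.
intros H HA Hd Hxy Hp.
apply (decr_lt _ (fun r => - (INR d / r * p r ^ 2))); try lra.
- intros r Hr. eapply energy_continuous; eauto. lra.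
- intros r Hr. eapply derive_energy; eauto. lra.
- intros r Hr. assert (0 < INR d / r * p r ^ 2); [|lra].
  apply Rmult_lt_0_compat; [|apply pow_lt, Hp; lra].
  apply Rdiv_lt_0_compat; [apply lt_0_INR; lia|lra].
Qed.

(** The energy starts at [F (u 0)] and does not increase, while [F] is strictly increasing above
    [b < u 0]. *)
Lemma profile_le_center d f F u p b beta r :
  profile d f u p -> admissible f F b beta -> b < u 0 -> 0 <= r -> u r <= u 0.
Proof.
intros H HA Hu0 Hr. apply Rnot_lt_le. intros Hlt.
assert (E := energy_le d f F u p b beta 0 r H HA ltac:(lra)).
unfold energy in E. rewrite (profile_p0 _ _ _ _ H) in E.
assert (- F (u r) < - F (u 0)).
{ apply (decr_lt (fun x => - F x) (fun x => - f x)); auto.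
  - intros x _. apply (continuous_opp F). eapply derive_continuous, (admissible_prim _ _ _ _ HA).
  - intros x _. apply (is_derive_opp F), (admissible_prim _ _ _ _ HA).
  - intros x Hx. assert (0 < f x); [|lra]. apply (admissible_pos _ _ _ _ HA). lra. }
assert (0 <= p r ^ 2) by apply pow2_ge_0. simpl in E. simpl in H1. nra.
Qed.

Lemma reaches_of_slope d f u p R :
  profile d f u p -> 0 < R -> (forall t, 0 < t <= R -> 0 < p t) -> reaches u p (u R).
Proof.
intros H HR Hp s Hs.
destruct (first_zero (fun t => u t - s) 0 R) as [c [Hc1 [Hc2 Hc3]]]; try lra.
{ intros x Hx. apply (continuous_minus u (fun _ => s)); [|apply continuous_const].
  eapply profile_cu; eauto. lra. }
exists c. repeat split; try lra. intros t Ht. apply Hp; lra.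
Qed.

Lemma reaches_mono u p l l' : reaches u p l -> l <= l' -> reaches u p l'.
Proof. intros H Hl s Hs. apply H. lra. Qed.

Lemma level_sol_restrict n f g r p l s1 l' s1' :
  level_sol n f r p l s1 -> l <= l' -> s1' <= s1 -> (forall s, l' < s < s1' -> f s = g s) ->
  level_sol n g r p l' s1'.
Proof.
intros L Hl Hs Hfg. constructor; intros s Hss.
- apply (level_r _ _ _ _ _ _ L); lra.
- apply (level_p _ _ _ _ _ _ L); lra.
- apply (level_dr _ _ _ _ _ _ L); lra.
- rewrite <- Hfg by lra. apply (level_dp _ _ _ _ _ _ L); lra.
Qed.

(** [level_compare] restated at radii. The two profiles may solve different equations that agree
    with [f] below [s1], which lets a solution of the glued problem be measured against the ground
    state. Positive energy is asked of the first and a negative [erbe_tang] of the second. *)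
Lemma profile_compare d f F b beta f1 u1 p1 f2 u2 p2 l s1 x1 x2 :
  (1 <= d)%nat -> admissible f F b beta ->
  profile d f1 u1 p1 -> profile d f2 u2 p2 -> reaches u1 p1 l -> reaches u2 p2 l ->
  s1 <= u1 0 -> s1 <= u2 0 ->
  (forall s, s < s1 -> f1 s = f s) -> (forall s, s < s1 -> f2 s = f s) ->
  0 <= l < beta ->
  0 < x1 -> (forall t, 0 < t <= x1 -> 0 < p1 t) ->
  0 < x2 -> (forall t, 0 < t <= x2 -> 0 < p2 t) ->
  u1 x1 = u2 x2 -> beta < u1 x1 < s1 -> p1 x1 < p2 x2 ->
  erbe_tang (INR d) (f (u2 x2)) (F (u2 x2)) x2 (p2 x2) <
    erbe_tang (INR d) (f (u1 x1)) (F (u1 x1)) x1 (p1 x1) ->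
  (forall r, 0 < r -> (forall t, 0 < t <= r -> 0 < p1 t) -> l < u1 r < beta ->
     0 < p1 r ^ 2 + 2 * F (u1 r)) ->
  (forall r, 0 < r -> (forall t, 0 < t <= r -> 0 < p2 t) -> beta <= u2 r <= u2 x2 ->
     erbe_tang (INR d) (f (u2 r)) (F (u2 r)) r (p2 r) < 0) ->
  exists delta, 0 < delta /\ forall y1 y2,
    0 < y1 -> (forall t, 0 < t <= y1 -> 0 < p1 t) ->
    0 < y2 -> (forall t, 0 < t <= y2 -> 0 < p2 t) ->
    u1 y1 = u2 y2 -> l < u1 y1 < beta ->
    p1 y1 < p2 y2 /\
    y1 * sqrt (p1 y1 ^ 2 + 2 * F (u1 y1)) + delta <= y2 * sqrt (p2 y2 ^ 2 + 2 * F (u2 y2)).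
Proof.
intros Hd HA H1 H2 R1 R2 Hs1 Hs2 Hf1 Hf2 Hl Hx1 Hpx1 Hx2 Hpx2 Hx Hs0 Hp0 Het HE HQ.
destruct (admissible_b _ _ _ _ HA) as [Hb0 Hbb].
destruct (profile_level _ _ _ _ _ H1 R1) as [rho1 [L1 [I1 J1]]].
destruct (profile_level _ _ _ _ _ H2 R2) as [rho2 [L2 [I2 J2]]].
assert (L1' : level_sol (INR d) f rho1 (fun s => p1 (rho1 s)) l s1).
{ apply (level_sol_restrict _ _ _ _ _ _ _ _ _ L1); try lra. intros; apply Hf1; lra. }
assert (L2' : level_sol (INR d) f rho2 (fun s => p2 (rho2 s)) l s1).
{ apply (level_sol_restrict _ _ _ _ _ _ _ _ _ L2); try lra. intros; apply Hf2; lra. }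
assert (E1 : rho1 (u1 x1) = x1) by (apply J1; auto; lra).
assert (E2 : rho2 (u1 x1) = x2) by (rewrite Hx; apply J2; auto; lra).
destruct (level_compare d f F rho1 (fun s => p1 (rho1 s)) rho2 (fun s => p2 (rho2 s)) l beta (u1 x1) s1)
  as [C1 [delta [Hdelta C2]]]; auto.
- intros; apply HA.
- intros s Hs. apply (admissible_pos _ _ _ _ HA). lra.
- intros; apply (admissible_neg _ _ _ _ HA); auto.
- intros s Hs. eapply prim_ge0; eauto.
- intros s Hs. destruct (I1 s ltac:(lra)) as [K1 K2].
  assert (K := HE (rho1 s) ltac:(apply (level_r _ _ _ _ _ _ L1); lra) K2). rewrite K1 in K. apply K; lra.
- intros s Hs. destruct (I2 s ltac:(lra)) as [K1 K2].
  assert (K := HQ (rho2 s) ltac:(apply (level_r _ _ _ _ _ _ L2); lra) K2). rewrite K1 in K. apply K; lra.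
- rewrite E1, E2; auto.
- rewrite E1, E2. rewrite <- Hx in Het. exact Het.
- apply HA.
- exists delta. split; auto. intros y1 y2 Hy1 Hpy1 Hy2 Hpy2 Hy Hly.
  assert (F1 : rho1 (u1 y1) = y1) by (apply J1; auto; lra).
  assert (F2 : rho2 (u1 y1) = y2) by (rewrite Hy; apply J2; auto; lra).
  assert (G1 := C1 (u1 y1) ltac:(lra)). assert (G2 := C2 (u1 y1) ltac:(lra)).
  rewrite F1, F2 in G1, G2. rewrite <- Hy. auto.
Qed.

(** As [u] tends to 0, so does [F (u)]; a negative energy at some radius would persist and
    contradict this. The slope is then positive, the energy strictly decreasing, and hence strictly
    positive. *)
Lemma positive_profile d f F u p b beta :
  profile d f u p -> admissible f F b beta -> (1 <= d)%nat ->
  (forall r, 0 <= r -> 0 < u r) -> is_lim u p_infty 0 ->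
  (forall r, 0 <= r -> 0 < energy F u p r) /\ beta < u 0 /\
  (forall r, 0 < r -> 0 < p r) /\ reaches u p 0.
Proof.
intros H HA Hd Hu Hlim.
destruct (admissible_b _ _ _ _ HA) as [Hb0 Hbb].
assert (HE : forall r, 0 <= r -> 0 <= energy F u p r).
{ intros r Hr. apply Rnot_lt_le. intros Hneg.
  destruct (continuous_eps F 0 (- energy F u p r)) as [e [He K]]; try lra.
  { eapply derive_continuous, (admissible_prim _ _ _ _ HA). }
  apply is_lim_spec in Hlim. destruct (Hlim (mkposreal e He)) as [M HM]. simpl in HM.
  set (y := Rmax r (M + 1)).
  assert (Hy : r <= y /\ M < y) by (unfold y; minmax).
  specialize (HM y ltac:(lra)). specialize (K (u y) HM).
  rewrite (admissible_F0 _ _ _ _ HA), Rminus_0_r in K. apply Rabs_def2 in K.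
  assert (E := energy_le d f F u p b beta r y H HA ltac:(lra)).
  unfold energy at 1 in E. assert (0 <= p y ^ 2) by apply pow2_ge_0. simpl in H0, E. nra. }
assert (E0 : energy F u p 0 = F (u 0)).
{ unfold energy. rewrite (profile_p0 _ _ _ _ H). field. }
assert (Hu0 : beta <= u 0).
{ apply Rnot_lt_le. intros Hlt.
  assert (F (u 0) < 0) by (apply (admissible_neg _ _ _ _ HA); split; [apply Hu|]; lra).
  specialize (HE 0 ltac:(lra)). lra. }
assert (Hp : forall r, 0 < r -> 0 < p r).
{ intros r Hr. apply (slope_pos d f F u p b beta r H HA Hd ltac:(lra) Hr); try lra.
  - intros; apply Hu; lra.
  - apply HE; lra. }
assert (HEs : forall r, 0 <= r -> 0 < energy F u p r).
{ intros r Hr. assert (energy F u p (r + 1) < energy F u p r).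
  { eapply energy_lt; eauto; try lra. intros; apply Hp; lra. }
  specialize (HE (r + 1) ltac:(lra)). lra. }
repeat split; auto.
- destruct (Req_dec (u 0) beta) as [E|E]; [|lra].
  specialize (HEs 0 ltac:(lra)). rewrite E0, E, (admissible_beta _ _ _ _ HA) in HEs. lra.
- apply (descent d f F u p b beta); auto; try lra. intros; apply HE; lra.
Qed.

Lemma weighted_root_le r p F : 0 < r -> 0 < p -> F <= 0 -> r * sqrt (p ^ 2 + 2 * F) <= r * p.
Proof.
intros Hr Hp HF. apply Rmult_le_compat_l; [lra|].
rewrite <- (sqrt_pow2 p) at 2 by lra. apply sqrt_le_1_alt. lra.
Qed.

(** * Solutions started just above the ground state *)

(** (H2) in dimension [d + 1], with a genuine derivative in place of [Derive], whose value means
    nothing where the quotient is not differentiable. *)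
Definition pohozaev_cond (d : nat) (f F : R -> R) (beta : R) : Prop :=
  forall s, beta < s -> exists q, is_derive (fun t => F t / f t) s q /\
    (INR d - 1) / (2 * (INR d + 1)) < q.

(** At the centre of [u] its slope is 0, and its [erbe_tang] tends to 0 because [r / p] tends to
    [(d + 1) / f (u 0)]. At that same level [v] already has positive slope and negative [erbe_tang].
    By continuity the comparison can start at a level slightly below [u 0]. *)
Lemma above_ground_state_start d f F b beta u p v q l :
  (1 <= d)%nat -> admissible f F b beta -> pohozaev_cond d f F beta ->
  profile d f u p -> (forall r, 0 <= r -> 0 < u r) -> is_lim u p_infty 0 ->
  profile d f v q -> u 0 < v 0 -> 0 <= l < beta -> reaches v q l ->
  exists delta, 0 < delta /\ forall y1 y2,
    0 < y1 -> (forall t, 0 < t <= y1 -> 0 < p t) ->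
    0 < y2 -> (forall t, 0 < t <= y2 -> 0 < q t) ->
    u y1 = v y2 -> l < u y1 < beta ->
    p y1 < q y2 /\
    y1 * sqrt (p y1 ^ 2 + 2 * F (u y1)) + delta <= y2 * sqrt (q y2 ^ 2 + 2 * F (v y2)).
Proof.
intros Hd HA HPz H Hu Hlim Hv Huv Hl Hreach.
destruct (admissible_b _ _ _ _ HA) as [Hb0 Hbb].
destruct (positive_profile d f F u p b beta) as [HE [Hbu [Hp Hru]]]; auto.
assert (HN : 0 < INR (S d)) by (apply lt_0_INR; lia).
destruct (profile_level _ _ _ _ _ Hv Hreach) as [rho [L [I J]]].
assert (Het : forall r, 0 < r -> (forall t, 0 < t <= r -> 0 < q t) -> beta <= v r ->
     erbe_tang (INR d) (f (v r)) (F (v r)) r (q r) < 0).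
{ intros r Hr Hq Hb. eapply erbe_tang_neg; eauto. intros s Hs; apply HPz; lra. }
set (ET := fun s => erbe_tang (INR d) (f s) (F s) (rho s) (q (rho s))).
set (a := u 0) in *.
assert (Hfa : 0 < f a) by (apply (admissible_pos _ _ _ _ HA); lra).
assert (HFa : 0 < F a) by (eapply prim_pos; eauto).
assert (HETa : ET a < 0).
{ unfold ET. destruct (I a ltac:(lra)) as [I1 I2]. rewrite <- I1 at 1 2. apply Het; auto; try lra.
  apply (level_r _ _ _ _ _ _ L); lra. }
set (K := 2 * (INR d + 1) * F a).
assert (HK : 0 < K). { unfold K. rewrite <- S_INR. repeat apply Rmult_lt_0_compat; lra. }
(* Slightly above [/ f a], the limit of [r / ((d + 1) p)] at the centre of [u]. *)
set (z := / f a + - ET a / (2 * (K + 1))).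
assert (Hz0 : 0 < - ET a / (2 * (K + 1))) by (apply Rdiv_lt_0_compat; lra).
assert (Hfa' : 0 < / f a) by now apply Rinv_0_lt_compat.
assert (Hz : 0 < z) by (unfold z; lra).
assert (Hzc : / z < f a).
{ rewrite <- (Rinv_inv (f a)). apply Rinv_lt_contravar; [apply Rmult_lt_0_compat; auto|unfold z; lra]. }
destruct (slope_ge_near0 d f u p (/ z) H Hd (admissible_cont _ _ _ _ HA _) Hzc) as [tau [Htau Kt]].
(* With [r / p <= (d + 1) z] along [u], the difference of the two [erbe_tang] values is at least
   [D (u r) - r p], and the last term vanishes at the centre. *)
set (D := fun s => 2 * (INR d + 1) * (F s / f s) - 2 * (INR d + 1) * F s * z - ET s).
assert (HDa : 0 < D a).
{ assert (E : 2 * (INR d + 1) * (F a / f a) - 2 * (INR d + 1) * F a * z - ET a =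
   - ET a * (1 - K / (2 * (K + 1)))).
  { assert (E1 : 2 * (INR d + 1) * (F a / f a) = K * / f a) by (unfold K; field; lra).
    rewrite E1. fold K. unfold z. field. lra. }
  unfold D. rewrite E.
  apply Rmult_lt_0_compat; [lra|].
  assert (K / (2 * (K + 1)) < 1); [|lra]. apply (Rmult_lt_reg_r (2 * (K + 1))); [lra|].
  unfold Rdiv. rewrite Rmult_assoc, Rinv_l by lra. lra. }
assert (La : l < a < v 0) by lra.
assert (Pa := level_p _ _ _ _ _ _ L a La). assert (Ra := level_r _ _ _ _ _ _ L a La).
assert (DRa := level_dr _ _ _ _ _ _ L a La). assert (DPa := level_dp _ _ _ _ _ _ L a La).
assert (DFa := admissible_prim _ _ _ _ HA a).
assert (CDa : continuous D a).
{ unfold D, ET, erbe_tang.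
  set (qr := fun s => q (rho s)) in *.
  (* The [F / f] terms of [D] and [ET] cancel, so what is left is differentiable at [a] without any
     differentiability of [f]. *)
  apply (continuous_ext (fun s => rho s * qr s + 2 * F s * (rho s / qr s) - 2 * (INR d + 1) * F s * z)).
  { intros x. match goal with |- ?y = ?y' => change (@eq R y y') end. unfold qr. ring. }
  apply (ex_derive_continuous (fun s => rho s * qr s + 2 * F s * (rho s / qr s) - 2 * (INR d + 1) * F s * z)).
  clearbody qr. auto_derive. repeat split; try (eexists; eassumption). lra. }
set (G := fun r => D (u r) - r * p r).
assert (CG : continuous G 0).
{ apply (continuous_minus (fun r => D (u r)) (fun r => r * p r)).
  - apply (continuous_comp u D); auto. apply H.
  - apply (continuous_mult (fun r => r) p); [apply continuous_id|apply H]. }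
destruct (continuous_pos G 0 CG) as [e1 [He1 K1]].
{ unfold G. rewrite (profile_p0 _ _ _ _ H). fold a. lra. }
assert (CQ : continuous (fun r => q (rho (u r)) - p r) 0).
{ apply (continuous_minus (fun r => q (rho (u r))) p); [|apply H].
  apply (continuous_comp u (fun s => q (rho s))); [apply H|]. eapply derive_continuous; eauto. }
destruct (continuous_pos _ 0 CQ) as [e2 [He2 K2]].
{ rewrite (profile_p0 _ _ _ _ H). fold a. lra. }
destruct (continuous_pos (fun r => u r - beta) 0) as [e3 [He3 K3]].
{ apply (continuous_minus u (fun _ => beta)); [apply H|apply continuous_const]. }
{ fold a; lra. }
set (x := Rmin tau (Rmin (e1 / 2) (Rmin (e2 / 2) (e3 / 2)))).
assert (Hx : 0 < x /\ x <= tau /\ x < e1 /\ x < e2 /\ x < e3) by (unfold x; minmax).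
assert (Hxa : forall e, x < e -> Rabs (x - 0) < e) by (intros e Hxe; rewrite Rminus_0_r, Rabs_right; lra).
specialize (K1 x ltac:(apply Hxa; lra)). specialize (K2 x ltac:(apply Hxa; lra)).
specialize (K3 x ltac:(apply Hxa; lra)). simpl in K2, K3.
assert (Hpx : 0 < p x) by (apply Hp; lra).
assert (Hux : u x < a).
{ unfold a. eapply profile_decr; eauto; [lra|]. intros; apply Hp; lra. }
destruct (I (u x) ltac:(lra)) as [I1 I2].
assert (Hrx : 0 < rho (u x)) by (apply (level_r _ _ _ _ _ _ L); lra).
apply (profile_compare d f F b beta f u p f v q l a x (rho (u x))); auto; try (unfold a in *; lra).
- eapply reaches_mono; eauto. lra.
- intros; apply Hp; lra.
- rewrite I1. unfold G, D, ET in K1.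
  assert (HFx : 0 < F (u x)) by (eapply prim_pos; eauto; lra).
  unfold erbe_tang at 2. 
  assert (Kx := Kt x ltac:(lra)).
  assert (Hxp : x / p x <= (INR d + 1) * z).
  { rewrite <- S_INR. apply (Rmult_le_reg_r (p x)); auto.
    replace (x / p x * p x) with x by (field; lra).
    apply (Rmult_le_compat_l (INR (S d) * z)) in Kx; [|apply Rlt_le, Rmult_lt_0_compat; auto].
    replace (INR (S d) * z * (/ z * x / INR (S d))) with x in Kx by (field; lra). auto. }
  assert (2 * F (u x) * (x / p x) <= 2 * F (u x) * ((INR d + 1) * z)) by (apply Rmult_le_compat_l; lra).
  lra.
- intros r Hr Hpr Hlr. specialize (HE r ltac:(lra)). unfold energy in HE. lra.
- intros r Hr Hqr Hb. apply Het; auto; lra.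
Qed.

Lemma above_ground_state_crosses d f F b beta u p v q :
  (2 <= d)%nat -> admissible f F b beta -> pohozaev_cond d f F beta ->
  (forall s, 0 <= s <= b -> f s <= 0) ->
  profile d f u p -> (forall r, 0 <= r -> 0 < u r) -> is_lim u p_infty 0 ->
  profile d f v q -> u 0 < v 0 -> exists r, 0 <= r /\ v r < 0.
Proof.
intros Hd HA HPz Hfb H Hu Hlim Hv Huv. apply NNPP. intros Hn.
assert (Hv0 : forall r, 0 <= r -> 0 <= v r).
{ intros r Hr. apply Rnot_lt_le. intros Hlt. apply Hn. exists r; auto. }
destruct (admissible_b _ _ _ _ HA) as [Hb0 Hbb].
destruct (positive_profile d f F u p b beta) as [HE [Hbu [Hp Hru]]]; auto; try lia.
(* If the energy of [v] first vanished at [c], then [v c < beta]; at this level [u] has the smaller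
   slope, hence negative energy, against [positive_profile]. *)
assert (HEv : forall r, 0 < r -> (forall t, 0 <= t <= r -> 0 < v t) -> 0 <= energy F v q r).
{ intros r Hr Hpos. apply Rnot_lt_le. intros Hneg.
  destruct (first_zero (energy F v q) 0 r) as [c [Hc1 [Hc2 Hc3]]]; try lra.
  { intros x Hx. eapply energy_continuous; eauto; lra. }
  { unfold energy. rewrite (profile_p0 _ _ _ _ Hv).
    assert (0 < F (v 0)) by (eapply prim_pos; eauto; lra). lra. }
  assert (Hq : forall t, 0 < t <= c -> 0 < q t).
  { apply (slope_pos d f F v q b beta c); auto; try lia; try lra. intros; apply Hpos; lra. }
  assert (Hqc : 0 < q c) by (apply Hq; lra).
  destruct (continuous_pos q c) as [e1 [He1 K1]]; auto.
  { eapply profile_cp; eauto; lra. }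
  destruct (continuous_pos v c) as [e2 [He2 K2]].
  { eapply profile_cu; eauto; lra. } { apply Hpos; lra. }
  (* The comparison covers only levels strictly above its lower end, so [v] is followed slightly
     past [c], where it is still positive and decreasing. *)
  set (R := c + Rmin (e1 / 2) (e2 / 2)).
  assert (HR : c < R /\ R < c + e1 /\ R < c + e2) by (unfold R; minmax).
  assert (HqR : forall t, 0 < t <= R -> 0 < q t).
  { intros t Ht. destruct (Rle_lt_dec t c); [apply Hq; lra|]. apply K1. apply Rabs_def1; lra. }
  assert (HvR : 0 < v R) by (apply K2; apply Rabs_def1; lra).
  assert (HvRc : v R < v c) by decr.
  assert (Hvc : v c < beta).
  { apply Rnot_le_lt. intros Hle. assert (0 <= F (v c)) by (eapply prim_ge0; eauto).
    unfold energy in Hc2. assert (0 < q c ^ 2) by (apply pow_lt; auto). lra. }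
  destruct (above_ground_state_start d f F b beta u p v q (v R)) as [delta [Hdelta K]]; auto; try lia; try lra.
  { eapply reaches_of_slope; eauto. lra. }
  assert (v c < v 0) by decr.
  destruct (Hru (v c)) as [y [Hy1 [Hy2 Hy3]]]; [lra|].
  destruct (K y c) as [K3 _]; auto; try lra.
  specialize (HE y ltac:(lra)). unfold energy in HE, Hc2. rewrite Hy2 in HE.
  assert (0 < p y) by (apply Hp; auto). simpl in HE, Hc2. nra. }
assert (Hrv : reaches v q 0) by (apply (descent d f F v q b beta); auto; try lia; lra).
destruct (above_ground_state_start d f F b beta u p v q 0) as [delta [Hdelta K]]; auto; try lia; try lra.
(* [W] along [v] is at most [r q], which drops below the guaranteed gap [delta]. *)
destruct (weighted_slope_small d f F v q b beta delta) as [r [Hr1 [Hr2 [Hr3 Hr4]]]]; auto; try lia; try lra.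
{ intros r Hr Hpos. apply (slope_pos d f F v q b beta r); auto; try lia; lra. }
destruct (Hru (v r)) as [y [Hy1 [Hy2 Hy3]]]; [lra|].
destruct (K y r) as [_ K2]; auto; try lra.
assert (r * sqrt (q r ^ 2 + 2 * F (v r)) <= r * q r).
{ apply weighted_root_le; auto. apply Hr3; lra. left. apply (admissible_neg _ _ _ _ HA); auto. }
assert (0 <= y * sqrt (p y ^ 2 + 2 * F (u y))) by (apply Rmult_le_pos; [lra|apply sqrt_pos]).
lra.
Qed.

(** * Solutions with a steep initial layer *)

Lemma profile_lower d f u p x y C k :
  profile d f u p -> 0 <= x <= y -> (forall t, x < t < y -> p t <= C * t + k) ->
  u x - C * (y ^ 2 - x ^ 2) / 2 - k * (y - x) <= u y.
Proof.
intros H Hxy Hp.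
assert (- u y - C * y ^ 2 / 2 - k * y <= - u x - C * x ^ 2 / 2 - k * x); [|lra].
apply (nonincr_le (fun t => - u t - C * t ^ 2 / 2 - k * t) (fun t => - - p t - C * t - k)); try lra.
- intros t Ht. apply (continuous_minus (fun t => - u t - C * t ^ 2 / 2) (fun t => k * t)).
  + apply (continuous_minus (fun t => - u t) (fun t => C * t ^ 2 / 2)).
    * apply (continuous_opp u). eapply profile_cu; eauto. lra.
    * apply (derive_continuous _ t (C * t)). auto_derive; auto; field.
  + apply (derive_continuous _ t k). auto_derive; auto; ring.
- intros t Ht. assert (DU := profile_u _ _ _ _ H t ltac:(lra)). auto_derive.
  + eexists; eassumption.
  + rewrite (Derive_eq _ _ _ DU). field.
- intros t Ht. specialize (Hp t Ht). lra.
Qed.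

Lemma profile_upper d f u p x y C k :
  profile d f u p -> 0 <= x <= y -> (forall t, x < t < y -> C * t + k <= p t) ->
  u y <= u x - C * (y ^ 2 - x ^ 2) / 2 - k * (y - x).
Proof.
intros H Hxy Hp.
assert (K := profile_lower d _ _ _ x y (- C) (- k) (profile_opp _ _ _ _ H) Hxy).
simpl in K. assert (K' : - u x - - C * (y ^ 2 - x ^ 2) / 2 - - k * (y - x) <= - u y).
{ apply K. intros t Ht. specialize (Hp t Ht). lra. }
lra.
Qed.

(** Made for the region past the layer: for [d >= 2] a flux of order [X^(d-1)] gives slope of order
    [X / t^2], whose integral from [2 X] on is bounded independently of [X]. *)
Lemma profile_lower_sq d f u p x y C k :
  profile d f u p -> 0 < x <= y -> (forall t, x < t < y -> p t <= k * / t ^ 2 + C * t) ->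
  u x - k * (/ x - / y) - C * (y ^ 2 - x ^ 2) / 2 <= u y.
Proof.
intros H Hxy Hp.
assert (- u y - C * y ^ 2 / 2 + k * / y <= - u x - C * x ^ 2 / 2 + k * / x); [|lra].
assert (D : forall t, 0 < t -> is_derive (fun t => - u t - C * t ^ 2 / 2 + k * / t) t
   (- - p t - C * t - k * / t ^ 2)).
{ intros t Ht. assert (DU := profile_u _ _ _ _ H t Ht). auto_derive.
  + split; [eexists; eassumption|lra].
  + rewrite (Derive_eq _ _ _ DU). field. lra. }
apply (nonincr_le (fun t => - u t - C * t ^ 2 / 2 + k * / t) (fun t => - - p t - C * t - k * / t ^ 2)); try lra.
- intros t Ht. eapply derive_continuous, D; lra.
- intros t Ht. apply D; lra.
- intros t Ht. specialize (Hp t Ht). lra.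
Qed.

Lemma exists_root n y : 0 < y -> exists r, 0 < r /\ r ^ S n = y.
Proof.
intros Hy. exists (Rpower y (/ INR (S n))). split; [apply exp_pos|].
rewrite <- Rpower_pow by apply exp_pos. rewrite Rpower_mult, Rinv_l.
- apply Rpower_1; auto.
- apply not_0_INR; lia.
Qed.

(* The initial layer [0 <= r <= 2 X] of a profile driven by [lam = A ^ 2] times
   a function with values in [[m, M]]; [RB] is the radius where [w] reaches [b]. *)
Lemma steep_layer d g G w q b beta al h e lam m M M1 X RB :
  profile d g w q -> admissible g G b beta -> (2 <= d)%nat ->
  beta < al -> 0 < m <= M -> 0 < h -> 0 < e -> 4 * e <= h -> 0 < lam -> 0 < M1 ->
  8 * e * 2 ^ d <= h * m / M ->
  (4 + 2 ^ d * 8) * (h * M / m) <= (al - beta) / 4 ->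
  w 0 = al + h ->
  (forall s, al + 2 * e <= s <= al + h -> lam * m <= g s) ->
  (forall s, s <= al + h -> g s <= lam * M) ->
  (forall s, 0 <= s <= al -> g s <= M1) ->
  0 < X -> w X = al + 2 * e -> w RB = b -> 0 < RB ->
  (forall t, 0 < t <= RB -> 0 < q t) -> X < RB ->
  lam * X ^ 2 <= 2 * INR (S d) * h / m /\
  (forall r, X <= r <= RB -> X ^ pred d * (h * m / M) <= r ^ d * q r) /\
  2 * X < RB /\
  (forall r, 2 * X <= r <= RB -> w r <= al - h * m / M / (4 * 2 ^ d)) /\
  (forall r, 2 * X <= r <= RB ->
     r ^ d * q r <= 2 ^ d * 4 * (h * M / m) * X ^ pred d + M1 * r ^ S d / INR (S d)) /\
  (forall r, 2 * X <= r <= RB -> M1 * r ^ 2 <= (al - beta) / 4 -> (al + beta) / 2 <= w r).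
Proof.
intros H HA Hd Hal Hm Hh He0 He Hlam HM1 Hk HC Hw0 Hg1 Hg2 Hg3 HX HwX HwB HRB Hq HXB.
destruct (admissible_b _ _ _ _ HA) as [Hb0 Hbb].
assert (HN : 3 <= INR (S d)) by (replace 3 with (INR 3) by (simpl; ring); apply le_INR; lia).
assert (Hdec : forall x y, 0 <= x -> x < y -> y <= RB -> w y < w x).
{ intros x y Hx Hxy Hy. decr. }
assert (Hdec' : forall x y, 0 <= x -> x <= y -> y <= RB -> w y <= w x).
{ intros x y Hx Hxy Hy. destruct (Req_dec x y) as [->|]; [lra|]. left. apply Hdec; lra. }
assert (Hle0 : forall t, 0 <= t <= RB -> w t <= al + h).
{ intros t Ht. rewrite <- Hw0. apply Hdec'; lra. }
assert (HqM : forall t, 0 < t <= RB -> q t <= lam * M * t / INR (S d)).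
{ intros t Ht. eapply slope_le; eauto; try lia; try lra. intros s Hs. apply Hg2, Hle0; lra. }
assert (Hqm : forall t, 0 < t <= X -> lam * m * t / INR (S d) <= q t).
{ intros t Ht. eapply slope_ge; eauto; try lia; try lra. intros s Hs. apply Hg1.
  split; [rewrite <- HwX; apply Hdec'; lra|apply Hle0; lra]. }
set (N := INR (S d)) in *.
assert (HMm : 0 < h * m / M) by (apply Rdiv_lt_0_compat; [apply Rmult_lt_0_compat|]; lra).
assert (HmM : 0 < h * M / m) by (apply Rdiv_lt_0_compat; [apply Rmult_lt_0_compat|]; lra).
(* Slope at least [lam m t / N] up to [X], against a total drop of at most [h]. *)
assert (E1 : lam * X ^ 2 <= 2 * N * h / m).
{ assert (K := profile_upper d g w q 0 X (lam * m / N) 0 H ltac:(lra)).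
  assert (K1 : w X <= w 0 - lam * m / N * (X ^ 2 - 0 ^ 2) / 2 - 0 * (X - 0)).
  { apply K. intros t Ht. specialize (Hqm t ltac:(lra)). unfold Rdiv in *. lra. }
  apply (Rmult_le_reg_r (m / (2 * N))); [apply Rdiv_lt_0_compat; lra|].
  replace (2 * N * h / m * (m / (2 * N))) with h by (field; lra).
  replace (lam * X ^ 2 * (m / (2 * N))) with (lam * m / N * (X ^ 2 - 0 ^ 2) / 2 + 0 * (X - 0)) by (field; lra).
  lra. }
assert (Hlow : forall r, 0 <= r <= RB -> al + h - lam * M / N * r ^ 2 / 2 <= w r).
{ intros r Hr. assert (K := profile_lower d g w q 0 r (lam * M / N) 0 H ltac:(lra)).
  assert (K1 : w 0 - lam * M / N * (r ^ 2 - 0 ^ 2) / 2 - 0 * (r - 0) <= w r).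
  { apply K. intros t Ht. specialize (HqM t ltac:(lra)). unfold Rdiv in *. lra. }
  replace (r ^ 2 - 0 ^ 2) with (r ^ 2) in K1 by ring. lra. }
(* Conversely, slope at most [lam M t / N] must produce a drop of [h - 2 e >= h / 2]. So [lam X^2]
   is of fixed order whatever [lam]. *)
assert (E2 : N * h / M <= lam * X ^ 2).
{ specialize (Hlow X ltac:(lra)). rewrite HwX in Hlow.
  apply (Rmult_le_reg_r (M / (2 * N))); [apply Rdiv_lt_0_compat; lra|].
  replace (N * h / M * (M / (2 * N))) with (h / 2) by (field; lra).
  replace (lam * X ^ 2 * (M / (2 * N))) with (lam * M / N * X ^ 2 / 2) by (field; lra). lra. }
assert (HXd : X ^ d = X * X ^ pred d) by (destruct d; [lia|reflexivity]).
assert (HXp : 0 < X ^ pred d) by (apply pow_lt; lra).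
assert (E3 : X ^ pred d * (h * m / M) <= X ^ d * q X).
{ rewrite HXd. specialize (Hqm X ltac:(lra)).
  apply Rle_trans with (X * X ^ pred d * (lam * m * X / N)).
  - replace (X * X ^ pred d * (lam * m * X / N)) with (X ^ pred d * (lam * X ^ 2 * (m / N))) by (field; lra).
    replace (h * m / M) with (N * h / M * (m / N)) by (field; lra).
    apply Rmult_le_compat_l; [lra|]. apply Rmult_le_compat_r; auto.
    left; apply Rdiv_lt_0_compat; lra.
  - apply Rmult_le_compat_l; auto. apply Rmult_le_pos; lra. }
assert (E4 : forall r, X <= r <= RB -> X ^ pred d * (h * m / M) <= r ^ d * q r).
{ intros r Hr. assert (K := flux_ge d g w q X r 0 H ltac:(lia) ltac:(lra)).
  unfold Rdiv in K. rewrite !Rmult_0_l, Rplus_0_r in K. apply Rle_trans with (1 := E3), K.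
  intros t Ht. left. apply (admissible_pos _ _ _ _ HA). rewrite <- HwB. apply Hdec; lra. }
assert (E4X : lam * M / N * (2 * X) ^ 2 / 2 <= 4 * (h * M / m)).
{ replace (lam * M / N * (2 * X) ^ 2 / 2) with (lam * X ^ 2 * (2 * M / N)) by (field; lra).
  replace (4 * (h * M / m)) with (2 * N * h / m * (2 * M / N)) by (field; lra).
  apply Rmult_le_compat_r; auto. left; apply Rdiv_lt_0_compat; lra. }
assert (H2d : 1 <= 2 ^ d) by (apply pow_R1_Rle; lra).
assert (E5 : 2 * X < RB).
{ apply Rnot_le_lt. intros Hle. specialize (Hlow RB ltac:(lra)). rewrite HwB in Hlow.
  assert (lam * M / N * RB ^ 2 / 2 <= lam * M / N * (2 * X) ^ 2 / 2).
  { assert (0 < lam * M / N) by (apply Rdiv_lt_0_compat; [apply Rmult_lt_0_compat|]; lra).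
    assert (RB ^ 2 <= (2 * X) ^ 2) by (apply pow_incr; lra).
    unfold Rdiv at 1 3. apply Rmult_le_compat_r; [lra|]. apply Rmult_le_compat_l; lra. }
  assert (0 <= 2 ^ d * 8 * (h * M / m)) by (apply Rmult_le_pos; lra). lra. }
(* On [[X, 2 X]] the flux bound gives slope at least [h m / M / (2^d X)], hence a drop of four times
   the claimed margin, from which at most one margin is lost to [2 e]. *)
assert (E6 : forall r, 2 * X <= r <= RB -> w r <= al - h * m / M / (4 * 2 ^ d)).
{ intros r Hr. apply Rle_trans with (w (2 * X)); [apply Hdec'; lra|].
  set (k := h * m / M / (2 ^ d * X)).
  assert (K := profile_upper d g w q X (2 * X) 0 k H ltac:(lra)).
  assert (K1 : w (2 * X) <= w X - 0 * ((2 * X) ^ 2 - X ^ 2) / 2 - k * (2 * X - X)).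
  { apply K. intros t Ht. specialize (E4 t ltac:(lra)).
    assert (Htd : 0 < t ^ d) by (apply pow_lt; lra).
    assert (Htd2 : t ^ d <= (2 * X) ^ d) by (apply pow_incr; lra).
    apply (Rmult_le_reg_l (t ^ d)); auto. apply Rle_trans with (2 := E4).
    rewrite Rmult_0_l, Rplus_0_l.
    apply Rle_trans with ((2 * X) ^ d * k).
    - apply Rmult_le_compat_r; auto. unfold k. left. apply Rdiv_lt_0_compat; auto.
      apply Rmult_lt_0_compat; lra.
    - right. rewrite Rpow_mult_distr, HXd. unfold k. field. lra. }
  replace (k * (2 * X - X)) with (h * m / M / 2 ^ d) in K1 by (unfold k; field; lra).
  rewrite HwX in K1.
  assert (2 * e <= h * m / M / (4 * 2 ^ d)).
  { apply (Rmult_le_reg_r (4 * 2 ^ d)); [lra|].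
    replace (h * m / M / (4 * 2 ^ d) * (4 * 2 ^ d)) with (h * m / M) by (field; lra). lra. }
  assert (h * m / M / 2 ^ d = 4 * (h * m / M / (4 * 2 ^ d))) by (field; lra). 
  assert (0 < h * m / M / (4 * 2 ^ d)) by (apply Rdiv_lt_0_compat; lra).
  lra. }
(* The flux at [2 X] is of order [X^(d-1)] because [lam X^2] is bounded; below level [al] the source
   adds at most [M1]. *)
assert (E7 : forall r, 2 * X <= r <= RB ->
     r ^ d * q r <= 2 ^ d * 4 * (h * M / m) * X ^ pred d + M1 * r ^ S d / N).
{ intros r Hr.
  assert (K := flux_le d g w q (2 * X) r M1 H ltac:(lia) ltac:(lra)).
  assert (K1 : r ^ d * q r <= (2 * X) ^ d * q (2 * X) + M1 * (r ^ S d - (2 * X) ^ S d) / N).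
  { apply K. intros t Ht. apply Hg3. split.
    - left. apply Rlt_trans with b; auto. rewrite <- HwB. apply Hdec; lra.
    - specialize (E6 t ltac:(lra)). assert (0 < h * m / M / (4 * 2 ^ d)) by (apply Rdiv_lt_0_compat; lra). lra. }
  assert (K2 : (2 * X) ^ d * q (2 * X) <= 2 ^ d * 4 * (h * M / m) * X ^ pred d).
  { apply Rle_trans with ((2 * X) ^ d * (lam * M * (2 * X) / N)).
    - apply Rmult_le_compat_l; [left; apply pow_lt; lra|apply HqM; lra].
    - rewrite Rpow_mult_distr, HXd.
      replace (2 ^ d * (X * X ^ pred d) * (lam * M * (2 * X) / N)) with
        (2 ^ d * X ^ pred d * (lam * X ^ 2 * (2 * M / N))) by (field; lra).
      replace (2 ^ d * 4 * (h * M / m) * X ^ pred d) with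
        (2 ^ d * X ^ pred d * (2 * N * h / m * (2 * M / N))) by (field; lra).
      apply Rmult_le_compat_l; [apply Rmult_le_pos; lra|].
      apply Rmult_le_compat_r; auto. left; apply Rdiv_lt_0_compat; lra. }
  assert (K3 : M1 * (r ^ S d - (2 * X) ^ S d) / N <= M1 * r ^ S d / N).
  { unfold Rdiv. apply Rmult_le_compat_r; [left; apply Rinv_0_lt_compat; lra|].
    apply Rmult_le_compat_l; [lra|]. assert (0 < (2 * X) ^ S d) by (apply pow_lt; lra). lra. }
  lra. }
repeat split; auto.
(* Losses below [al]: at most [4 h M / m] up to [2 X], then [C0] from the layer flux, together at
   most [(al - beta) / 4] by the smallness of [h], and another [(al - beta) / 4] from [M1]. *)
intros r Hr HMr.
set (C0 := 2 ^ d * 4 * (h * M / m)) in *.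
assert (HC0 : 0 < C0) by (unfold C0; apply Rmult_lt_0_compat; lra).
assert (K := profile_lower_sq d g w q (2 * X) r (M1 / N) (C0 * X) H ltac:(lra)).
assert (K1 : w (2 * X) - C0 * X * (/ (2 * X) - / r) - M1 / N * (r ^ 2 - (2 * X) ^ 2) / 2 <= w r).
{ apply K. intros t Ht. specialize (E7 t ltac:(lra)).
  assert (Htd : 0 < t ^ d) by (apply pow_lt; lra).
  apply (Rmult_le_reg_l (t ^ d)); auto. apply Rle_trans with (1 := E7).
  rewrite Rmult_plus_distr_l. apply Rplus_le_compat.
  - destruct d as [|[|d']]; try lia. simpl Nat.pred.
    replace (t ^ S (S d') * (C0 * X * / t ^ 2)) with (C0 * (X * t ^ d')) by (simpl; field; lra).
    apply Rmult_le_compat_l; [lra|]. simpl. apply Rmult_le_compat_l; [lra|]. apply pow_incr; lra.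
  - right. simpl. unfold Rdiv. ring. }
specialize (Hlow (2 * X) ltac:(lra)).
assert (K2 : C0 * X * (/ (2 * X) - / r) <= C0).
{ assert (0 < / r) by (apply Rinv_0_lt_compat; lra).
  assert (C0 * X * / (2 * X) = C0 / 2) by (field; lra).
  assert (0 < C0 * X * / r) by (apply Rmult_lt_0_compat; [apply Rmult_lt_0_compat|]; lra).
  rewrite Rmult_minus_distr_l. lra. }
assert (K3 : M1 / N * (r ^ 2 - (2 * X) ^ 2) / 2 <= (al - beta) / 4).
{ apply Rle_trans with (M1 * r ^ 2); auto.
  assert (0 < M1 / N) by (apply Rdiv_lt_0_compat; lra).
  assert (M1 / N <= M1). { apply (Rmult_le_reg_r N); [lra|]. unfold Rdiv. rewrite Rmult_assoc, Rinv_l by lra. nra. }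
  assert (0 <= r ^ 2) by apply pow2_ge_0. assert (0 <= (2 * X) ^ 2) by apply pow2_ge_0.
  assert (M1 / N * (r ^ 2 - (2 * X) ^ 2) <= M1 / N * r ^ 2) by (apply Rmult_le_compat_l; lra).
  assert (M1 / N * r ^ 2 <= M1 * r ^ 2) by (apply Rmult_le_compat_r; lra).
  assert (0 <= M1 * r ^ 2) by (apply Rmult_le_pos; lra). lra. }
assert (0 <= 2 ^ d * 4 * (h * M / m)) by (apply Rmult_le_pos; lra).
unfold C0 in *. lra.
Qed.

Lemma pow_S_lt x y n : 0 <= x < y -> x ^ S n < y ^ S n.
Proof.
intros H. induction n as [|n IH]; [simpl; lra|].
rewrite <- (tech_pow_Rmult x (S n)), <- (tech_pow_Rmult y (S n)).
assert (0 <= x ^ S n) by (apply pow_le; lra). nra.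
Qed.

Lemma pow_S_le_inv x y n : 0 <= y -> x ^ S n <= y ^ S n -> x <= y.
Proof.
intros Hy H. apply Rnot_lt_le. intros Hlt. assert (K := pow_S_lt y x n ltac:(lra)). lra.
Qed.

(** All constants up to [Lam] depend on the ground state and on [m], [M], [h] only. Since [Lam]
    precedes [e] and [g], the thresholds for [eps] and [A] in the theorem can be chosen
    independently of each other. *)
Lemma steep_profile_positive d f F b beta u p m M h :
  (2 <= d)%nat -> admissible f F b beta -> pohozaev_cond d f F beta ->
  (forall s, 0 <= s <= b -> f s <= 0) ->
  profile d f u p -> (forall r, 0 <= r -> 0 < u r) -> is_lim u p_infty 0 ->
  0 < m <= M -> 0 < h -> (4 + 2 ^ d * 8) * (h * M / m) <= (u 0 - beta) / 4 ->
  exists Lam, 0 < Lam /\ forall lam e g G w q,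
    Lam < lam -> 0 < e -> 4 * e <= h -> 8 * e * 2 ^ d <= h * m / M ->
    profile d g w q -> admissible g G b beta ->
    (forall s, s <= u 0 + e -> g s = f s) -> (forall s, s <= u 0 + e -> G s = F s) ->
    w 0 = u 0 + h ->
    (forall s, u 0 + 2 * e <= s <= u 0 + h -> lam * m <= g s) ->
    (forall s, s <= u 0 + h -> g s <= lam * M) ->
    forall r, 0 <= r -> 0 < w r.
Proof.
intros Hd HA HPz Hfb H Hu Hlim Hm Hh HC.
destruct (admissible_b _ _ _ _ HA) as [Hb0 Hbb].
destruct (positive_profile d f F u p b beta) as [HE [Hbu [Hp Hru]]]; auto; try lia.
set (al := u 0) in *. set (N := INR (S d)).
assert (HN : 3 <= N) by (unfold N; replace 3 with (INR 3) by (simpl; ring); apply le_INR; lia).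
assert (H2d : 1 <= 2 ^ d) by (apply pow_R1_Rle; lra).
assert (HMm : 0 < h * m / M) by (apply Rdiv_lt_0_compat; [apply Rmult_lt_0_compat|]; lra).
assert (HmM : 0 < h * M / m) by (apply Rdiv_lt_0_compat; [apply Rmult_lt_0_compat|]; lra).
set (k0 := h * m / M) in *. set (kap := k0 / (4 * 2 ^ d)).
assert (Hkap : 0 < kap) by (apply Rdiv_lt_0_compat; lra).
assert (Hkap2 : kap < (al - beta) / 2).
{ assert (k0 <= h).
  { unfold k0. apply (Rmult_le_reg_r M); [lra|]. replace (h * m / M * M) with (h * m) by (field; lra). nra. }
  assert (h <= h * M / m).
  { apply (Rmult_le_reg_r m); [lra|]. replace (h * M / m * m) with (h * M) by (field; lra). nra. }
  assert (kap <= k0 / 4).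
  { unfold kap. apply (Rmult_le_reg_r (4 * 2 ^ d)); [lra|].
    replace (k0 / (4 * 2 ^ d) * (4 * 2 ^ d)) with k0 by (field; lra). nra. }
  assert (0 <= 2 ^ d * 8 * (h * M / m)) by (apply Rmult_le_pos; lra). lra. }
destruct (max_on f 0 al) as [sM [HsM1 HsM2]]; [lra|intros; apply HA|].
set (M1 := f sM) in *.
assert (HM1 : 0 < M1).
{ apply Rlt_le_trans with (f al); [apply (admissible_pos _ _ _ _ HA); lra|apply HsM2; lra]. }
(* The steep profile will be compared at a level between [(al + beta) / 2] and [al - kap]. There the
   radius of [u] lies in [[ra, rb]], on which its slope has positive bounds [pi] and [Pi]. *)
destruct (Hru (al - kap)) as [ra [Hra1 [Hra2 Hra3]]]; [fold al; lra|].
destruct (Hru ((al + beta) / 2)) as [rb [Hrb1 [Hrb2 Hrb3]]]; [fold al; lra|].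
assert (Hrng : forall x, 0 < x -> (al + beta) / 2 <= u x <= al - kap -> ra <= x <= rb).
{ intros x Hx Hux. split; apply Rnot_lt_le; intros Hlt.
  - assert (u ra < u x) by decr. lra.
  - assert (u x < u rb) by decr. lra. }
assert (Hrab : ra <= rb).
{ apply Rnot_lt_le. intros Hlt. assert (u ra < u rb) by decr. lra. }
destruct (min_on p ra rb Hrab) as [y1 [Hy1 Hmin]]; [intros; eapply profile_cp; eauto; lra|].
destruct (max_on p ra rb Hrab) as [y2 [Hy2 Hmax]]; [intros; eapply profile_cp; eauto; lra|].
set (pi := p y1) in *. set (Pi := p y2) in *.
assert (Hpi : 0 < pi) by (apply Hp; lra). assert (HPi : 0 < Pi) by (apply Hp; lra).
(* A lower bound for [r / p] along [u] on [[ra, rb]]. *)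
set (eta := ra / Pi). assert (Heta : 0 < eta) by (apply Rdiv_lt_0_compat; lra).
assert (Hek : 0 < eta * k0) by (apply Rmult_lt_0_compat; lra).
set (C0 := 2 ^ d * 4 * (h * M / m)).
assert (HC0 : 0 < C0) by (unfold C0; apply Rmult_lt_0_compat; lra).
(* The constant in [q <= C1 r] at the comparison radius [r1], defined by
   [r1^(d+1) = eta k0 X^(d-1)]: dividing the flux bound by [r1^(d+1)] gives these two terms. *)
set (C1 := C0 / (eta * k0) + M1 / N).
assert (HC1 : 0 < C1).
{ unfold C1. assert (0 < C0 / (eta * k0)) by (apply Rdiv_lt_0_compat; lra).
  assert (0 < M1 / N) by (apply Rdiv_lt_0_compat; lra). lra. }
(* For [r1 <= rbar] the steep profile has slope below [pi] and [r q] below [ra pi], as the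
   comparison asks; [rbar <= 1] makes the condition on [M1 rbar] imply the one on [M1 rbar^2]. *)
assert (Hrbar : exists rbar, 0 < rbar /\ rbar <= 1 /\ C1 * rbar < pi /\ C1 * rbar < ra * pi /\
   M1 * rbar <= (al - beta) / 4).
{ assert (A1 : 0 < pi / (2 * C1)) by (apply Rdiv_lt_0_compat; lra).
  assert (A2 : 0 < ra * pi / (2 * C1)) by (apply Rdiv_lt_0_compat; [apply Rmult_lt_0_compat|]; lra).
  assert (A3 : 0 < (al - beta) / (4 * M1)) by (apply Rdiv_lt_0_compat; lra).
  set (rbar := Rmin 1 (Rmin (pi / (2 * C1)) (Rmin (ra * pi / (2 * C1)) ((al - beta) / (4 * M1))))).
  assert (Hr : 0 < rbar /\ rbar <= 1 /\ rbar <= pi / (2 * C1) /\ rbar <= ra * pi / (2 * C1) /\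
     rbar <= (al - beta) / (4 * M1)) by (unfold rbar; minmax).
  exists rbar. destruct Hr as [R0 [R1 [R2 [R3 R4]]]].
  apply (Rmult_le_compat_l C1) in R2; [|lra]. apply (Rmult_le_compat_l C1) in R3; [|lra].
  apply (Rmult_le_compat_l M1) in R4; [|lra].
  replace (C1 * (pi / (2 * C1))) with (pi / 2) in R2 by (field; lra).
  replace (C1 * (ra * pi / (2 * C1))) with (ra * pi / 2) in R3 by (field; lra).
  replace (M1 * ((al - beta) / (4 * M1))) with ((al - beta) / 4) in R4 by (field; lra).
  assert (0 < ra * pi) by (apply Rmult_lt_0_compat; lra). repeat split; lra. }
destruct Hrbar as [rbar [Hrb0 [Hrb1' [Hr1 [Hr2 Hr3]]]]].
(* These conditions yield [2 X <= r1 <= rbar] whenever [X <= xb]; they use [X^(d-1) <= X] and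
   [X^2 <= X], valid for [X <= 1] and [d >= 2]. *)
assert (Hxbar : exists xb, 0 < xb /\ xb <= 1 /\ eta * k0 * xb <= rbar ^ S d /\ 2 ^ S d * xb <= eta * k0).
{ assert (A1 : 0 < rbar ^ S d / (eta * k0)) by (apply Rdiv_lt_0_compat; [apply pow_lt|]; lra).
  assert (H2 : 0 < 2 ^ S d) by (apply pow_lt; lra).
  assert (A2 : 0 < eta * k0 / 2 ^ S d) by (apply Rdiv_lt_0_compat; lra).
  set (xb := Rmin 1 (Rmin (rbar ^ S d / (eta * k0)) (eta * k0 / 2 ^ S d))).
  assert (Hx : 0 < xb /\ xb <= 1 /\ xb <= rbar ^ S d / (eta * k0) /\ xb <= eta * k0 / 2 ^ S d)
    by (unfold xb; minmax).
  exists xb. destruct Hx as [R0 [R1 [R2 R3]]].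
  apply (Rmult_le_compat_l (eta * k0)) in R2; [|lra]. apply (Rmult_le_compat_l (2 ^ S d)) in R3; [|lra].
  replace (eta * k0 * (rbar ^ S d / (eta * k0))) with (rbar ^ S d) in R2 by (field; split; lra).
  replace (2 ^ S d * (eta * k0 / 2 ^ S d)) with (eta * k0) in R3 by (field; lra).
  repeat split; lra. }
destruct Hxbar as [xb [Hxb0 [Hxb1 [Hxb2 Hxb3]]]].
(* As [lam X^2 <= 2 N h / m], a larger [lam] forces [X <= xb]. *)
exists (2 * N * h / m / xb ^ 2). split.
{ apply Rdiv_lt_0_compat; [|apply pow_lt; lra]. apply Rdiv_lt_0_compat; [|lra].
  repeat apply Rmult_lt_0_compat; lra. }
intros lam e g G w q Hlam He0 He Hek2 Hw HAg Hgf HGF Hw0 Hg1 Hg2 r Hr.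
assert (Hlam0 : 0 < lam).
{ apply Rlt_trans with (2 := Hlam). apply Rdiv_lt_0_compat; [|apply pow_lt; lra].
  apply Rdiv_lt_0_compat; [|lra]. repeat apply Rmult_lt_0_compat; lra. }
apply Rnot_le_lt. intros Hneg.
destruct (first_zero w 0 r) as [z [Hz1 [Hz2 Hz3]]]; try lra.
{ intros x Hx. eapply profile_cu; eauto; lra. }
(* At a zero the energy is [q^2 / 2]. Being nonincreasing, it is nonnegative before as well, so [w]
   descends through all levels with positive slope. *)
assert (HEz : 0 <= energy G w q z).
{ unfold energy. rewrite Hz2, (admissible_F0 _ _ _ _ HAg). assert (0 <= q z ^ 2) by apply pow2_ge_0. lra. }
assert (Hz : forall x, 0 < x -> (forall t, 0 <= t <= x -> 0 < w t) -> x < z).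
{ intros x Hx Hpos. apply Rnot_le_lt. intros Hle. specialize (Hpos z ltac:(lra)). lra. }
assert (HEw : forall x, 0 < x -> (forall t, 0 <= t <= x -> 0 < w t) -> 0 <= energy G w q x).
{ intros x Hx Hpos. specialize (Hz x Hx Hpos).
  assert (energy G w q z <= energy G w q x) by (eapply energy_le; eauto; lra). lra. }
assert (Hrw : reaches w q 0) by (apply (descent d g G w q b beta); auto; try lia; lra).
destruct (Hrw (al + 2 * e)) as [X [HX1 [HX2 HX3]]]; [lra|].
destruct (Hrw b) as [RB [HRB1 [HRB2 HRB3]]]; [lra|].
assert (HXRB : X < RB).
{ apply Rnot_le_lt. intros Hle. destruct (Req_dec X RB) as [E|E]; [subst; lra|].
  assert (w X < w RB) by decr. lra. }
destruct (steep_layer d g G w q b beta al h e lam m M M1 X RB) as [S1 [S3 [S4 [S5 [S6 S7]]]]]; auto; try lra.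
{ intros s Hs. rewrite Hgf by lra. apply HsM2; lra. }
fold N in S1, S6. fold k0 in S3, S5. fold kap in S5. fold C0 in S6.
assert (HXb : X <= xb).
{ apply Rnot_lt_le. intros Hlt. assert (xb ^ 2 < X ^ 2) by (apply (pow_S_lt xb X 1); lra).
  assert (0 < xb ^ 2) by (apply pow_lt; lra).
  assert (2 * N * h / m / xb ^ 2 * xb ^ 2 < lam * xb ^ 2) by (apply Rmult_lt_compat_r; lra).
  replace (2 * N * h / m / xb ^ 2 * xb ^ 2) with (2 * N * h / m) in H2 by (field; lra).
  assert (lam * xb ^ 2 < lam * X ^ 2) by (apply Rmult_lt_compat_l; lra). lra. }
assert (HXp : 0 < X ^ pred d) by (apply pow_lt; lra).
assert (HXp1 : X ^ pred d <= X).
{ destruct d as [|[|d']]; try lia. simpl. assert (X ^ d' <= 1).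
  { rewrite <- (pow1 d'). apply pow_incr; lra. } nra. }
(* At this radius the flux [r ^ d q], of order [k0 X ^ (d-1)], still makes [r / q]
   at most [eta], while [q] is already at most of order [r]. *)
destruct (exists_root d (eta * k0 * X ^ pred d)) as [r1 [Hr10 Hr1e]].
{ apply Rmult_lt_0_compat; lra. }
assert (H2X : 2 * X <= r1).
{ apply (pow_S_le_inv _ _ d); [lra|]. rewrite Hr1e, Rpow_mult_distr.
  replace (X ^ S d) with (X * X * X ^ pred d) by (destruct d; [lia|simpl; ring]).
  rewrite <- Rmult_assoc. apply Rmult_le_compat_r; [lra|].
  assert (0 < 2 ^ S d) by (apply pow_lt; lra).
  assert (X * X <= xb) by nra.
  apply Rle_trans with (2 ^ S d * xb); auto. apply Rmult_le_compat_l; lra. }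
assert (Hr1b : r1 <= rbar).
{ apply (pow_S_le_inv _ _ d); [lra|]. rewrite Hr1e. apply Rle_trans with (2 := Hxb2).
  apply Rmult_le_compat_l; lra. }
assert (Hsq : forall x, 0 <= x <= rbar -> M1 * x ^ 2 <= (al - beta) / 4).
{ intros x Hx. apply Rle_trans with (2 := Hr3). apply Rmult_le_compat_l; [lra|]. nra. }
assert (Hr1RB : r1 < RB).
{ apply Rnot_le_lt. intros Hle. assert (K := S7 RB ltac:(lra) (Hsq RB ltac:(lra))). lra. }
assert (W1 := S7 r1 ltac:(lra) (Hsq r1 ltac:(lra))).
assert (W2 := S5 r1 ltac:(lra)).
assert (Hr1d : 0 < r1 ^ d) by (apply pow_lt; lra).
assert (Q1 : r1 <= eta * q r1).
{ apply (Rmult_le_reg_l (r1 ^ d)); auto.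
  replace (r1 ^ d * r1) with (r1 ^ S d) by (simpl; ring). rewrite Hr1e.
  replace (r1 ^ d * (eta * q r1)) with (eta * (r1 ^ d * q r1)) by ring.
  replace (eta * k0 * X ^ pred d) with (eta * (X ^ pred d * k0)) by ring.
  apply Rmult_le_compat_l; [lra|]. apply S3; lra. }
assert (Q2 : q r1 <= C1 * r1).
{ apply (Rmult_le_reg_l (r1 ^ d)); auto. apply Rle_trans with (1 := S6 r1 ltac:(lra)).
  right. replace (r1 ^ d * (C1 * r1)) with (C1 * r1 ^ S d) by (simpl; ring).
  unfold C1. rewrite Rmult_plus_distr_r. f_equal; [|field; lra]. rewrite Hr1e. field. split; lra. }
assert (Hqr1 : 0 < q r1) by (apply HRB3; lra).
destruct (Hru (w r1)) as [r2 [Hr20 [Hr2e Hr2p]]]; [fold al; lra|].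
assert (Hr2rng : ra <= r2 <= rb) by (apply Hrng; lra).
assert (Hp2 : pi <= p r2 <= Pi) by (split; [apply Hmin|apply Hmax]; lra).
destruct (profile_compare d f F b beta g w q f u p 0 al r1 r2) as [delta [Hdelta K]]; auto; try lra; try lia.
- fold al; lra.
- intros; apply Hgf; lra.
- intros; apply HRB3; lra.
- nra.
- rewrite Hr2e. unfold erbe_tang.
  assert (HFr : 0 < F (w r1)) by (eapply prim_pos; eauto; lra).
  assert (A1 : r1 / q r1 <= eta).
  { apply (Rmult_le_reg_r (q r1)); auto. replace (r1 / q r1 * q r1) with r1 by (field; lra). auto. }
  assert (A2 : eta <= r2 / p r2).
  { apply (Rmult_le_reg_r (p r2)); [lra|]. replace (r2 / p r2 * p r2) with r2 by (field; lra).
    unfold eta. apply Rle_trans with (ra / Pi * Pi).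
    - apply Rmult_le_compat_l; [fold eta|]; lra.
    - replace (ra / Pi * Pi) with ra by (field; lra). lra. }
  assert (A3 : 2 * F (w r1) * (r1 / q r1) <= 2 * F (w r1) * (r2 / p r2)) by (apply Rmult_le_compat_l; lra).
  assert (A4 : r1 * q r1 < r2 * p r2).
  { apply Rlt_le_trans with (ra * pi).
    - apply Rle_lt_trans with (2 := Hr2). apply Rle_trans with (r1 * (C1 * r1)).
      + apply Rmult_le_compat_l; lra.
      + replace (r1 * (C1 * r1)) with (C1 * (r1 * r1)) by ring. apply Rmult_le_compat_l; [lra|]. nra.
    - apply Rmult_le_compat; lra. }
  lra.
- intros x Hx Hqx Hlx.
  assert (Hxz : forall t, 0 <= t <= x -> 0 < w t).
  { intros t Ht. destruct (Req_dec t x) as [->|]; [lra|]. assert (w x < w t) by decr. lra. }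
  assert (Hxz' := Hz x Hx Hxz).
  (* Strictness comes from the strict decrease of the energy up to the midpoint of [x] and [z],
     where the slope is still positive. *)
  assert (E1 : energy G w q ((x + z) / 2) < energy G w q x).
  { eapply energy_lt; eauto; try lia; try lra. intros t Ht.
    apply (slope_pos d g G w q b beta ((x + z) / 2)); auto; try lia; try lra.
    - intros; apply Hz3; lra.
    - apply HEw; [lra|]. intros; apply Hz3; lra. }
  assert (E2 : 0 <= energy G w q ((x + z) / 2)) by (apply HEw; [lra|intros; apply Hz3; lra]).
  unfold energy at 2 in E1. rewrite HGF in E1 by lra. lra.
- intros x Hx Hpx Hux. eapply erbe_tang_neg; eauto; try lia; try lra. intros s Hs; apply HPz; lra.
- destruct (weighted_slope_small d f F u p b beta delta) as [x [Hx1 [Hx2 [Hx3 Hx4]]]]; auto; try lra.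
  { fold al; lra. }
  { intros x Hx. left; auto. }
  { intros x Hx Hpos t Ht. apply Hp; lra. }
  destruct (Hrw (u x)) as [y [Hy1' [Hy2' Hy3']]]; [lra|].
  destruct (K y x) as [_ K2]; auto; try lra.
  assert (x * sqrt (p x ^ 2 + 2 * F (u x)) <= x * p x).
  { apply weighted_root_le; auto. left. apply (admissible_neg _ _ _ _ HA); auto. }
  assert (0 <= y * sqrt (q y ^ 2 + 2 * F (w y))) by (apply Rmult_le_pos; [lra|apply sqrt_pos]).
  lra.
Qed.

(** * Limits along an ultrafilter *)

(** A nonprincipal ultrafilter on the indices. Limits along it replace successive extractions of
    subsequences, and [ultra_or] selects one of the alternative outcomes of the shooting to be
    passed to the limit. *)
Record ultrafilter (U : (nat -> Prop) -> Prop) : Prop := {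
  ultra_eventually : forall n0 (P : nat -> Prop), (forall n, (n0 <= n)%nat -> P n) -> U P;
  ultra_and : forall P Q : nat -> Prop, U P -> U Q -> U (fun n => P n /\ Q n);
  ultra_mono : forall P Q : nat -> Prop, (forall n, P n -> Q n) -> U P -> U Q;
  ultra_ex : forall P : nat -> Prop, U P -> exists n, P n;
  ultra_or : forall P Q : nat -> Prop, (forall n, P n \/ Q n) -> U P \/ U Q }.

Lemma ultrafilter_exists : exists U, ultrafilter U.
Proof.
destruct (@filter.ultraFilterLemma nat (fun P : nat -> Prop => exists n0, forall n, (n0 <= n)%nat -> P n))
  as [U [HU Hsub]].
- split.
  + intros [n0 H]. exact (H n0 (le_n _)).
  + split.
    * exists 0%nat. intros n _. exact I.
    * intros P Q [n1 H1] [n2 H2]. exists (max n1 n2). intros n Hn.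
      split; [apply H1|apply H2]; lia.
    * intros P Q HPQ [n1 H1]. exists n1. intros n Hn. apply HPQ, H1, Hn.
- destruct (@filter.ultra_proper nat U HU) as [Hne [HT HI HS]].
  exists U. split.
  + intros n0 P HP. apply Hsub. exists n0; auto.
  + intros P Q HP HQ. exact (HI P Q HP HQ).
  + intros P Q HPQ HP. exact (HS P Q HPQ HP).
  + intros P HP. apply NNPP. intros Hn. apply Hne. refine (HS P _ _ HP).
    intros n Hp. apply Hn. exists n; auto.
  + intros P Q HPQ. destruct (filter.in_ultra_setVsetC P HU) as [H|H]; auto.
    right. refine (HS _ Q _ H). intros n Hp. destruct (HPQ n); auto. contradiction.
Qed.

(** The limit is the supremum of the numbers that lie below the sequence on a set of [U]; [ultra_or]
    rules out oscillation. *)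
Lemma ultra_limit U (x : nat -> R) B :
  ultrafilter U -> (forall n, Rabs (x n) <= B) ->
  exists l, forall e, 0 < e -> U (fun n => Rabs (x n - l) < e).
Proof.
intros HU HB.
assert (HBn : forall n, - B <= x n <= B) by (intros n; apply Rabs_le_between, HB).
destruct (completeness (fun a => U (fun n => a <= x n))) as [l [Hl1 Hl2]].
- exists B. intros a Ha. destruct (ultra_ex _ HU _ Ha) as [n Hn]. specialize (HBn n). lra.
- exists (- B). apply (ultra_eventually _ HU 0). intros n _. apply HBn.
- exists l. intros e He.
  assert (H1 : U (fun n => l - e < x n)).
  { destruct (ultra_or _ HU (fun n => l - e < x n) (fun n => x n <= l - e)) as [H|H]; auto.
    - intros n. destruct (Rlt_le_dec (l - e) (x n)); auto.
    - exfalso. assert (l <= l - e); [|lra]. apply Hl2. intros a Ha.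
      destruct (ultra_ex _ HU _ (ultra_and _ HU _ _ Ha H)) as [n Hn]. lra. }
  assert (H2 : U (fun n => x n < l + e)).
  { destruct (ultra_or _ HU (fun n => x n < l + e) (fun n => l + e <= x n)) as [H|H]; auto.
    - intros n. destruct (Rlt_le_dec (x n) (l + e)); auto.
    - exfalso. assert (l + e <= l) by (apply Hl1; auto). lra. }
  refine (ultra_mono _ HU _ _ _ (ultra_and _ HU _ _ H1 H2)).
  intros n Hn; cbv beta in Hn. apply Rabs_def1; lra.
Qed.

Lemma ultra_forall_le U (P : nat -> nat -> Prop) k :
  ultrafilter U -> (forall i, U (P i)) -> U (fun n => forall i, (i <= k)%nat -> P i n).
Proof.
intros HU HP. induction k as [|k IH].
- apply (ultra_mono _ HU (P 0%nat)); auto. intros n Hn i Hi. replace i with 0%nat by lia. auto.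
- refine (ultra_mono _ HU _ _ _ (ultra_and _ HU _ _ IH (HP (S k)))).
  intros n Hn i Hi; cbv beta in Hn. destruct (Nat.eq_dec i (S k)) as [->|]; [tauto|]. apply Hn. lia.
Qed.

(** * The radial integral operator *)

(** The value of [- u'] when [g] is the source term. The quotient is of order [r], so the extension
    by 0 is continuous; it also makes [radial_op] vanish for [r <= 0], and delayed arguments may be
    negative. *)
Definition radial_slope (d : nat) (g : R -> R) (r : R) : R :=
  if Rle_dec r 0 then 0 else RInt (fun t => t ^ d * g t) 0 r / r ^ d.

Definition radial_op (d : nat) (g : R -> R) (r : R) : R := RInt (radial_slope d g) 0 r.

(* [ring] does not see through the carriers of Coquelicot's hierarchy. *)
Ltac eqR := match goal with |- ?y = ?y' => change (@eq R y y') end.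

Lemma pow_mult_continuous d (g : R -> R) : (forall x, continuous g x) ->
  forall x, continuous (fun t => t ^ d * g t) x.
Proof.
intros Hg x. apply (continuous_mult (fun t => t ^ d) g); auto.
apply (derive_continuous _ x (INR d * x ^ pred d)). auto_derive; auto; ring.
Qed.

Lemma ex_RInt_cont (g : R -> R) a b : (forall x, continuous g x) -> ex_RInt g a b.
Proof. intros Hg. apply (ex_RInt_continuous g). intros; apply Hg. Qed.

Lemma derive_RInt_cont (g : R -> R) a r : (forall x, continuous g x) -> is_derive (RInt g a) r (g r).
Proof.
intros Hg. apply (is_derive_RInt g (RInt g a) a r); auto.
exists (mkposreal 1 Rlt_0_1). intros y _. apply (RInt_correct g). now apply ex_RInt_cont.
Qed.

Lemma radial_slope_diff d (g1 g2 : R -> R) r e :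
  (forall x, continuous g1 x) -> (forall x, continuous g2 x) -> 0 <= e ->
  (forall t, 0 <= t <= r -> Rabs (g1 t - g2 t) <= e) ->
  Rabs (radial_slope d g1 r - radial_slope d g2 r) <= e * Rmax 0 r.
Proof.
intros H1 H2 He Hd. unfold radial_slope. destruct (Rle_dec r 0) as [Hr|Hr].
- rewrite Rminus_0_r, Rabs_R0. apply Rmult_le_pos; auto. minmax.
- assert (Hrd : 0 < r ^ d) by (apply pow_lt; lra).
  replace (RInt (fun t => t ^ d * g1 t) 0 r / r ^ d - RInt (fun t => t ^ d * g2 t) 0 r / r ^ d)
   with ((RInt (fun t => t ^ d * g1 t) 0 r - RInt (fun t => t ^ d * g2 t) 0 r) / r ^ d) by (field; lra).
  rewrite Rabs_div by lra. rewrite (Rabs_right (r ^ d)) by lra.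
  apply (Rmult_le_reg_r (r ^ d)); auto. unfold Rdiv. rewrite Rmult_assoc, Rinv_l, Rmult_1_r by lra.
  rewrite (Rmax_right 0 r) by lra.
  assert (E : RInt (fun t => t ^ d * g1 t) 0 r - RInt (fun t => t ^ d * g2 t) 0 r =
     RInt (fun t => t ^ d * g1 t - t ^ d * g2 t) 0 r).
  { symmetry. apply (RInt_minus (fun t => t ^ d * g1 t) (fun t => t ^ d * g2 t));
    apply ex_RInt_cont; apply pow_mult_continuous; auto. }
  rewrite E. replace (e * r * r ^ d) with ((r - 0) * (r ^ d * e)) by ring.
  apply (abs_RInt_le_const (fun t => t ^ d * g1 t - t ^ d * g2 t)); [lra| |].
  + apply ex_RInt_cont. intros x.
    apply (continuous_minus (fun t => t ^ d * g1 t) (fun t => t ^ d * g2 t)); apply pow_mult_continuous; auto.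
  + intros t Ht. replace (t ^ d * g1 t - t ^ d * g2 t) with (t ^ d * (g1 t - g2 t)) by ring.
    rewrite Rabs_mult. rewrite (Rabs_right (t ^ d)) by (apply Rle_ge, pow_le; lra).
    apply Rmult_le_compat; [apply pow_le; lra|apply Rabs_pos|apply pow_incr; lra|auto].
Qed.

Lemma radial_slope_zero d r : radial_slope d (fun _ => 0) r = 0.
Proof.
unfold radial_slope. destruct (Rle_dec r 0); auto.
rewrite (RInt_ext _ (fun _ => 0)) by (intros; eqR; ring). rewrite RInt_const.
unfold scal; simpl; unfold mult; simpl. unfold Rdiv. ring.
Qed.

Lemma radial_slope_bound d (g : R -> R) r B :
  (forall x, continuous g x) -> 0 <= B -> (forall t, 0 <= t <= r -> Rabs (g t) <= B) ->
  Rabs (radial_slope d g r) <= B * Rmax 0 r.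
Proof.
intros H HB Hg.
assert (K := radial_slope_diff d g (fun _ => 0) r B H (fun x => continuous_const 0 x) HB).
rewrite radial_slope_zero, Rminus_0_r in K. apply K.
intros t Ht. rewrite Rminus_0_r. auto.
Qed.

Lemma derive_radial_slope d (g : R -> R) r :
  (forall x, continuous g x) -> (1 <= d)%nat -> 0 < r ->
  is_derive (radial_slope d g) r (g r - INR d / r * radial_slope d g r).
Proof.
intros Hg Hd Hr.
assert (D := derive_RInt_cont _ 0 r (pow_mult_continuous d g Hg)).
apply (is_derive_ext_loc (fun r => RInt (fun t => t ^ d * g t) 0 r / r ^ d)).
- exists (mkposreal r Hr). intros y Hy. apply Rabs_def2 in Hy.
  unfold minus, plus, opp in Hy. simpl in Hy.
  unfold radial_slope. destruct (Rle_dec y 0); [lra|reflexivity].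
- unfold radial_slope. destruct (Rle_dec r 0); [lra|].
  set (J := fun r : R => RInt (fun t => t ^ d * g t) 0 r) in *.
  change (is_derive (fun r => J r / r ^ d) r (g r - INR d / r * (J r / r ^ d))).
  change (is_derive J r (r ^ d * g r)) in D. clearbody J.
  assert (0 < r ^ d) by (apply pow_lt; lra).
  auto_derive.
  + repeat split; [eexists; eassumption|lra].
  + rewrite (Derive_eq _ _ _ D). destruct d as [|d]; [lia|]. simpl Nat.pred.
    rewrite <- !tech_pow_Rmult in *. field. split; [|lra]. intros E. rewrite E in *. lra.
Qed.

Lemma radial_slope_continuous d (g : R -> R) :
  (forall x, continuous g x) -> (1 <= d)%nat -> forall r, continuous (radial_slope d g) r.
Proof.
intros Hg Hd r. destruct (Rtotal_order r 0) as [Hr|[->|Hr]].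
- apply (continuous_ext_loc _ (fun _ => 0)); [|apply continuous_const].
  assert (Hr' : 0 < - r) by lra. exists (mkposreal _ Hr'). intros y Hy. apply Rabs_def2 in Hy.
  unfold minus, plus, opp in Hy. simpl in Hy.
  unfold radial_slope. destruct (Rle_dec y 0); [reflexivity|lra].
- apply eps_continuous. intros e He.
  destruct (continuous_eps g 0 1 (Hg 0) ltac:(lra)) as [d1 [Hd1 K]].
  set (B := Rabs (g 0) + 1). assert (HB : 0 < B) by (unfold B; assert (H := Rabs_pos (g 0)); lra).
  assert (HeB : 0 < e / (2 * B)) by (apply Rdiv_lt_0_compat; lra).
  exists (Rmin d1 (e / (2 * B))). split; [minmax|]. intros y Hy. rewrite Rminus_0_r in Hy.
  assert (Hy1 : Rabs y < d1) by (revert Hy; minmax).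
  assert (Hy2 : Rabs y < e / (2 * B)) by (revert Hy; minmax).
  assert (E0 : radial_slope d g 0 = 0) by (unfold radial_slope; destruct (Rle_dec 0 0); lra).
  rewrite E0, Rminus_0_r. apply Rle_lt_trans with (B * Rmax 0 y).
  + apply radial_slope_bound; auto; [lra|]. intros t Ht. apply Rabs_def2 in Hy1.
    specialize (K t ltac:(rewrite Rminus_0_r, Rabs_right; lra)).
    assert (H := Rabs_triang (g t - g 0) (g 0)). replace (g t - g 0 + g 0) with (g t) in H by ring.
    unfold B. lra.
  + assert (Rmax 0 y <= Rabs y).
    { assert (H := Rabs_pos y). assert (H' := Rle_abs y). minmax. }
    apply Rle_lt_trans with (B * (e / (2 * B))); [apply Rmult_le_compat_l; lra|].
    replace (B * (e / (2 * B))) with (e / 2) by (field; lra). lra.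
- eapply derive_continuous, derive_radial_slope; auto.
Qed.

Lemma derive_radial_op d (g : R -> R) r :
  (forall x, continuous g x) -> (1 <= d)%nat -> is_derive (radial_op d g) r (radial_slope d g r).
Proof. intros Hg Hd. apply derive_RInt_cont. now apply radial_slope_continuous. Qed.

Lemma radial_op_neg d (g : R -> R) r : r <= 0 -> radial_op d g r = 0.
Proof.
intros Hr. unfold radial_op. rewrite (RInt_ext _ (fun _ => 0)).
- rewrite RInt_const. unfold scal; simpl; unfold mult; simpl. ring.
- intros x Hx. rewrite Rmin_right, Rmax_left in Hx by lra. unfold radial_slope.
  destruct (Rle_dec x 0); [reflexivity|lra].
Qed.

Lemma radial_op_diff d (g1 g2 : R -> R) r T e :
  (forall x, continuous g1 x) -> (forall x, continuous g2 x) -> (1 <= d)%nat -> 0 <= e -> 0 <= T -> r <= T ->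
  (forall t, 0 <= t <= r -> Rabs (g1 t - g2 t) <= e) ->
  Rabs (radial_op d g1 r - radial_op d g2 r) <= e * T ^ 2.
Proof.
intros H1 H2 Hd He HT HrT Hg. destruct (Rle_lt_dec r 0) as [Hr|Hr].
- rewrite !radial_op_neg by auto. rewrite Rminus_0_r, Rabs_R0. apply Rmult_le_pos; auto. apply pow2_ge_0.
- apply Rle_trans with ((r - 0) * (e * T)).
  + unfold radial_op.
    assert (E : RInt (radial_slope d g1) 0 r - RInt (radial_slope d g2) 0 r =
       RInt (fun t => radial_slope d g1 t - radial_slope d g2 t) 0 r).
    { symmetry. apply (RInt_minus (radial_slope d g1) (radial_slope d g2));
      apply ex_RInt_cont; apply radial_slope_continuous; auto. }
    rewrite E. apply (abs_RInt_le_const (fun t => radial_slope d g1 t - radial_slope d g2 t)); [lra| |].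
    * apply ex_RInt_cont. intros x.
      apply (continuous_minus (radial_slope d g1) (radial_slope d g2)); apply radial_slope_continuous; auto.
    * intros t Ht. apply Rle_trans with (e * Rmax 0 t).
      -- apply radial_slope_diff; auto. intros s Hs. apply Hg; lra.
      -- apply Rmult_le_compat_l; auto. minmax.
  + assert (0 <= e * T) by (apply Rmult_le_pos; auto).
    replace (e * T ^ 2) with (T * (e * T)) by ring. apply Rmult_le_compat_r; lra.
Qed.

Lemma radial_op_lip d (g : R -> R) B T x y :
  (forall z, continuous g z) -> (1 <= d)%nat -> 0 <= B -> (forall t, Rabs (g t) <= B) -> 0 <= T ->
  x <= T -> y <= T -> Rabs (radial_op d g x - radial_op d g y) <= B * T * Rabs (x - y).
Proof.
intros Hg Hd HB HgB HT Hx Hy.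
destruct (MVT_gen (radial_op d g) y x (radial_slope d g)) as [z [Hz1 Hz2]].
- intros z _. now apply derive_radial_op.
- intros z _. apply continuous_pt. eapply derive_continuous, derive_radial_op; auto.
- rewrite Hz2, Rabs_mult. apply Rmult_le_compat_r; [apply Rabs_pos|].
  apply Rle_trans with (B * Rmax 0 z); [apply radial_slope_bound; auto|].
  apply Rmult_le_compat_l; auto. revert Hz1. minmax.
Qed.

Definition radial_fix (d : nat) (f : R -> R) (alpha : R) (u : R -> R) : Prop :=
  (forall r, continuous u r) /\ forall r, u r = alpha - radial_op d (fun t => f (u t)) r.

Lemma radial_fix_center d (f : R -> R) alpha (u : R -> R) : radial_fix d f alpha u -> u 0 = alpha.
Proof. intros [_ H]. rewrite H, radial_op_neg; lra. Qed.

Lemma radial_fix_profile d (f : R -> R) alpha (u : R -> R) :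
  (1 <= d)%nat -> (forall s, continuous f s) -> radial_fix d f alpha u ->
  profile d f u (radial_slope d (fun t => f (u t))).
Proof.
intros Hd Hf [Hc Hu].
assert (Hg : forall x, continuous (fun t => f (u t)) x).
{ intros x. apply (continuous_comp u f); auto. }
split; auto.
- intros r Hr. apply (is_derive_ext (fun r => alpha - radial_op d (fun t => f (u t)) r)); [auto|].
  assert (D := derive_radial_op d _ r Hg Hd).
  replace (- radial_slope d (fun t => f (u t)) r) with (minus 0 (radial_slope d (fun t => f (u t)) r))
    by (unfold minus, plus, opp; simpl; ring).
  apply (is_derive_minus (fun _ => alpha) (radial_op d (fun t => f (u t)))); auto.
  apply (is_derive_const alpha).
- intros r Hr. now apply (derive_radial_slope d (fun t => f (u t))).
- apply radial_slope_continuous; auto.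
- unfold radial_slope. destruct (Rle_dec 0 0); lra.
Qed.

(** * Compactness of approximate solutions *)

Definition unif_cont (f : R -> R) : Prop :=
  forall e, 0 < e -> exists dl, 0 < dl /\ forall x y, Rabs (x - y) < dl -> Rabs (f x - f y) <= e.

(** Arzela-Ascoli along [U]: the bound on [f] makes the integral terms Lipschitz uniformly in [n],
    so their pointwise limit is locally uniform, and uniform continuity of [f] carries it into the
    integral equation. *)
Lemma approx_limit U d (f : R -> R) B a c (al : nat -> R) (u : nat -> R -> R) :
  ultrafilter U -> (1 <= d)%nat -> (forall s, continuous f s) -> unif_cont f ->
  (forall s, Rabs (f s) <= B) ->
  (forall n, a <= al n <= c) -> (forall n r, continuous (u n) r) ->
  (forall T e, 0 < T -> 0 < e -> U (fun n => forall r, 0 <= r <= T ->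
     Rabs (u n r - (al n - radial_op d (fun t => f (u n t)) r)) <= e)) ->
  exists alpha v, a <= alpha <= c /\ radial_fix d f alpha v /\
    (forall e, 0 < e -> U (fun n => Rabs (al n - alpha) < e)) /\
    (forall T e, 0 < T -> 0 < e -> U (fun n => forall r, 0 <= r <= T -> Rabs (u n r - v r) < e)) /\
    (forall T e, 0 < T -> 0 < e -> U (fun n => forall r, 0 <= r <= T ->
       Rabs (radial_slope d (fun t => f (u n t)) r - radial_slope d (fun t => f (v t)) r) < e)).
Proof.
intros HU Hd Hf Huf HB Hal Hu Happ.
assert (HB0 : 0 <= B) by (apply Rle_trans with (2 := HB 0), Rabs_pos).
assert (Hg : forall n x, continuous (fun t => f (u n t)) x).
{ intros n x. apply (continuous_comp (u n) f); auto. }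
(* The [u n] need not be equicontinuous; [w n] is, and it is eventually uniformly close to [u n] on
   bounded intervals. *)
set (w := fun n r => al n - radial_op d (fun t => f (u n t)) r).
assert (Hlip : forall n T x y, 0 <= T -> x <= T -> y <= T -> Rabs (w n x - w n y) <= B * T * Rabs (x - y)).
{ intros n T x y HT Hx Hy. unfold w.
  replace (al n - radial_op d (fun t => f (u n t)) x - (al n - radial_op d (fun t => f (u n t)) y))
    with (- (radial_op d (fun t => f (u n t)) x - radial_op d (fun t => f (u n t)) y)) by ring.
  rewrite Rabs_Ropp. apply radial_op_lip; auto. }
assert (Hw0 : forall n r, r <= 0 -> w n r = al n).
{ intros n r Hr. unfold w. rewrite radial_op_neg by auto. ring. }
assert (Halb : forall n, Rabs (al n) <= Rabs a + Rabs c).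
{ intros n. specialize (Hal n). unfold Rabs. repeat destruct Rcase_abs; lra. }
destruct (ultra_limit U al (Rabs a + Rabs c) HU Halb) as [alpha Halpha].
destruct (choice (fun r l => forall e, 0 < e -> U (fun n => Rabs (w n r - l) < e))) as [v Hv].
{ intros r. apply (ultra_limit U _ (Rabs a + Rabs c + B * Rmax 0 r * Rabs (r - 0)) HU).
  intros n. replace (w n r) with (al n + (w n r - w n 0)) by (rewrite (Hw0 n 0) by lra; ring).
  apply Rle_trans with (1 := Rabs_triang _ _). apply Rplus_le_compat; auto.
  apply Hlip; minmax. }
assert (Huniq : forall x y, (forall e, 0 < e -> Rabs (x - y) <= e) -> x = y).
{ intros x y H. apply Rminus_diag_uniq. apply NNPP. intros Hn.
  assert (K := H (Rabs (x - y) / 2)). assert (0 < Rabs (x - y)) by now apply Rabs_pos_lt. specialize (K ltac:(lra)). lra. }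
assert (Hvlip : forall T x y, 0 <= T -> x <= T -> y <= T -> Rabs (v x - v y) <= B * T * Rabs (x - y)).
{ intros T x y HT Hx Hy. apply le_epsilon. intros e He.
  destruct (ultra_ex _ HU _ (ultra_and _ HU _ _ (Hv x (e / 2) ltac:(lra)) (Hv y (e / 2) ltac:(lra)))) as [n [H1 H2]].
  assert (H3 := Hlip n T x y HT Hx Hy).
  apply Rabs_le_between in H3. apply Rabs_def2 in H1. apply Rabs_def2 in H2.
  apply Rabs_le_between. lra. }
assert (Hvc : forall r, continuous v r).
{ intros r. apply eps_continuous. intros e He.
  set (T := Rabs r + 1). assert (HT : 0 < T) by (unfold T; assert (H := Rabs_pos r); lra).
  assert (HL : 0 < B * T + 1) by (assert (0 <= B * T) by (apply Rmult_le_pos; lra); lra).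
  assert (He' : 0 < e / (B * T + 1)) by (apply Rdiv_lt_0_compat; lra).
  exists (Rmin 1 (e / (B * T + 1))). split; [minmax|]. intros y Hy.
  assert (Hy1 : Rabs (y - r) < 1) by (revert Hy; minmax).
  assert (Hy2 : Rabs (y - r) < e / (B * T + 1)) by (revert Hy; minmax).
  assert (HyT : y <= T). { apply Rabs_def2 in Hy1. unfold T. assert (H := Rle_abs r). lra. }
  apply Rle_lt_trans with (1 := Hvlip T y r ltac:(lra) HyT ltac:(unfold T; assert (H := Rle_abs r); lra)).
  apply Rle_lt_trans with ((B * T + 1) * Rabs (y - r)).
  - apply Rmult_le_compat_r; [apply Rabs_pos|lra].
  - replace e with ((B * T + 1) * (e / (B * T + 1))) by (field; lra). apply Rmult_lt_compat_l; auto. }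
assert (Hfv : forall x, continuous (fun t => f (v t)) x).
{ intros x. apply (continuous_comp v f); auto. }
(* A finite grid of mesh [s] with [L s = e / 4] suffices: [e / 4] at the grid point, and at most
   [e / 4] from each Lipschitz bound. *)
assert (Hunif : forall T e, 0 < T -> 0 < e -> U (fun n => forall r, 0 <= r <= T -> Rabs (w n r - v r) < e)).
{ intros T e HT He. set (L := B * T + 1).
  assert (HL : 0 < L) by (unfold L; assert (0 <= B * T) by (apply Rmult_le_pos; lra); lra).
  set (s := e / (4 * L)). assert (Hs : 0 < s) by (apply Rdiv_lt_0_compat; lra).
  destruct (nfloor_ex (T / s)) as [k Hk]. { left; apply Rdiv_lt_0_compat; lra. }
  apply (ultra_mono _ HU (fun n => forall i, (i <= k)%nat -> Rabs (w n (INR i * s) - v (INR i * s)) < e / 4)).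
  - intros n Hn r Hr. destruct (nfloor_ex (r / s)) as [i Hi].
    { apply Rmult_le_pos; [lra|left; now apply Rinv_0_lt_compat]. }
    assert (Hir : INR i * s <= r < INR i * s + s).
    { replace r with (r / s * s) by (field; lra). split; [apply Rmult_le_compat_r; lra|].
      replace (INR i * s + s) with ((INR i + 1) * s) by ring. apply Rmult_lt_compat_r; lra. }
    assert (Hik : (i <= k)%nat).
    { apply INR_le. assert (INR i < INR k + 1).
      { apply Rle_lt_trans with (r / s); [lra|]. apply Rle_lt_trans with (T / s); [|lra].
        apply Rmult_le_compat_r; [left; now apply Rinv_0_lt_compat|lra]. }
      rewrite <- S_INR in H. apply INR_lt in H. apply le_INR. lia. }
    specialize (Hn i Hik). assert (Hi0 := pos_INR i).
    assert (0 <= INR i * s) by (apply Rmult_le_pos; lra).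
    assert (H1 := Hlip n T r (INR i * s) ltac:(lra) ltac:(lra) ltac:(lra)).
    assert (H2 := Hvlip T r (INR i * s) ltac:(lra) ltac:(lra) ltac:(lra)).
    assert (H3 : B * T * Rabs (r - INR i * s) <= e / 4).
    { rewrite (Rabs_right (r - INR i * s)) by lra. apply Rle_trans with (L * s).
      - assert (0 <= B * T) by (apply Rmult_le_pos; lra). apply Rmult_le_compat; unfold L; lra.
      - right. unfold s. field. lra. }
    apply Rabs_le_between in H1. apply Rabs_le_between in H2. apply Rabs_def2 in Hn.
    apply Rabs_def1; lra.
  - apply ultra_forall_le; auto. intros i. apply Hv. lra. }
assert (Huu : forall T e, 0 < T -> 0 < e -> U (fun n => forall r, 0 <= r <= T -> Rabs (u n r - v r) < e)).
{ intros T e HT He.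
  refine (ultra_mono _ HU _ _ _ (ultra_and _ HU _ _ (Happ T (e / 2) HT ltac:(lra)) (Hunif T (e / 2) HT ltac:(lra)))).
  intros n Hn r Hr; cbv beta in Hn. destruct Hn as [H1 H2]. specialize (H1 r Hr). specialize (H2 r Hr).
  fold (w n r) in H1. apply Rabs_le_between in H1. apply Rabs_def2 in H2. apply Rabs_def1; lra. }
assert (Hff : forall T e, 0 < T -> 0 < e -> U (fun n => forall r, 0 <= r <= T -> Rabs (f (u n r) - f (v r)) <= e)).
{ intros T e HT He. destruct (Huf e He) as [dl [Hdl K]].
  apply (ultra_mono _ HU _ _ (fun n Hn r Hr => K _ _ (Hn r Hr)) (Huu T dl HT Hdl)). }
exists alpha, v. split; [|split; [|split; [|split]]]; auto.
- split; apply le_epsilon; intros e He; destruct (ultra_ex _ HU _ (Halpha e He)) as [n Hn];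
  apply Rabs_def2 in Hn; specialize (Hal n); lra.
- split; auto. intros r. apply Huniq. intros e He.
  destruct (Rle_lt_dec r 0) as [Hr|Hr].
  + rewrite radial_op_neg by auto.
    destruct (ultra_ex _ HU _ (ultra_and _ HU _ _ (Hv r (e / 2) ltac:(lra)) (Halpha (e / 2) ltac:(lra)))) as [n [H1 H2]].
    rewrite Hw0 in H1 by auto. apply Rabs_def2 in H1. apply Rabs_def2 in H2. apply Rabs_le_between. lra.
  + assert (Hr2 : 0 < r ^ 2) by (apply pow_lt; lra).
    assert (He3 : 0 < e / (3 * r ^ 2)) by (apply Rdiv_lt_0_compat; lra).
    destruct (ultra_ex _ HU _ (ultra_and _ HU _ _ (ultra_and _ HU _ _ (Hv r (e / 3) ltac:(lra)) (Halpha (e / 3) ltac:(lra)))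
      (Hff r (e / (3 * r ^ 2)) Hr He3))) as [n [[H1 H2] H3]].
    assert (H4 := radial_op_diff d (fun t => f (u n t)) (fun t => f (v t)) r r (e / (3 * r ^ 2))
       (Hg n) Hfv Hd ltac:(lra) ltac:(lra) ltac:(lra) H3).
    replace (e / (3 * r ^ 2) * r ^ 2) with (e / 3) in H4 by (field; lra).
    unfold w in H1. apply Rabs_def2 in H1. apply Rabs_def2 in H2. apply Rabs_le_between in H4.
    apply Rabs_le_between. lra.
- intros T e HT He. assert (He2 : 0 < e / (2 * T)) by (apply Rdiv_lt_0_compat; lra).
  refine (ultra_mono _ HU _ _ _ (Hff T (e / (2 * T)) HT He2)).
  intros n Hn r Hr; cbv beta in Hn. apply Rle_lt_trans with (e / (2 * T) * Rmax 0 r).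
  + apply radial_slope_diff; auto; [lra|]. intros t Ht. apply Hn; lra.
  + rewrite Rmax_right by lra. apply Rle_lt_trans with (e / (2 * T) * T).
    * apply Rmult_le_compat_l; lra.
    * replace (e / (2 * T) * T) with (e / 2) by (field; lra). lra.
Qed.

(** * Shooting with Tonelli approximations *)

(* The delay [dl] makes the equation explicit: the [k]-th iterate solves it on [r <= k dl]. *)
Fixpoint tonelli (d : nat) (f : R -> R) (dl alpha : R) (k : nat) (r : R) : R :=
  match k with
  | O => alpha
  | S k => alpha - radial_op d (fun t => f (tonelli d f dl alpha k t)) (r - dl)
  end.

Lemma tonelli_continuous d (f : R -> R) dl alpha k :
  (1 <= d)%nat -> (forall s, continuous f s) -> forall r, continuous (tonelli d f dl alpha k) r.
Proof.
intros Hd Hf. induction k as [|k IH]; intros r.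
- apply continuous_const.
- simpl. apply (continuous_minus (fun _ => alpha)
    (fun r => radial_op d (fun t => f (tonelli d f dl alpha k t)) (r - dl))); [apply continuous_const|].
  apply (continuous_comp (fun r => r - dl) (radial_op d (fun t => f (tonelli d f dl alpha k t)))).
  + apply (derive_continuous _ r 1). auto_derive; auto; ring.
  + eapply derive_continuous, derive_radial_op; auto.
    intros x. apply (continuous_comp (tonelli d f dl alpha k) f); auto.
Qed.

Lemma tonelli_fcontinuous d (f : R -> R) dl alpha k :
  (1 <= d)%nat -> (forall s, continuous f s) ->
  forall r, continuous (fun t => f (tonelli d f dl alpha k t)) r.
Proof.
intros Hd Hf r. apply (continuous_comp (tonelli d f dl alpha k) f); auto.
now apply tonelli_continuous.
Qed.

(** An iterate at [r] reads the previous one only up to [r - dl], so agreement spreads by [dl] at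
    each iteration, starting from [r <= 0], where every iterate equals [alpha]. *)
Lemma tonelli_stable d (f : R -> R) dl alpha k r :
  (1 <= d)%nat -> (forall s, continuous f s) -> 0 < dl -> r <= INR k * dl ->
  tonelli d f dl alpha (S k) r = tonelli d f dl alpha k r.
Proof.
intros Hd Hf Hdl. revert r. induction k as [|k IH]; intros r Hr.
- simpl in *. rewrite radial_op_neg by lra. ring.
- rewrite S_INR in Hr.
  change (alpha - radial_op d (fun t => f (tonelli d f dl alpha (S k) t)) (r - dl) =
    alpha - radial_op d (fun t => f (tonelli d f dl alpha k t)) (r - dl)).
  f_equal. apply Rminus_diag_uniq.
  (* Tolerance 0: the estimate becomes an equality. *)
  assert (K := radial_op_diff d (fun t => f (tonelli d f dl alpha (S k) t))
    (fun t => f (tonelli d f dl alpha k t)) (r - dl) (Rmax 0 (r - dl)) 0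
    (tonelli_fcontinuous d f dl alpha (S k) Hd Hf) (tonelli_fcontinuous d f dl alpha k Hd Hf)
    Hd ltac:(lra) ltac:(minmax) ltac:(minmax)).
  rewrite Rmult_0_l in K. apply NNPP. intros Hn. apply Rabs_pos_lt in Hn.
  assert (Rabs (radial_op d (fun t => f (tonelli d f dl alpha (S k) t)) (r - dl) -
      radial_op d (fun t => f (tonelli d f dl alpha k t)) (r - dl)) <= 0); [|lra].
  apply K. intros t Ht. rewrite IH by lra. unfold Rminus. rewrite Rplus_opp_r, Rabs_R0. lra.
Qed.

Lemma tonelli_approx d (f : R -> R) B dl alpha k T r :
  (1 <= d)%nat -> (forall s, continuous f s) -> (forall s, Rabs (f s) <= B) ->
  0 < dl -> 0 <= T <= INR k * dl -> r <= T ->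
  Rabs (tonelli d f dl alpha k r -
    (alpha - radial_op d (fun t => f (tonelli d f dl alpha k t)) r)) <= B * T * dl.
Proof.
intros Hd Hf HB Hdl HT Hr. rewrite <- (tonelli_stable d f dl alpha k r) by (auto; lra).
simpl. replace (alpha - radial_op d (fun t => f (tonelli d f dl alpha k t)) (r - dl) -
  (alpha - radial_op d (fun t => f (tonelli d f dl alpha k t)) r)) with
  (radial_op d (fun t => f (tonelli d f dl alpha k t)) r -
   radial_op d (fun t => f (tonelli d f dl alpha k t)) (r - dl)) by ring.
assert (0 <= B) by (apply Rle_trans with (2 := HB 0), Rabs_pos).
apply Rle_trans with (B * T * Rabs (r - (r - dl))).
- apply radial_op_lip; auto; try lra. now apply tonelli_fcontinuous.
- replace (r - (r - dl)) with dl by ring. rewrite (Rabs_right dl); lra.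
Qed.

Lemma tonelli_dep d (f : R -> R) dl k T e :
  (1 <= d)%nat -> (forall s, continuous f s) -> unif_cont f -> 0 < dl -> 0 < T -> 0 < e ->
  exists rho, 0 < rho /\ forall a1 a2, Rabs (a1 - a2) < rho -> forall r, r <= T ->
    Rabs (tonelli d f dl a1 k r - tonelli d f dl a2 k r) <= e.
Proof.
intros Hd Hf Huf Hdl HT. revert e. induction k as [|k IH]; intros e He.
- exists e. split; auto. intros a1 a2 Ha r Hr. simpl. lra.
- assert (HT2 : 0 < T ^ 2) by (apply pow_lt; auto).
  assert (He2 : 0 < e / (2 * T ^ 2)) by (apply Rdiv_lt_0_compat; lra).
  destruct (Huf _ He2) as [d1 [Hd1 K1]]. destruct (IH (d1 / 2) ltac:(lra)) as [rho [Hrho K2]].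
  exists (Rmin rho (e / 2)). split; [minmax|]. intros a1 a2 Ha r Hr. simpl.
  assert (Ha1 : Rabs (a1 - a2) < rho) by (revert Ha; minmax).
  assert (Ha2 : Rabs (a1 - a2) < e / 2) by (revert Ha; minmax).
  assert (K := radial_op_diff d (fun t => f (tonelli d f dl a1 k t))
    (fun t => f (tonelli d f dl a2 k t)) (r - dl) T (e / (2 * T ^ 2))
    (tonelli_fcontinuous d f dl a1 k Hd Hf) (tonelli_fcontinuous d f dl a2 k Hd Hf)
    Hd ltac:(lra) ltac:(lra) ltac:(lra)).
  assert (K3 : Rabs (radial_op d (fun t => f (tonelli d f dl a1 k t)) (r - dl) -
      radial_op d (fun t => f (tonelli d f dl a2 k t)) (r - dl)) <= e / (2 * T ^ 2) * T ^ 2).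
  { apply K. intros t Ht. apply K1. apply Rle_lt_trans with (d1 / 2); [|lra]. apply K2; auto. lra. }
  replace (e / (2 * T ^ 2) * T ^ 2) with (e / 2) in K3 by (field; lra).
  apply Rabs_le_between in K3. apply Rabs_def2 in Ha2. apply Rabs_le_between. lra.
Qed.

(** The last outcome cannot be discarded here: positivity of solutions started at [c] is known for
    exact solutions only, so it is refuted after the passage to the limit. *)
Lemma tonelli_shoot d (f : R -> R) dl k T a c :
  (1 <= d)%nat -> (forall s, continuous f s) -> unif_cont f -> 0 < dl -> 0 < T -> a <= c ->
  exists alpha, a <= alpha <= c /\
   ((alpha = a /\ forall r, 0 <= r <= T -> 0 <= tonelli d f dl alpha k r) \/
    ((forall r, 0 <= r <= T -> 0 <= tonelli d f dl alpha k r) /\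
       exists r, 0 <= r <= T /\ tonelli d f dl alpha k r = 0) \/
    (alpha = c /\ exists r, 0 <= r <= T /\ tonelli d f dl alpha k r < 0)).
Proof.
intros Hd Hf Huf Hdl HT Hac.
destruct (choice (fun alpha x => 0 <= x <= T /\ forall r, 0 <= r <= T ->
   tonelli d f dl alpha k x <= tonelli d f dl alpha k r)) as [x Hx].
{ intros alpha. apply min_on; [lra|]. intros; now apply tonelli_continuous. }
set (m := fun alpha => tonelli d f dl alpha k (x alpha)).
assert (Hm : continuity m).
{ intros alpha. apply continuous_pt, eps_continuous. intros e He.
  destruct (tonelli_dep d f dl k T (e / 2) Hd Hf Huf Hdl HT ltac:(lra)) as [rho [Hrho K]].
  exists rho. split; auto. intros al' Hal'.
  destruct (Hx alpha) as [X1 X2]. destruct (Hx al') as [X1' X2'].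
  assert (A1 := X2 (x al') X1'). assert (A2 := X2' (x alpha) X1).
  assert (B1 := K al' alpha Hal' (x alpha) ltac:(lra)).
  assert (B2 := K al' alpha Hal' (x al') ltac:(lra)).
  fold (m alpha) (m al') in *. unfold m in *.
  apply Rabs_le_between in B1. apply Rabs_le_between in B2. apply Rabs_def1; lra. }
destruct (Rle_lt_dec 0 (m a)) as [Ha|Ha].
- exists a. split; [lra|]. left. split; auto. intros r Hr.
  apply Rle_trans with (m a); auto. apply (Hx a); auto.
- destruct (Rle_lt_dec 0 (m c)) as [Hc|Hc].
  + destruct (IVT_gen m a c 0 Hm) as [alpha [H1 H2]]; [minmax|].
    exists alpha. split; [revert H1; minmax|]. right; left. split.
    * intros r Hr. rewrite <- H2. apply (Hx alpha); auto.
    * exists (x alpha). split; [apply (Hx alpha)|auto].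
  + exists c. split; [lra|]. right; right. split; auto. exists (x c). split; [apply (Hx c)|auto].
Qed.

(** If the approximations were started at [c] and became negative for a set of indices in [U], their
    limit would be an exact solution from [c] that is not positive. The other outcomes pass to the
    limit as stated. *)
Lemma shoot_finite d (f : R -> R) B a c T :
  (1 <= d)%nat -> (forall s, continuous f s) -> unif_cont f -> (forall s, Rabs (f s) <= B) ->
  a <= c -> 0 < T ->
  (forall v, radial_fix d f c v -> forall r, 0 <= r -> 0 < v r) ->
  exists alpha v, a <= alpha <= c /\ radial_fix d f alpha v /\
    (forall r, 0 <= r <= T -> 0 <= v r) /\
    (alpha = a \/ exists r, 0 <= r <= T /\ v r = 0).
Proof.
intros Hd Hf Huf HB Hac HT Hpos.
destruct ultrafilter_exists as [U HU].
assert (HB0 : 0 <= B) by (apply Rle_trans with (2 := HB 0), Rabs_pos).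
(* The delay tends to 0 while [k dl = n + 1] tends to infinity, so every bounded interval is
   eventually covered. *)
set (dl := fun n => / INR (S n)). set (k := fun n => (S n * S n)%nat).
assert (HSn : forall n, 0 < INR (S n)) by (intros n; apply lt_0_INR; lia).
assert (Hdl : forall n, 0 < dl n) by (intros n; apply Rinv_0_lt_compat; auto).
destruct (choice (fun n alpha => a <= alpha <= c /\
   ((alpha = a /\ forall r, 0 <= r <= T -> 0 <= tonelli d f (dl n) alpha (k n) r) \/
    ((forall r, 0 <= r <= T -> 0 <= tonelli d f (dl n) alpha (k n) r) /\
       exists r, 0 <= r <= T /\ tonelli d f (dl n) alpha (k n) r = 0) \/
    (alpha = c /\ exists r, 0 <= r <= T /\ tonelli d f (dl n) alpha (k n) r < 0)))) as [al Hal].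
{ intros n. apply tonelli_shoot; auto. }
set (u := fun n => tonelli d f (dl n) (al n) (k n)).
destruct (approx_limit U d f B a c al u) as [alpha [v [Ha [Hv [L1 [L2 _]]]]]]; auto.
- intros n. apply Hal.
- intros n r. now apply tonelli_continuous.
- intros T' e HT' He.
  destruct (nfloor_ex (T' + B * T' / e)) as [n0 Hn0].
  { assert (0 <= B * T' / e); [|lra]. apply Rmult_le_pos; [apply Rmult_le_pos; lra|left; now apply Rinv_0_lt_compat]. }
  apply (ultra_eventually _ HU n0). intros n Hn r Hr.
  assert (Hn1 : T' + B * T' / e <= INR (S n)).
  { apply le_INR in Hn. rewrite S_INR. lra. }
  assert (0 <= B * T' / e) by (apply Rmult_le_pos; [apply Rmult_le_pos; lra|left; now apply Rinv_0_lt_compat]).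
  apply Rle_trans with (B * T' * dl n).
  + apply tonelli_approx; auto; [|lra]. split; [lra|]. unfold k, dl. rewrite mult_INR.
    replace (INR (S n) * INR (S n) * / INR (S n)) with (INR (S n)) by (field; specialize (HSn n); lra). lra.
  + unfold dl. apply (Rmult_le_reg_r (INR (S n))); auto.
    rewrite Rmult_assoc, Rinv_l, Rmult_1_r by (specialize (HSn n); lra).
    replace (B * T') with (e * (B * T' / e)) by (field; lra). apply Rmult_le_compat_l; lra.
- assert (Hv0 : v 0 = alpha) by (eapply radial_fix_center; eauto).
  assert (Hnn : U (fun n => forall r, 0 <= r <= T -> 0 <= u n r) -> forall r, 0 <= r <= T -> 0 <= v r).
  { intros HP r Hr. apply Rnot_lt_le. intros Hneg.
    destruct (ultra_ex _ HU _ (ultra_and _ HU _ _ HP (L2 T (- v r) HT ltac:(lra)))) as [n [H1 H2]].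
    specialize (H1 r Hr). specialize (H2 r Hr). apply Rabs_def2 in H2. lra. }
  assert (Hzero : U (fun n => exists r, 0 <= r <= T /\ u n r <= 0) -> exists r, 0 <= r <= T /\ v r <= 0).
  { intros HP. apply NNPP. intros Hn.
    destruct (min_on v 0 T) as [y [Hy1 Hy2]]; [lra|intros; apply Hv|].
    assert (Hvy : 0 < v y). { apply Rnot_le_lt. intros Hle. apply Hn. exists y; auto. }
    destruct (ultra_ex _ HU _ (ultra_and _ HU _ _ HP (L2 T (v y) HT Hvy))) as [n [[r [Hr1 Hr2]] H2]].
    specialize (H2 r Hr1). specialize (Hy2 r Hr1). apply Rabs_def2 in H2. lra. }
  destruct (ultra_or _ HU
     (fun n => al n = a /\ forall r, 0 <= r <= T -> 0 <= u n r)
     (fun n => ((forall r, 0 <= r <= T -> 0 <= u n r) /\ exists r, 0 <= r <= T /\ u n r = 0) \/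
        (al n = c /\ exists r, 0 <= r <= T /\ u n r < 0))) as [HP|HP].
  { intros n. apply Hal. }
  + exists alpha, v. split; [|split; [|split]]; auto.
    * apply Hnn. apply (ultra_mono _ HU _ _ (fun n Hn => proj2 Hn) HP).
    * left. apply Rminus_diag_uniq. apply NNPP. intros Hne. apply Rabs_pos_lt in Hne.
      destruct (ultra_ex _ HU _ (ultra_and _ HU _ _ HP (L1 _ Hne))) as [n [[H1 _] H2]].
      rewrite H1, Rabs_minus_sym in H2. lra.
  + assert (HZ : exists r, 0 <= r <= T /\ v r <= 0).
    { apply Hzero. apply (ultra_mono _ HU _ _) with (2 := HP). intros n [[_ [r [H1 H2]]]|[_ [r [H1 H2]]]];
      exists r; split; auto; lra. }
    destruct (ultra_or _ HU (fun n => forall r, 0 <= r <= T -> 0 <= u n r)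
       (fun n => al n = c \/ ~ (forall r, 0 <= r <= T -> 0 <= u n r))) as [HQ|HQ].
    { intros n. destruct (classic (forall r, 0 <= r <= T -> 0 <= u n r)); auto. }
    * exists alpha, v. split; [|split; [|split]]; auto. right. destruct HZ as [r [H1 H2]].
      exists r. split; auto. assert (0 <= v r) by (apply Hnn; auto). lra.
    * exfalso. assert (alpha = c).
      { apply Rminus_diag_uniq. apply NNPP. intros Hne. apply Rabs_pos_lt in Hne.
        destruct (ultra_ex _ HU _ (ultra_and _ HU _ _ (ultra_and _ HU _ _ HP HQ) (L1 _ Hne)))
          as [n [[H1 H2] H3]].
        assert (al n = c).
        { destruct H2 as [|H2]; auto. destruct H1 as [[H1 _]|[H1 _]]; auto. contradiction. }
        rewrite H, Rabs_minus_sym in H3. lra. }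
      rewrite H in Hv. destruct HZ as [r [H1 H2]]. assert (0 < v r) by (apply (Hpos v Hv); lra). lra.
Qed.

(** Here the horizon [T = n + 1] tends to infinity. Starting from [a] is excluded because such
    solutions become negative, so the approximants have zeros. The energy is nonnegative at a zero,
    hence before it, and this passes to the limit as long as the limit is positive. *)
Lemma shooting d (f F : R -> R) B b beta a c :
  (1 <= d)%nat -> admissible f F b beta -> unif_cont f -> (forall s, Rabs (f s) <= B) ->
  b < a -> a <= c ->
  (forall v p, profile d f v p -> v 0 = a -> exists r, 0 <= r /\ v r < 0) ->
  (forall v p, profile d f v p -> v 0 = c -> forall r, 0 <= r -> 0 < v r) ->
  exists u p, profile d f u p /\ a <= u 0 <= c /\ (forall r, 0 <= r -> 0 <= u r) /\
    (forall r, 0 < r -> (forall t, 0 <= t <= r -> 0 < u t) -> 0 <= energy F u p r).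
Proof.
intros Hd HA Huf HB Hba Hac Hneg Hpos.
assert (Hf := admissible_cont _ _ _ _ HA).
destruct ultrafilter_exists as [U HU].
assert (HSn : forall n, 0 < INR (S n)) by (intros n; apply lt_0_INR; lia).
destruct (choice (fun n (x : R * (R -> R)) => a <= fst x <= c /\ radial_fix d f (fst x) (snd x) /\
    (forall r, 0 <= r <= INR (S n) -> 0 <= snd x r) /\
    (fst x = a \/ exists r, 0 <= r <= INR (S n) /\ snd x r = 0))) as [x Hx].
{ intros n. destruct (shoot_finite d f B a c (INR (S n))) as [alpha [v Hv]]; auto.
  - intros v Hv. eapply Hpos; [eapply radial_fix_profile; eauto|eapply radial_fix_center; eauto].
  - exists (alpha, v). exact Hv. }
set (al := fun n => fst (x n)). set (u := fun n => snd (x n)).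
destruct (approx_limit U d f B a c al u) as [alpha [v [Ha [Hv [L1 [L2 L3]]]]]]; auto.
- intros n. apply Hx.
- intros n. apply (Hx n).
- intros T e HT He. apply (ultra_eventually _ HU 0). intros n _ r Hr.
  destruct (Hx n) as [_ [[_ E] _]]. fold (al n) (u n) in E. rewrite <- E.
  unfold Rminus. rewrite Rplus_opp_r, Rabs_R0. lra.
- assert (HP := radial_fix_profile d f alpha v Hd Hf Hv).
  assert (Hv0 : v 0 = alpha) by (eapply radial_fix_center; eauto).
  assert (Hnn : forall r, 0 <= r -> 0 <= v r).
  { intros r Hr. apply Rnot_lt_le. intros Hlt.
    destruct (nfloor_ex r Hr) as [n0 Hn0].
    destruct (ultra_ex _ HU _ (ultra_and _ HU _ _
      (ultra_eventually _ HU n0 (fun n => (n0 <= n)%nat) (fun n H => H))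
      (L2 (r + 1) (- v r) ltac:(lra) ltac:(lra)))) as [n [H1 H2]].
    specialize (H2 r ltac:(lra)). apply Rabs_def2 in H2. apply le_INR in H1.
    destruct (Hx n) as [_ [_ [K _]]]. specialize (K r ltac:(rewrite S_INR; lra)). fold (u n) in K. lra. }
  exists v, (radial_slope d (fun t => f (v t))). rewrite Hv0.
  split; [exact HP|split; [exact Ha|split; [exact Hnn|]]].
  intros r Hr Hvp.
  destruct (min_on v 0 r) as [y [Hy1 Hy2]]; [lra|intros; apply Hv|].
  assert (Hvy : 0 < v y) by (apply Hvp; auto).
  apply le_epsilon. intros e He. rewrite Rplus_comm.
  set (p := radial_slope d (fun t => f (v t))) in *.
  destruct (continuous_eps F (v r) (e / 2)) as [e1 [He1 K1]]; [|lra|].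
  { eapply derive_continuous, (admissible_prim _ _ _ _ HA). }
  destruct (continuous_eps (fun z => z ^ 2 / 2) (p r) (e / 2)) as [e2 [He2 K2]]; [|lra|].
  { apply (derive_continuous _ _ (p r)). auto_derive; auto; field. }
  destruct (ultra_or _ HU (fun n => al n = a) (fun n => exists z, 0 <= z <= INR (S n) /\ u n z = 0)) as [HQ|HQ].
  { intros n. apply Hx. }
  + exfalso. assert (alpha = a).
    { apply Rminus_diag_uniq. apply NNPP. intros Hne. apply Rabs_pos_lt in Hne.
      destruct (ultra_ex _ HU _ (ultra_and _ HU _ _ HQ (L1 _ Hne))) as [n [H1 H2]].
      rewrite H1, Rabs_minus_sym in H2. lra. }
    destruct (Hneg v p HP) as [z [Hz1 Hz2]]; [congruence|]. specialize (Hnn z Hz1). lra.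
  + destruct (ultra_ex _ HU _ (ultra_and _ HU _ _ (ultra_and _ HU _ _ HQ (L2 r (v y) Hr Hvy))
       (ultra_and _ HU _ _ (L2 r e1 Hr He1) (L3 r e2 Hr He2))))
      as [n [[[z [Hz1 Hz2]] H2] [H3 H4]]].
    destruct (Hx n) as [_ [Hfix _]]. fold (al n) (u n) in Hfix.
    assert (HPn := radial_fix_profile d f _ _ Hd Hf Hfix).
    set (pn := radial_slope d (fun t => f (u n t))) in *.
    (* [u n] differs from [v] by less than the minimum [v y] of [v] on [[0, r]], so it has no zero
       there. *)
    assert (Hrz : r < z).
    { apply Rnot_le_lt. intros Hle. specialize (H2 z ltac:(lra)). specialize (Hy2 z ltac:(lra)).
      rewrite Hz2 in H2. apply Rabs_def2 in H2. lra. }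
    assert (E := energy_le d f F (u n) pn b beta r z HPn HA ltac:(lra)).
    unfold energy in E. rewrite Hz2, (admissible_F0 _ _ _ _ HA) in E.
    assert (0 <= pn z ^ 2) by apply pow2_ge_0.
    specialize (K1 (u n r) (H3 r ltac:(lra))). specialize (K2 (pn r) (H4 r ltac:(lra))).
    apply Rabs_def2 in K1. apply Rabs_def2 in K2. unfold energy. lra.
Qed.

(** * Profiles and radial solutions *)

Lemma profile_radial_sol d (f g u p : R -> R) :
  (forall s, continuous f s) -> profile d f u p -> (forall r, 0 < r -> g (u r) = f (u r)) ->
  radial_sol (S d) g u.
Proof.
intros Hf H Hg.
assert (Dloc : forall r, 0 < r -> locally r (fun t : R => - p t = Derive u t)).
{ intros r Hr. exists (mkposreal r Hr). intros t Ht. apply Rabs_def2 in Ht.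
  unfold minus, plus, opp in Ht. simpl in Ht. symmetry.
  apply is_derive_unique, (profile_u _ _ _ _ H). lra. }
assert (D1 : forall r, 0 < r -> is_derive (Derive u) r (- (f (u r) - INR d / r * p r))).
{ intros r Hr. apply (is_derive_ext_loc (fun t => - p t)); auto.
  apply (is_derive_opp p), (profile_p _ _ _ _ H); auto. }
assert (D2 : forall r, 0 < r -> Derive (Derive u) r = - (f (u r) - INR d / r * p r)).
{ intros r Hr. apply is_derive_unique; auto. }
split; [|split].
- intros r Hr. split; [eexists; apply (profile_u _ _ _ _ H); auto|].
  split; [eexists; apply D1; auto|]. split.
  + apply (continuous_ext_loc _ (fun t => - (f (u t) - INR d / t * p t))).
    * exists (mkposreal r Hr). intros t Ht. apply Rabs_def2 in Ht.
      unfold minus, plus, opp in Ht. simpl in Ht. symmetry. apply D2. lra.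
    * apply (continuous_opp (fun t => f (u t) - INR d / t * p t)).
      apply (continuous_minus (fun t => f (u t)) (fun t => INR d / t * p t)).
      -- apply (continuous_comp u f); auto. eapply profile_cu; eauto; lra.
      -- apply (continuous_mult (fun t => INR d / t) p); [|eapply profile_cp; eauto; lra].
         apply (derive_continuous _ r (- INR d / r ^ 2)). auto_derive; [lra|field; lra].
  + rewrite D2, Hg, (is_derive_unique _ _ _ (profile_u _ _ _ _ H r Hr)), S_INR by auto. field. lra.
- apply (filterlim_filter_le_1 (F := locally 0) (G := at_right 0)); [|apply H].
  intros P HP. apply filter_le_within, HP.
- apply (filterlim_ext_loc (fun t => - p t)).
  + exists (mkposreal 1 Rlt_0_1). intros t _ Ht. symmetry.
    apply is_derive_unique, (profile_u _ _ _ _ H). lra.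
  + apply (filterlim_filter_le_1 (F := locally 0) (G := at_right 0)).
    * intros P HP. apply filter_le_within, HP.
    * replace 0 with (- p 0) at 2 by (rewrite (profile_p0 _ _ _ _ H); ring).
      apply (continuous_opp p), H.
Qed.

Lemma filterlim_right_continuous (g : R -> R) (l : R) :
  filterlim g (at_right 0) (locally l) ->
  continuous (fun r => if Rle_dec r 0 then l else g r) 0.
Proof.
intros Hg. apply eps_continuous. intros e He.
destruct (Rle_dec 0 0); [|lra].
destruct (proj1 (filterlim_locally g l) Hg (mkposreal e He)) as [dl K].
exists dl. split; [apply cond_pos|]. intros y Hy. destruct (Rle_dec y 0).
- rewrite Rminus_eq_0, Rabs_R0. auto.
- apply (K y Hy). lra.
Qed.

Lemma radial_sol_profile d (g f u : R -> R) :
  radial_sol (S d) g u -> (forall r, 0 < r -> g (u r) = f (u r)) ->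
  profile d f (fun r => if Rle_dec r 0 then u 0 else u r)
    (fun r => if Rle_dec r 0 then 0 else - Derive u r).
Proof.
intros [H1 [H2 H3]] Hg.
assert (Hloc : forall (a b : R -> R) (x r : R), 0 < r ->
   locally r (fun t : R => b t = (if Rle_dec t 0 then x else b t))).
{ intros a b x r Hr. exists (mkposreal r Hr). intros t Ht. apply Rabs_def2 in Ht.
  unfold minus, plus, opp in Ht. simpl in Ht. destruct (Rle_dec t 0); [lra|reflexivity]. }
split.
- intros r Hr. destruct (Rle_dec r 0); [lra|]. destruct (H1 r Hr) as [E _].
  apply (is_derive_ext_loc u); [apply (Hloc u u); auto|].
  rewrite Ropp_involutive. now apply Derive_correct.
- intros r Hr. destruct (Rle_dec r 0); [lra|]. destruct (H1 r Hr) as [_ [E [_ E2]]].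
  apply (is_derive_ext_loc (fun t => - Derive u t)).
  { apply (Hloc u (fun t => - Derive u t)); auto. }
  rewrite <- Hg by auto.
  replace (g (u r) - INR d / r * - Derive u r) with (- Derive (Derive u) r).
  + apply (is_derive_opp (Derive u)). now apply Derive_correct.
  + rewrite S_INR in E2. replace (INR d + 1 - 1) with (INR d) in E2 by ring. lra.
- now apply filterlim_right_continuous.
- apply (filterlim_right_continuous (fun r => - Derive u r)).
  apply (filterlim_comp _ _ _ (Derive u) Ropp (at_right 0) (locally 0)); auto.
  replace 0 with (- 0) at 2 by ring. apply (continuous_opp (fun x => x) 0), continuous_id.
- destruct (Rle_dec 0 0); lra.
Qed.

(** At [c] the left quotients are those of [g] and the right ones are 0; they have the same limit
    because the derivative at [c] vanishes. *)
Lemma derive_stop (g : R -> R) c r l :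
  is_derive g (Rmin r c) l -> (c <= r -> l = 0) -> is_derive (fun t => g (Rmin t c)) r l.
Proof.
intros Hg Hl. destruct (Rlt_le_dec r c) as [Hr|Hr].
- rewrite Rmin_left in Hg by lra. apply (is_derive_ext_loc g); auto.
  assert (Hr' : 0 < c - r) by lra. exists (mkposreal _ Hr'). intros t Ht. apply Rabs_def2 in Ht.
  unfold minus, plus, opp in Ht. simpl in Ht. rewrite Rmin_left; [reflexivity|lra].
- rewrite Rmin_right in Hg by lra. rewrite (Hl Hr) in *.
  apply is_derive_Reals in Hg. apply is_derive_Reals. intros e He.
  destruct (Hg e He) as [dl K]. exists dl. intros h Hh0 Hh. rewrite (Rmin_right r c) by lra.
  destruct (Rlt_le_dec (r + h) c) as [Hrh|Hrh].
  (* Only the part [k] of the increment that lies below [c] counts, and [0 <= k / h <= 1]. *)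
  + rewrite Rmin_left by lra. set (k := r + h - c).
    assert (Hk : h <= k < 0) by (unfold k; lra).
    assert (Kk := K k ltac:(lra)). replace (c + k) with (r + h) in Kk by (unfold k; ring).
    rewrite Rminus_0_r in *. rewrite Rabs_left in Hh by lra.
    specialize (Kk ltac:(rewrite Rabs_left; lra)).
    replace ((g (r + h) - g c) / h) with ((g (r + h) - g c) / k * (k / h)) by (field; lra).
    rewrite Rabs_mult.
    assert (Hkh : 0 <= k / h <= 1).
    { replace (k / h) with (- k * / - h) by (field; lra).
      assert (0 < / - h) by (apply Rinv_0_lt_compat; lra). split; [apply Rmult_le_pos; lra|].
      apply (Rmult_le_reg_r (- h)); [lra|]. rewrite Rmult_assoc, Rinv_l by lra. lra. }
    rewrite (Rabs_right (k / h)) by lra. assert (Ha := Rabs_pos ((g (r + h) - g c) / k)). nra.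
  + rewrite Rmin_right by lra. replace ((g c - g c) / h - 0) with 0 by (field; lra).
    rewrite Rabs_R0; auto.
Qed.

Lemma profile_stop d f u p c :
  profile d f u p -> f 0 = 0 -> 0 < c -> u c = 0 -> p c = 0 ->
  profile d f (fun r => u (Rmin r c)) (fun r => p (Rmin r c)).
Proof.
intros H Hf Hc Hu Hp. split.
- intros r Hr. apply derive_stop.
  + apply (profile_u _ _ _ _ H). minmax.
  + intros Hcr. rewrite Rmin_right, Hp by lra. eqR. ring.
- intros r Hr. apply derive_stop.
  + assert (D := profile_p _ _ _ _ H (Rmin r c) ltac:(minmax)).
    destruct (Rle_dec r c) as [Hrc|Hrc].
    * rewrite Rmin_left in * by lra. auto.
    * rewrite Rmin_right in * by lra. rewrite Hu, Hp, Hf in *.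
      replace (0 - INR d / r * 0) with (0 - INR d / c * 0) by ring. auto.
  + intros Hcr. rewrite Rmin_right, Hp, Hu, Hf by lra. eqR. ring.
- apply (continuous_comp (fun r => Rmin r c) u).
  + apply (continuous_ext_loc _ (fun r => r)); [|apply continuous_id].
    exists (mkposreal c Hc). intros t Ht. apply Rabs_def2 in Ht.
    unfold minus, plus, opp in Ht. simpl in Ht. rewrite Rmin_left; [reflexivity|lra].
  + rewrite Rmin_left by lra. apply H.
- apply (continuous_comp (fun r => Rmin r c) p).
  + apply (continuous_ext_loc _ (fun r => r)); [|apply continuous_id].
    exists (mkposreal c Hc). intros t Ht. apply Rabs_def2 in Ht.
    unfold minus, plus, opp in Ht. simpl in Ht. rewrite Rmin_left; [reflexivity|lra].
  + rewrite Rmin_left by lra. apply H.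
- rewrite Rmin_left by lra. apply H.
Qed.

(** After a first zero [u] could leave 0 again, as uniqueness may fail there; being nonnegative it
    has zero slope at that point, so it can be stopped and continued by 0. Without a zero it
    decreases through all positive levels. *)
Lemma profile_ground_state d f F b beta u p :
  (1 <= d)%nat -> admissible f F b beta -> f 0 = 0 -> profile d f u p -> b < u 0 ->
  (forall r, 0 <= r -> 0 <= u r) ->
  (forall r, 0 < r -> (forall t, 0 <= t <= r -> 0 < u t) -> 0 <= energy F u p r) ->
  exists v q, profile d f v q /\ v 0 = u 0 /\ (forall r, 0 <= r -> 0 <= v r) /\ is_lim v p_infty 0.
Proof.
intros Hd HA Hf0 H Hu0 Hu HE. destruct (admissible_b _ _ _ _ HA) as [Hb0 Hbb].
destruct (classic (exists r, 0 <= r /\ u r <= 0)) as [[r [Hr1 Hr2]]|Hn].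
- assert (Hr0 : 0 < r). { destruct (Req_dec r 0); [subst; lra|lra]. }
  assert (Hur : u r = 0) by (apply Rle_antisym; auto).
  exists (fun t => u (Rmin t r)), (fun t => p (Rmin t r)). split; [|split; [|split]].
  + apply profile_stop; auto. eapply slope_zero_at_min; eauto.
  + rewrite Rmin_left; lra.
  + intros t Ht. apply Hu. minmax.
  + apply (is_lim_ext_loc (fun _ => 0)); [|apply is_lim_const].
    exists r. intros t Ht. rewrite Rmin_right; lra.
- assert (Hpos : forall r, 0 <= r -> 0 < u r).
  { intros r Hr. apply Rnot_le_lt. intros Hle. apply Hn. exists r; auto. }
  exists u, p. split; [|split; [|split]]; auto.
  assert (Hp : forall r, 0 < r -> 0 < p r).
  { intros r Hr. apply (slope_pos d f F u p b beta r); auto; try lra.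
    - intros; apply Hpos; lra.
    - apply HE; auto. intros; apply Hpos; lra. }
  assert (Hreach := descent d f F u p b beta H HA Hd Hu0 HE).
  apply is_lim_spec. intros [e He]. simpl.
  destruct (Hreach (Rmin (e / 2) (u 0 / 2))) as [r [Hr1 [Hr2 _]]]; [minmax|].
  exists r. intros t Ht. assert (u t < u r) by decr.
  rewrite Rminus_0_r, Rabs_right by (apply Rle_ge, Hu; lra). rewrite Hr2 in H0. revert H0. minmax.
Qed.

(** * The nonlinearities *)

Lemma within_eps (D : R -> Prop) (g : R -> R) x e :
  filterlim g (within D (locally x)) (locally (g x)) -> 0 < e ->
  exists dl, 0 < dl /\ forall y, D y -> Rabs (y - x) < dl -> Rabs (g y - g x) < e.
Proof.
intros Hg He. destruct (proj1 (filterlim_locally g (g x)) Hg (mkposreal e He)) as [dl K].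
exists dl. split; [apply cond_pos|]. intros y Dy Hy. exact (K y Hy Dy).
Qed.

(** Turns the continuity of (H1) and (H5), relative to an interval, into continuity on the whole
    line. *)
Lemma within_retract_continuous (D : R -> Prop) (g k : R -> R) :
  (forall x, D (k x)) -> (forall x y, Rabs (k x - k y) <= Rabs (x - y)) ->
  (forall x, D x -> filterlim g (within D (locally x)) (locally (g x))) ->
  forall x, continuous (fun t => g (k t)) x.
Proof.
intros Hk Hlip Hg x. apply eps_continuous. intros e He.
destruct (within_eps D g (k x) e (Hg _ (Hk x)) He) as [dl [Hdl K]].
exists dl. split; auto. intros y Hy. apply K; auto. apply Rle_lt_trans with (2 := Hy), Hlip.
Qed.

Lemma retract_continuous (g k : R -> R) :
  (forall x y, Rabs (k x - k y) <= Rabs (x - y)) -> (forall x, continuous g x) ->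
  forall x, continuous (fun t => g (k t)) x.
Proof.
intros Hk Hg. apply (within_retract_continuous (fun _ => True)); auto.
intros x _. apply (filterlim_filter_le_1 (F := locally x) (G := within (fun _ => True) (locally x))).
- intros P HP. apply filter_le_within, HP.
- apply Hg.
Qed.

Lemma Rmin_lip a x y : Rabs (Rmin x a - Rmin y a) <= Rabs (x - y).
Proof. unfold Rmin; repeat destruct Rle_dec; unfold Rabs; repeat destruct Rcase_abs; lra. Qed.

Lemma Rmax_lip a x y : Rabs (Rmax a x - Rmax a y) <= Rabs (x - y).
Proof. unfold Rmax; repeat destruct Rle_dec; unfold Rabs; repeat destruct Rcase_abs; lra. Qed.

Definition clamp (a c x : R) : R := Rmax a (Rmin x c).

Lemma clamp_lip a c x y : Rabs (clamp a c x - clamp a c y) <= Rabs (x - y).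
Proof. apply Rle_trans with (1 := Rmax_lip _ _ _). apply Rmin_lip. Qed.

Lemma clamp_range a c x : a <= c -> a <= clamp a c x <= c.
Proof. intros H. unfold clamp. minmax. Qed.

Lemma clamp_id a c x : a <= x <= c -> clamp a c x = x.
Proof. intros H. unfold clamp. minmax. Qed.

Lemma clamped_unif_cont (f : R -> R) a c :
  a <= c -> (forall x, continuous f x) -> (forall x, f x = f (clamp a c x)) ->
  unif_cont f /\ exists B, forall x, Rabs (f x) <= B.
Proof.
intros Hac Hf Hcl. split.
- intros e He.
  destruct (Heine f (fun x => a <= x <= c) (compact_P3 a c)
    (fun x _ => continuous_pt f x (Hf x)) (mkposreal e He)) as [[dl Hdl] K]. simpl in K.
  exists dl. split; auto. intros x y Hxy. rewrite (Hcl x), (Hcl y). left. apply K.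
  + now apply clamp_range.
  + now apply clamp_range.
  + apply Rle_lt_trans with (2 := Hxy), clamp_lip.
- destruct (max_on f a c Hac) as [M [_ HM]]; [intros; apply Hf|].
  destruct (min_on f a c Hac) as [m [_ Hm]]; [intros; apply Hf|].
  exists (Rabs (f M) + Rabs (f m)). intros x. rewrite Hcl.
  specialize (HM _ (clamp_range a c x Hac)). specialize (Hm _ (clamp_range a c x Hac)).
  revert HM Hm. unfold Rabs. repeat destruct Rcase_abs; lra.
Qed.

(** Negativity of [f1] near 0 gives [b > 0] and makes [F] negative on [(0, b]], so [beta] cannot
    equal [b]; from [b] on, [F] increases to its zero [beta]. *)
Lemma H1_admissible f1 b beta :
  H1 f1 b beta ->
  exists F, admissible (fun s => f1 (Rmax 0 s)) F b beta /\ forall s, 0 <= s -> F s = prim f1 s.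
Proof.
intros [Hc [_ [H0 [Hb0 [Hpos [Hneg [[e0 [He0 Hne]] [Hbb [Hpb _]]]]]]]]].
set (f := fun s => f1 (Rmax 0 s)).
assert (Hf : forall s, continuous f s).
{ apply (within_retract_continuous (fun t => 0 <= t) f1 (Rmax 0)); auto.
  - intros x. minmax.
  - intros x y. apply Rmax_lip. }
assert (Hff : forall s, 0 <= s -> f s = f1 s) by (intros s Hs; unfold f; rewrite Rmax_right; auto).
set (F := RInt f 0).
assert (HF : forall s, is_derive F s (f s)) by (intros s; now apply derive_RInt_cont).
assert (HFc : forall s, continuous F s) by (intros s; eapply derive_continuous, HF).
assert (HF0 : F 0 = 0) by (unfold F; rewrite RInt_point; reflexivity).
assert (HFp : forall s, 0 <= s -> F s = prim f1 s).
{ intros s Hs. unfold F, prim. apply RInt_ext. intros x Hx.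
  rewrite Rmin_left, Rmax_right in Hx by lra. apply Hff; lra. }
assert (Hb : 0 < b).
{ destruct (Req_dec b 0) as [->|]; [|lra]. specialize (Hpos (e0 / 2) ltac:(lra)).
  specialize (Hne (e0 / 2) ltac:(lra)). lra. }
assert (HFb : forall s, 0 < s <= b -> F s < 0).
{ intros s Hs. set (x := Rmin s (e0 / 2)).
  assert (Hx : 0 < x <= s /\ x < e0) by (unfold x; minmax).
  assert (F x < F 0).
  { apply (decr_lt F f); auto; try lra. intros t Ht. rewrite Hff by lra. apply Hne; lra. }
  assert (F s <= F x).
  { apply (nonincr_le F f); auto; try lra. intros t Ht. rewrite Hff by lra. apply Hneg; lra. }
  lra. }
assert (HFbeta : F beta = 0) by (rewrite HFp; auto; lra).
assert (Hbb' : b < beta).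
{ destruct (Req_dec b beta) as [E|]; [|lra]. specialize (HFb b ltac:(lra)). rewrite E in HFb. lra. }
exists F. split; auto. split; auto.
- intros s Hs. rewrite Hff by lra. auto.
- intros s Hs. destruct (Rle_lt_dec s b) as [Hsb|Hsb]; [apply HFb; lra|].
  assert (- F beta < - F s); [|lra].
  apply (decr_lt (fun x => - F x) (fun x => - f x)); try lra.
  + intros x _. apply (continuous_opp F), HFc.
  + intros x _. apply (is_derive_opp F), HF.
  + intros x Hx. rewrite Hff by lra. assert (0 < f1 x) by (apply Hpos; lra). lra.
Qed.

Lemma H2_pohozaev_cond d f1 F b beta :
  H1 f1 b beta -> H2 (S d) f1 beta ->
  admissible (fun s => f1 (Rmax 0 s)) F b beta -> (forall s, 0 <= s -> F s = prim f1 s) ->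
  pohozaev_cond d (fun s => f1 (Rmax 0 s)) F beta.
Proof.
intros HH1 HH2 HA HF s Hs. destruct (admissible_b _ _ _ _ HA) as [Hb0 Hbb].
assert (Hloc : locally s (fun t : R => prim f1 t / f1 t = F t / f1 (Rmax 0 t))).
{ assert (Hs0 : 0 < s) by lra. exists (mkposreal s Hs0). intros t Ht. apply Rabs_def2 in Ht.
  unfold minus, plus, opp in Ht. simpl in Ht. rewrite HF, Rmax_right by lra. reflexivity. }
assert (Hfs : 0 < f1 s).
{ destruct HH1 as [_ [_ [_ [_ [Hp _]]]]]. apply Hp; lra. }
assert (Dq : ex_derive (fun t => prim f1 t / f1 t) s).
{ destruct HH1 as [_ [Hd _]]. destruct (Hd s ltac:(lra)) as [Hf _].
  apply (ex_derive_ext_loc (fun t => F t / f1 t)).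
  - assert (Hs0 : 0 < s) by lra. exists (mkposreal s Hs0). intros t Ht. apply Rabs_def2 in Ht.
    unfold minus, plus, opp in Ht. simpl in Ht. rewrite HF by lra. reflexivity.
  - apply (ex_derive_div F f1); auto; [|lra]. eexists. apply (admissible_prim _ _ _ _ HA). }
exists (Derive (fun t => prim f1 t / f1 t) s). split.
- apply (is_derive_ext_loc (fun t => prim f1 t / f1 t)); auto. now apply Derive_correct.
- specialize (HH2 s Hs). rewrite S_INR in HH2.
  replace (INR d - 1) with (INR d + 1 - 2) by ring. lra.
Qed.

(* The nonlinearity of the statement, kept constant outside [0, c]. *)
Definition glued_ext (f g : R -> R) (al e lam s : R) : R :=
  f (Rmin s (al + e))
  + (lam * g (al + 2 * e) - f (al + e)) * ((clamp (al + e) (al + 2 * e) s - (al + e)) / e)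
  + lam * (g (Rmax (al + 2 * e) s) - g (al + 2 * e)).

Lemma glued_ext_low f g al e lam s : 0 < e -> s <= al + e -> glued_ext f g al e lam s = f s.
Proof.
intros He Hs. unfold glued_ext, clamp.
rewrite (Rmin_left s (al + e)), (Rmin_left s (al + 2 * e)), (Rmax_left (al + e) s),
  (Rmax_left (al + 2 * e) s) by lra. field. lra.
Qed.

Lemma glued_ext_mid f g al e lam s : 0 < e -> al + e <= s <= al + 2 * e ->
  glued_ext f g al e lam s =
    f (al + e) + (lam * g (al + 2 * e) - f (al + e)) * ((s - (al + e)) / e).
Proof.
intros He Hs. unfold glued_ext. rewrite clamp_id by lra.
rewrite (Rmin_right s (al + e)), (Rmax_left (al + 2 * e) s) by lra. ring.
Qed.

Lemma glued_ext_high f g al e lam s : 0 < e -> al + 2 * e <= s ->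
  glued_ext f g al e lam s = lam * g s.
Proof.
intros He Hs. unfold glued_ext, clamp.
rewrite (Rmin_right s (al + e)), (Rmin_right s (al + 2 * e)), (Rmax_right (al + e) (al + 2 * e)),
  (Rmax_right (al + 2 * e) s) by lra. field. lra.
Qed.

(** Each summand is a continuous function composed with a 1-Lipschitz truncation, so nothing has to
    be matched at the two junctions. *)
Lemma glued_ext_continuous f g al e lam : 0 < e ->
  (forall s, continuous f s) -> (forall s, continuous g s) ->
  forall s, continuous (glued_ext f g al e lam) s.
Proof.
intros He Hf Hg s. unfold glued_ext.
apply (continuous_plus
  (fun s => f (Rmin s (al + e)) +
    (lam * g (al + 2 * e) - f (al + e)) * ((clamp (al + e) (al + 2 * e) s - (al + e)) / e))
  (fun s => lam * (g (Rmax (al + 2 * e) s) - g (al + 2 * e)))).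
- apply (continuous_plus (fun s => f (Rmin s (al + e)))
    (fun s => (lam * g (al + 2 * e) - f (al + e)) * ((clamp (al + e) (al + 2 * e) s - (al + e)) / e))).
  + apply (retract_continuous f (fun s => Rmin s (al + e))); auto. intros; apply Rmin_lip.
  + apply (retract_continuous (fun x => (lam * g (al + 2 * e) - f (al + e)) * ((x - (al + e)) / e))).
    * intros; apply clamp_lip.
    * intros x. eapply derive_continuous. auto_derive; auto.
- apply (retract_continuous (fun x => lam * (g x - g (al + 2 * e))) (Rmax (al + 2 * e))).
  + intros; apply Rmax_lip.
  + intros x. apply (continuous_mult (fun _ => lam) (fun x => g x - g (al + 2 * e))); [apply continuous_const|].
    apply (continuous_minus g (fun _ => g (al + 2 * e))); auto. apply continuous_const.
Qed.

Lemma glued_ext_admissible f F g b beta al e lam :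
  admissible f F b beta -> (forall s, continuous g s) -> 0 < e -> 0 < lam -> beta < al ->
  (forall s, al <= s -> 0 < g s) ->
  exists G, admissible (glued_ext f g al e lam) G b beta /\ forall s, s <= al + e -> G s = F s.
Proof.
intros HA Hg He Hlam Hal Hgp. destruct (admissible_b _ _ _ _ HA) as [Hb0 Hbb].
assert (Hf := admissible_cont _ _ _ _ HA).
set (k := glued_ext f g al e lam).
assert (Hk : forall s, continuous k s) by (now apply glued_ext_continuous).
assert (HF : forall s, F s = RInt f 0 s).
{ intros s. assert (K : is_RInt f 0 s (minus (F s) (F 0))).
  { apply (is_RInt_derive F f); intros; [apply HA|auto]. }
  rewrite (is_RInt_unique _ _ _ _ K), (admissible_F0 _ _ _ _ HA). unfold minus, plus, opp; simpl. ring. }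
assert (HG : forall s, s <= al + e -> RInt k 0 s = F s).
{ intros s Hs. rewrite HF. apply RInt_ext. intros x Hx. apply glued_ext_low; auto.
  revert Hx. minmax. }
exists (RInt k 0). split; auto. split; auto.
- intros s. now apply derive_RInt_cont.
- rewrite RInt_point. reflexivity.
- intros s Hs. unfold k. assert (Hfe : 0 < f (al + e)) by (apply (admissible_pos _ _ _ _ HA); lra).
  destruct (Rle_lt_dec s (al + e)) as [H1|H1].
  { rewrite glued_ext_low by auto. now apply (admissible_pos _ _ _ _ HA). }
  destruct (Rle_lt_dec s (al + 2 * e)) as [H2|H2].
  + rewrite glued_ext_mid by lra. set (t := (s - (al + e)) / e).
    assert (Ht : 0 < t <= 1).
    { unfold t. split; [apply Rdiv_lt_0_compat; lra|]. apply (Rmult_le_reg_r e); auto.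
      unfold Rdiv. rewrite Rmult_assoc, Rinv_l by lra. lra. }
    assert (0 < lam * g (al + 2 * e)) by (apply Rmult_lt_0_compat; [auto|apply Hgp; lra]). nra.
  + rewrite glued_ext_high by lra. apply Rmult_lt_0_compat; [auto|apply Hgp; lra].
- intros s Hs. rewrite HG by lra. now apply (admissible_neg _ _ _ _ HA).
- rewrite HG by lra. apply HA.
Qed.

Lemma fglued_ext f1 f2 al e A c s : 0 < e -> 0 < al -> 0 <= s <= c -> al + 2 * e <= c ->
  fglued f1 f2 al e A s =
    glued_ext (fun s => f1 (Rmax 0 s)) (fun s => f2 (clamp al c s)) al e (A ^ 2) s.
Proof.
intros He Hal Hs Hc. unfold fglued, fpos. destruct (Rle_dec 0 s); [|lra].
destruct (Rle_dec s (al + e)).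
{ rewrite glued_ext_low, Rmax_right by lra. auto. }
destruct (Rle_dec s (al + 2 * e)).
- rewrite glued_ext_mid by lra. unfold Lseg. rewrite !clamp_id, Rmax_right by lra.
  unfold Rdiv. ring.
- rewrite glued_ext_high, clamp_id by lra. auto.
Qed.

Lemma glued_ext_clamp f1 g al e lam c : 0 < e -> 0 < al -> al + 2 * e <= c ->
  (forall s, g s = g (clamp al c s)) ->
  forall s, glued_ext (fun s => f1 (Rmax 0 s)) g al e lam s =
    glued_ext (fun s => f1 (Rmax 0 s)) g al e lam (clamp 0 c s).
Proof.
intros He Hal Hc Hg s. destruct (Rle_lt_dec s 0) as [H0|H0].
- assert (E : clamp 0 c s = 0) by (unfold clamp; minmax).
  rewrite E, !glued_ext_low by lra. f_equal. minmax.
- destruct (Rle_lt_dec s c) as [H1|H1]; [rewrite clamp_id; auto; lra|].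
  assert (E : clamp 0 c s = c) by (unfold clamp; minmax).
  rewrite E, !glued_ext_high by lra. f_equal. rewrite Hg. f_equal. unfold clamp; minmax.
Qed.

Lemma H5_right_interval f2 al gamma : H5 f2 al gamma ->
  exists h, 0 < h /\ Rbar_lt (al + h) gamma.
Proof.
intros [Hg _]. destruct gamma as [g| |]; simpl in *; [|exists 1; split; [lra|exact I]|contradiction].
exists ((g - al) / 2). split; lra.
Qed.

Theorem theorem4p1 (N : nat) (f1 f2 : R -> R) (b beta alpha : R) (gamma : Rbar) :
  (2 < N)%nat ->
  H1 f1 b beta -> H2 N f1 beta -> H3 f1 b -> H4 N f1 alpha -> H5 f2 alpha gamma ->
  exists epsb Ab : R, 0 < epsb /\ 0 < Ab /\
    forall eps A : R, 0 < eps < epsb -> Ab < A ->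
      exists u1 u2 : R -> R,
        ground_state N (fglued f1 f2 alpha eps A) gamma u1 /\
        ground_state N (fglued f1 f2 alpha eps A) gamma u2 /\
        exists r, 0 <= r /\ u1 r <> u2 r.
Proof.
intros HN HH1 HH2 _ [Hal0 [u [Hsol [Hu0 [Hupos Hulim]]]]] HH5.
destruct N as [|d]; [lia|]. assert (Hd : (2 <= d)%nat) by lia.
destruct (H1_admissible f1 b beta HH1) as [F [HA HFp]].
set (f := fun s => f1 (Rmax 0 s)) in *.
destruct (admissible_b _ _ _ _ HA) as [Hb0 Hbb].
assert (HPz : pohozaev_cond d f F beta) by (eapply H2_pohozaev_cond; eauto).
assert (Hfb : forall s, 0 <= s <= b -> f s <= 0).
{ intros s Hs. unfold f. rewrite Rmax_right by lra. destruct HH1 as [_ [_ [_ [_ [_ [K _]]]]]]. auto. }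
assert (Hf0 : f 0 = 0).
{ unfold f. rewrite Rmax_right by lra. destruct HH1 as [_ [_ [K _]]]. auto. }
assert (Hff : forall s, 0 <= s -> f s = f1 s) by (intros s Hs; unfold f; rewrite Rmax_right; auto).
set (uc := fun r => if Rle_dec r 0 then u 0 else u r).
set (pc := fun r => if Rle_dec r 0 then 0 else - Derive u r).
assert (HP : profile d f uc pc).
{ apply (radial_sol_profile d f1); auto. intros r Hr. symmetry. apply Hff. left. apply Hupos. lra. }
assert (Huc0 : uc 0 = alpha) by (unfold uc; destruct (Rle_dec 0 0); [auto|lra]).
assert (Hucp : forall r, 0 <= r -> 0 < uc r).
{ intros r Hr. unfold uc. destruct (Rle_dec r 0); apply Hupos; lra. }
assert (Huclim : is_lim uc p_infty 0).
{ apply (is_lim_ext_loc u); auto. exists 0. intros r Hr. unfold uc. destruct (Rle_dec r 0); [lra|auto]. }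
destruct (positive_profile d f F uc pc b beta) as [_ [Hbu _]]; auto; try lia.
assert (Hule : forall r, 0 <= r -> u r <= alpha).
{ intros r Hr. rewrite <- Huc0. destruct (Req_dec r 0) as [->|].
  - rewrite Huc0, Hu0. lra.
  - replace (u r) with (uc r) by (unfold uc; destruct (Rle_dec r 0); [lra|auto]).
    eapply profile_le_center; eauto. lra. }
rewrite Huc0 in Hbu.
destruct (H5_right_interval f2 alpha gamma HH5) as [h0 [Hh0 Hh0g]].
destruct HH5 as [_ Hf2].
assert (Hlt : forall s c, s <= c -> c <= alpha + h0 -> Rbar_lt s gamma).
{ intros s c Hs Hc. apply (Rbar_le_lt_trans s (alpha + h0) gamma); auto. simpl. lra. }
assert (Hgc : forall c, alpha <= c <= alpha + h0 -> forall s, continuous (fun s => f2 (clamp alpha c s)) s).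
{ intros c Hc. apply (within_retract_continuous (fun t => alpha <= t /\ Rbar_lt t gamma)).
  - intros x. assert (K := clamp_range alpha c x ltac:(lra)). split; [lra|]. apply (Hlt _ c); lra.
  - intros; apply clamp_lip.
  - intros x [Hx1 Hx2]. apply Hf2; auto. }
assert (Hc0 : forall s, continuous (fun s => f2 (clamp alpha (alpha + h0) s)) s) by (apply Hgc; lra).
destruct (max_on _ alpha (alpha + h0) ltac:(lra) (fun x _ => Hc0 x)) as [sM [HsM1 HsM2]].
destruct (min_on _ alpha (alpha + h0) ltac:(lra) (fun x _ => Hc0 x)) as [sm [Hsm1 Hsm2]].
cbv beta in HsM2, Hsm2. rewrite clamp_id in HsM2, Hsm2 by lra.
set (M := f2 sM) in *. set (m := f2 sm) in *.
assert (Hmpos : 0 < m). { apply (Hf2 sm); [lra|]. apply (Hlt _ (alpha + h0)); lra. }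
assert (HmM : 0 < m <= M). { split; auto. specialize (HsM2 sm Hsm1). rewrite clamp_id in HsM2 by lra. auto. }
assert (Hf2b : forall s, alpha <= s <= alpha + h0 -> m <= f2 s <= M).
{ intros s Hs. specialize (HsM2 s Hs). specialize (Hsm2 s Hs). rewrite clamp_id in HsM2, Hsm2 by lra. lra. }
set (C := 4 + 2 ^ d * 8).
assert (HC : 0 < C) by (unfold C; assert (0 < 2 ^ d) by (apply pow_lt; lra); lra).
assert (Hh1 : 0 < (alpha - beta) * m / (4 * C * M)).
{ apply Rdiv_lt_0_compat; repeat apply Rmult_lt_0_compat; lra. }
(* The second term is the largest [h] with [C h M / m <= (alpha - beta) / 4], as
   [steep_profile_positive] requires; [h0] keeps [alpha + h] below [gamma]. *)
set (h := Rmin h0 ((alpha - beta) * m / (4 * C * M))).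
assert (Hh : 0 < h /\ h <= h0 /\ h <= (alpha - beta) * m / (4 * C * M)) by (unfold h; minmax).
assert (HCh : C * (h * M / m) <= (uc 0 - beta) / 4).
{ rewrite Huc0. apply Rle_trans with (C * ((alpha - beta) * m / (4 * C * M) * M / m)).
  - apply Rmult_le_compat_l; [lra|]. unfold Rdiv at 1 2. apply Rmult_le_compat_r.
    + left; apply Rinv_0_lt_compat; lra.
    + apply Rmult_le_compat_r; lra.
  - right. field. lra. }
destruct (steep_profile_positive d f F b beta uc pc m M h) as [Lam [HLam Hsteep]]; auto; try lra.
rewrite Huc0 in Hsteep.
destruct (max_on f 0 (alpha + h)) as [sf [Hsf1 Hsf2]]; [lra|intros; apply HA|].
assert (H2d : 0 < 2 ^ d) by (apply pow_lt; lra).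
assert (HhmM : 0 < h * m / M) by (apply Rdiv_lt_0_compat; [apply Rmult_lt_0_compat|]; lra).
assert (He1 : 0 < h * m / M / (8 * 2 ^ d)) by (apply Rdiv_lt_0_compat; lra).
assert (Hfs : 0 <= Rabs (f sf) / M).
{ apply Rmult_le_pos; [apply Rabs_pos|left; apply Rinv_0_lt_compat; lra]. }
(* The bounds on [eps] are [4 e <= h] and [8 e 2^d <= h m / M] of the layer. As [A > 1] gives
   [A^2 > A], the bound on [A] yields [lam > Lam] and [f <= lam M] up to [alpha + h]. *)
exists (Rmin (h / 4) (h * m / M / (8 * 2 ^ d))), (1 + Lam + Rabs (f sf) / M).
split; [minmax|]. split; [lra|].
intros e A He HAb. set (lam := A ^ 2). set (c := alpha + h).
assert (Hlam : Lam < lam /\ Rabs (f sf) / M <= lam) by (unfold lam; simpl; nra).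
assert (He' : 0 < e /\ 4 * e <= h /\ e <= h * m / M / (8 * 2 ^ d)) by (revert He; minmax).
assert (Hek : 8 * e * 2 ^ d <= h * m / M).
{ replace (h * m / M) with (h * m / M / (8 * 2 ^ d) * (8 * 2 ^ d)) by (field; lra).
  replace (8 * e * 2 ^ d) with (e * (8 * 2 ^ d)) by ring. apply Rmult_le_compat_r; lra. }
set (g2 := fun s => f2 (clamp alpha c s)).
assert (Hg2c : forall s, continuous g2 s) by (apply Hgc; unfold c; lra).
assert (Hg2b : forall s, m <= g2 s <= M).
{ intros s. apply Hf2b. assert (K := clamp_range alpha c s ltac:(unfold c; lra)). unfold c in *. lra. }
set (g := glued_ext f g2 alpha e lam).
destruct (glued_ext_admissible f F g2 b beta alpha e lam) as [G [HAg HGF]]; auto; try lra.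
{ intros s _. specialize (Hg2b s). lra. }
fold g in HAg.
assert (Hglow : forall s, s <= alpha + e -> g s = f s) by (intros; apply glued_ext_low; lra).
assert (Hgcl : forall s, g s = g (clamp 0 c s)).
{ apply glued_ext_clamp; try (unfold c; lra). intros s. unfold g2. f_equal. symmetry. apply clamp_id.
  apply clamp_range. unfold c; lra. }
destruct (clamped_unif_cont g 0 c) as [Huf [B HB]]; auto.
{ unfold c; lra. } { apply HAg. }
assert (Hfle : forall s, s <= c -> f s <= lam * M).
{ intros s Hs. assert (Hlm : Rabs (f sf) <= lam * M).
  { destruct Hlam as [_ Hl]. apply (Rmult_le_compat_r M) in Hl; [|lra].
    replace (Rabs (f sf) / M * M) with (Rabs (f sf)) in Hl by (field; lra). auto. }
  destruct (Rle_lt_dec s 0) as [Hs0|Hs0].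
  - unfold f at 1. rewrite Rmax_left by lra. rewrite <- Hff, Hf0 by lra.
    apply Rle_trans with (2 := Hlm), Rabs_pos.
  - apply Rle_trans with (f sf); [apply Hsf2; unfold c in Hs; lra|].
    apply Rle_trans with (2 := Hlm), Rle_abs. }
assert (Hgle : forall s, s <= c -> g s <= lam * M).
{ intros s Hs. unfold g.
  assert (Hlg : forall t, lam * g2 t <= lam * M).
  { intros t. apply Rmult_le_compat_l; [lra|apply Hg2b]. }
  destruct (Rle_lt_dec s (alpha + e)).
  { rewrite glued_ext_low by lra. auto. }
  destruct (Rle_lt_dec s (alpha + 2 * e)).
  - rewrite glued_ext_mid by lra. set (t := (s - (alpha + e)) / e).
    assert (Ht : 0 < t <= 1).
    { unfold t. split; [apply Rdiv_lt_0_compat; lra|]. apply (Rmult_le_reg_r e); [lra|].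
      unfold Rdiv. rewrite Rmult_assoc, Rinv_l by lra. lra. }
    assert (K1 := Hlg (alpha + 2 * e)). assert (K2 := Hfle (alpha + e) ltac:(unfold c; lra)). nra.
  - rewrite glued_ext_high by lra. apply Hlg. }
destruct (shooting d g G B b beta (alpha + e) c) as [v [q [HPv [Hv0 [Hvn HEv]]]]]; auto; try lia; try (unfold c; lra).
(* Such a solution never exceeds its centre value [alpha + e], so it only meets [g = f] and solves
   the original equation. *)
- intros v q HPv Hv0. apply (above_ground_state_crosses d f F b beta uc pc v q); auto; [|lra].
  assert (Hvle : forall r, 0 < r -> g (v r) = f (v r)).
  { intros r Hr. apply Hglow. rewrite <- Hv0. eapply profile_le_center; eauto; lra. }
  destruct HPv as [P1 P2 P3 P4 P5]. split; auto. intros r Hr. rewrite <- Hvle by auto. auto.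
- intros v q HPv Hv0. apply (Hsteep lam e g G v q); auto; try lra.
  intros s Hs. unfold g. rewrite glued_ext_high by lra. apply Rmult_le_compat_l; [lra|apply Hg2b].
- destruct (profile_ground_state d g G b beta v q) as [w [pw [HPw [Hw0 [Hwn Hwlim]]]]]; auto; try lia; try lra.
  { rewrite Hglow by lra. auto. }
  (* Thus [w] takes values in [[0, c]], where [g] coincides with the nonlinearity of the
     statement. *)
  assert (Hwc : forall r, 0 <= r -> w r <= c).
  { intros r Hr. apply Rle_trans with (w 0); [|lra]. eapply profile_le_center; eauto. lra. }
  exists u, w. split; [|split].
  + split; [|split; [|split]]; auto.
    * destruct Hsol as [S1 S2]. split; auto. intros r Hr. destruct (S1 r Hr) as [T1 [T2 [T3 T4]]].
      repeat split; auto. rewrite <- T4. f_equal.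
      assert (0 < u r) by (apply Hupos; lra). assert (u r <= alpha) by (apply Hule; lra).
      rewrite (fglued_ext f1 f2 alpha e A c) by (unfold c; lra). fold f. rewrite glued_ext_low by lra.
      apply Hff; lra.
    * intros r Hr. split; [left; auto|]. apply (Hlt _ alpha); [auto|lra].
    * exists 0. split; [lra|]. rewrite Hu0. lra.
  + split; [|split; [|split]]; auto.
    * apply (profile_radial_sol d g) with (p := pw); auto; [apply HAg|].
      intros r Hr. apply fglued_ext; try (unfold c; lra). split; [apply Hwn|apply Hwc]; lra.
    * intros r Hr. split; auto. apply (Hlt _ c); [auto|unfold c; lra].
    * exists 0. split; [lra|]. lra.
  (* The centre values differ: [u 0 = alpha], while [w 0 >= alpha + e]. *)
  + exists 0. split; [lra|]. lra.
Qed.
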